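(* Let $f:\mathbb R^+\times L^2(\Omega)\to L^2(\Omega)$ be a continuous mapping such that $\|f(t,v)\|\le p(t)G(\|v\|)$ for all $t\in\mathbb R^+$ and $v\in L^2(\Omega)$, where $p\in L^1_{loc}(\mathbb R^+)$ is a nonnegative function and $G\in C(\mathbb R^+)$ is a nonnegative and nondecreasing function such that $$\limsup_{r\to0}\frac{G(r)}{r}\cdot\sup_{t\ge0}\int_0^t\omega(t-s,\lambda_1)p(s)ds<1$$ and $$\lim_{T\to\infty}\sup_{t\ge T}\int_0^{t/2}\omega(t-s,\lambda_1)p(s)ds=0.$$ Then there exists $\delta>0$ such that the problem $$\partial_tu-(1+\gamma\partial_t^\alpha)\Delta u=f(t,u_\rho)\ \text{in }\Omega,\ t>0;\quad u=0\ \text{on }\partial\Omega,\ t\ge 0;\quad u(x,s)=\xi(x,s),\ x\in\Omega,\ s\in[-\tau,0],$$ with $\xi\in C([-\tau,0];L^2(\Omega))$, has a compact set of decay solutions, provided $\|\xi\|_\infty\le\delta$.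
   Context: Setting: $\Omega\subset\mathbb R^d$ is a bounded domain with smooth boundary, $\gamma>0$, $\alpha\in(0,1)$, $\tau\ge0$, and $\rho$ is a continuous function on $\mathbb R^+=[0,\infty)$ with $-\tau\le t-\rho(t)\le t$ for all $t\ge0$ and $\lim_{t\to\infty}(t-\rho(t))=\infty$; $u_\rho(x,t)=u(x,t-\rho(t))$. $\|\cdot\|$ is the norm of $L^2(\Omega)$; $\|\xi\|_\infty$ is the sup norm in $C([-\tau,0];L^2(\Omega))$. $\partial_t^\alpha w(t)=\frac{d}{dt}\int_0^tg_{1-\alpha}(t-s)w(s)ds$ is the Riemann-Liouville derivative, with $g_\beta(t)=t^{\beta-1}/\Gamma(\beta)$. For $\mu>0$, $\omega(\cdot,\mu)$ is the solution of the scalar problem $\omega'(t)+\mu(1+\gamma\partial_t^\alpha)\omega(t)=0$ for $t>0$, $\omega(0)=1$. $\{\varphi_n\}_{n\ge1}$ is an orthonormal basis of $L^2(\Omega)$ consisting of eigenfunctions of $-\Delta$ with homogeneous Dirichlet boundary condition, $-\Delta\varphi_n=\lambda_n\varphi_n$, with $0<\lambda_1\le\lambda_2\le\cdots\to\infty$. The resolvent operator $S(t):L^2(\Omega)\to L^2(\Omega)$ is $S(t)v=\sum_{n=1}^\infty\omega(t,\lambda_n)\langle v,\varphi_n\rangle\varphi_n$, $t\ge0$. Solutions are mild solutions: continuous $u:[-\tau,\infty)\to L^2(\Omega)$ with $u(\cdot,s)=\xi(\cdot,s)$ for $s\in[-\tau,0]$ and $u(\cdot,t)=S(t)\xi(\cdot,0)+\int_0^tS(t-s)f(s,u_\rho(\cdot,s))ds$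 for all $t\ge0$. A decay solution is a mild solution whose restriction to $\mathbb R^+$ belongs to $BC_0(\mathbb R^+;L^2(\Omega))$, the space of continuous functions $u:\mathbb R^+\to L^2(\Omega)$ with $u(\cdot,t)\to0$ in $L^2(\Omega)$ as $t\to\infty$, equipped with the supremum norm; compactness refers to this space. *)

(* Defs.v *)
From HB Require Import structures.
From mathcomp Require Import all_boot all_order all_algebra.
From mathcomp Require Import all_classical all_reals all_analysis.
From mathcomp Require Import measurable_realfun ess_sup_inf.
From mathcomp Require Import ring lra.

Set Implicit Arguments.
Unset Strict Implicit.
Unset Printing Implicit Defensive.
Import Order.TTheory GRing.Theory Num.Theory.
Import numFieldNormedType.Exports.

Local Open Scope classical_set_scope.
Local Open Scope ring_scope.

Section Lspace_mod.
Context d (T : measurableType d) (R : realType).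
Variables (mu : {measure set T -> \bar R}) (p : \bar R) (p1 : (1 <= p)%E).

Implicit Types (u v w : LspaceType mu p1) (f g : T -> R).

Lemma eq_Lnorm_ae f g : measurable_fun setT f -> measurable_fun setT g ->
  f = g %[ae mu] -> ('N[mu]_p[EFin \o f] = 'N[mu]_p[EFin \o g])%E.
Proof.
move=> mf mg fg; rewrite unlock /Lnorm.
case: p p1 => [r _|_|]; last by [].
- have mp (h : T -> R) : measurable_fun [set: T] h ->
      measurable_fun [set: T] ((fun x => (`|(EFin \o h) x| `^ r)%E) : T -> \bar R).
    move=> mh; apply: (@measurableT_comp _ _ _ _ _ _ (fun x : \bar R => (x `^ r)%E : \bar R)).
      exact: measurable_poweR.
    by apply: measurableT_comp => //; exact/measurable_EFinP.
  have -> : (\int[mu]_x (`|(EFin \o f) x| `^ r) = \int[mu]_x (`|(EFin \o g) x| `^ r))%E.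
    apply: (ae_eq_integral _ _ measurableT (mp _ mf) (mp _ mg)).
    by apply: filterS fg => x /= fg _; rewrite fg.
  by [].
- case: ifPn => // _; apply: eq_ess_sup.
  by apply: filterS fg => x /= ->.
Qed.
End Lspace_mod.


(* The library's [LspaceType] is a bare quotient; here it is made a normed
   module for the L^p norm. *)
Section Lspace_normedmod.
Context d (T : measurableType d) (R : realType).
Variables (mu : {measure set T -> \bar R}) (p : \bar R) (p1 : (1 <= p)%E).
Local Open Scope quotient_scope.
Local Notation Lp := (LspaceType mu p1).
Implicit Types (u v w : Lp) (f g : T -> R).

Let cls f (mf : measurable_fun setT f) : {mfun_ mu, T >-> measurableTypeR R} :=
  \pi_({mfun_ mu, T >-> measurableTypeR R})
    (@mfun_Sub _ _ T (measurableTypeR R) f (mem_set mf)).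

Let clsE f (mf : measurable_fun setT f) : (cls mf : T -> R) = f %[ae mu].
Proof. by have /eqmodP/asboolP := reprK (cls mf). Qed.

Lemma measurable_Lspace v : measurable_fun setT (v : T -> R).
Proof.
have := (@measurable_funPT _ _ T (measurableTypeR R) (repr (v : {mfun_ mu, T >-> measurableTypeR R}))).
by [].

Qed.

Let clsfin f (mf : measurable_fun setT f) : finite_norm mu p f ->
  finite_norm mu p (cls mf).
Proof.
rewrite /finite_norm (eq_Lnorm_ae p1 _ mf (clsE mf)) //.
exact: (@measurable_funPT _ _ T (measurableTypeR R) (repr (cls mf))).
Qed.

Definition Lspace_of f (mf : measurable_fun setT f) (ff : finite_norm mu p f) : Lp :=
  LebesgueSpace.Pack (LebesgueSpace.Class
    (isFinLebesgue.Build d T R mu p p1 (cls mf) (clsfin mf ff))).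

Lemma Lspace_ofE f (mf : measurable_fun setT f) (ff : finite_norm mu p f) :
  (Lspace_of mf ff : T -> R) = f %[ae mu].
Proof. exact: clsE. Qed.

Lemma Lspace_ae_eq u v : (\forall x \ae mu, (u : T -> R) x = v x) -> u = v.
Proof.
move=> uv0; have uv : (u : T -> R) = v %[ae mu] by apply: filterS uv0 => x ->.
clear uv0.
have {uv} : (u : {mfun_ mu, T >-> measurableTypeR R}) = v.
  by rewrite -[LHS]reprK -[RHS]reprK; apply/eqmodP/asboolP.
case: u v => u [[uf]] [v [[vf]]] /= uv; rewrite uv in uf *.
by rewrite (Prop_irrelevance uf vf).
Qed.


Let finD u v : finite_norm mu p (u \+ v).
Proof.
rewrite /finite_norm (le_lt_trans (eminkowski mu (measurable_Lspace u) (measurable_Lspace v) p1))//.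
by rewrite lte_add_pinfty//; exact: Lebesgue_finite.
Qed.

Let finZ (a : R) u : finite_norm mu p (a \*o u).
Proof.
have fu : (u : T -> R) \in Lfun mu p.
  apply/andP; split; rewrite inE; first exact: measurable_Lspace.
  exact: Lebesgue_finite.
have := LnormZ (Lfun_Sub p1 fu) a.
rewrite /finite_norm => ->; rewrite lte_mul_pinfty ?lee_fin//.
exact: Lebesgue_finite.
Qed.

Let mD u v : measurable_fun setT (u \+ v).
Proof. exact: measurable_funD (measurable_Lspace u) (measurable_Lspace v). Qed.

Let mZ (a : R) u : measurable_fun setT (a \*o u).
Proof. exact: measurable_funM (measurable_cst _) (measurable_Lspace u). Qed.


Let zero : Lp := Lspace_of (measurable_cst (0 : R)) (finite_norm_cst0 mu p1).
Let add u v : Lp := Lspace_of (mD u v) (finD u v).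
Let scale (a : R) u : Lp := Lspace_of (mZ a u) (finZ a u).
Let opp u : Lp := scale (-1) u.

Let zeroE : \forall x \ae mu, (zero : T -> R) x = 0.
Proof. by have := Lspace_ofE (measurable_cst (0 : R)) (finite_norm_cst0 mu p1); apply: filterS => x /(_ I). Qed.
Let addE u v : \forall x \ae mu, (add u v : T -> R) x = u x + v x.
Proof. by have := Lspace_ofE (mD u v) (finD u v); apply: filterS => x /(_ I). Qed.
Let scaleE a u : \forall x \ae mu, (scale a u : T -> R) x = a * u x.
Proof. by have := Lspace_ofE (mZ a u) (finZ a u); apply: filterS => x /(_ I). Qed.

Let addA : associative add.
Proof.
move=> u v w; apply: Lspace_ae_eq.
by apply: (filterS _ (filterI (filterI (addE u (add v w)) (addE v w))
  (filterI (addE (add u v) w) (addE u v)))) => x [[-> ->] [-> ->]]; rewrite addrA.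
Qed.

Let addC : commutative add.
Proof.
move=> u v; apply: Lspace_ae_eq.
by apply: (filterS _ (filterI (addE u v) (addE v u))) => x [-> ->]; rewrite addrC.
Qed.

Let add0 : left_id zero add.
Proof.
move=> u; apply: Lspace_ae_eq.
by apply: (filterS _ (filterI (addE zero u) zeroE)) => x [-> ->]; rewrite add0r.
Qed.

Let addN : left_inverse zero opp add.
Proof.
move=> u; apply: Lspace_ae_eq.
apply: (filterS _ (filterI (addE (opp u) u) (filterI (scaleE (-1) u) zeroE))).
by move=> x [-> [-> ->]]; rewrite mulN1r addNr.
Qed.

HB.instance Definition _ := gen_eqMixin Lp.
HB.instance Definition _ := gen_choiceMixin Lp.
HB.instance Definition _ := GRing.isZmodule.Build Lp addA addC add0 addN.

Let scaleA a b u : scale a (scale b u) = scale (a * b) u.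
Proof.
apply: Lspace_ae_eq.
apply: (filterS _ (filterI (scaleE a (scale b u))
  (filterI (scaleE b u) (scaleE (a * b) u)))).
by move=> x [-> [-> ->]]; rewrite mulrA.
Qed.

Let scale1 : left_id 1 scale.
Proof.
move=> u; apply: Lspace_ae_eq.
by apply: (filterS _ (scaleE 1 u)) => x ->; rewrite mul1r.
Qed.

Let scaleDr : right_distributive scale +%R.
Proof.
move=> a u v; apply: Lspace_ae_eq.
apply: (filterS _ (filterI (filterI (scaleE a (u + v)) (addE u v))
  (filterI (addE (scale a u) (scale a v)) (filterI (scaleE a u) (scaleE a v))))).
by move=> x [[-> ->] [-> [-> ->]]]; rewrite mulrDr.
Qed.

Let scaleDl u : {morph scale^~ u : a b / a + b}.
Proof.
move=> a b; apply: Lspace_ae_eq.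
apply: (filterS _ (filterI (scaleE (a + b) u)
  (filterI (addE (scale a u) (scale b u)) (filterI (scaleE a u) (scaleE b u))))).
by move=> x [-> [-> [-> ->]]]; rewrite mulrDl.
Qed.

HB.instance Definition _ :=
  GRing.Zmodule_isLmodule.Build R Lp scaleA scale1 scaleDr scaleDl.

Lemma Lspace0E : \forall x \ae mu, (0 : Lp) x = 0.
Proof. exact: zeroE. Qed.

Lemma LspaceDE u v : \forall x \ae mu, (u + v : Lp) x = u x + v x.
Proof. exact: addE. Qed.

Lemma LspaceZE (a : R) u : \forall x \ae mu, (a *: u : Lp) x = a * u x.
Proof. exact: scaleE. Qed.

Let nrm u : R := fine ('N[mu]_p[EFin \o u])%E.

Let nrmE u : (nrm u)%:E = 'N[mu]_p[EFin \o u]%E.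
Proof.
by rewrite fineK// ge0_fin_numE ?Lnorm_ge0//; exact: Lebesgue_finite.
Qed.

Let nrmD u v : nrm (u + v) <= nrm u + nrm v.
Proof.
rewrite -lee_fin EFinD !nrmE.
rewrite (eq_Lnorm_ae p1 (measurable_Lspace _) (mD u v) (Lspace_ofE _ _)).
exact: eminkowski (measurable_Lspace u) (measurable_Lspace v) p1.
Qed.

Let nrmZ (a : R) u : nrm (a *: u) = `|a| * nrm u.
Proof.
apply: EFin_inj; rewrite EFinM !nrmE.
rewrite (eq_Lnorm_ae p1 (measurable_Lspace _) (mZ a u) (Lspace_ofE _ _)).
have fu : (u : T -> R) \in Lfun mu p.
  apply/andP; split; rewrite inE; first exact: measurable_Lspace.
  exact: Lebesgue_finite.
exact: (LnormZ (Lfun_Sub p1 fu) a).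
Qed.

Let nrm0 u : nrm u = 0 -> u = 0.
Proof.
move=> u0; apply: Lspace_ae_eq.
have u0' : ('N[mu]_p[EFin \o u] = 0)%E by rewrite -nrmE u0.
have mu' : measurable_fun [set: T] (EFin \o u).
  exact/measurable_EFinP/measurable_Lspace.
have := Lnorm_eq0_eq0 mu' (lt_le_trans lte01 p1) u0'.
move=> h; apply: (filterS _ (filterI h zeroE)) => x [/(_ I) [ux ->]].
exact: ux.
Qed.

HB.instance Definition _ := Lmodule_isNormed.Build R Lp nrmD nrmZ nrm0.

Lemma Lspace_normE u : `|u| = fine ('N[mu]_p[EFin \o u])%E.
Proof. by []. Qed.

End Lspace_normedmod.

(* The sigma-algebra generated by the coordinates, that is, the Borel sets
   ([open_measurable_rV] below). *)
Section rV_measurable.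
Context (R : realType) (n : nat).

Definition rv_cylinder : set (set 'rV[R]_n) :=
  [set A | exists i (B : set R), measurable B /\ A = [set x : 'rV[R]_n | B (x ord0 i)]].

Let rv0 : <<s rv_cylinder >> set0.
Proof. exact: sigma_algebra0. Qed.

Let rvC A : <<s rv_cylinder >> A -> <<s rv_cylinder >> (~` A).
Proof. exact: sigma_algebraC. Qed.

Let rvU (F : (set 'rV[R]_n)^nat) : (forall i, <<s rv_cylinder >> (F i)) ->
  <<s rv_cylinder >> (\bigcup_i (F i)).
Proof. exact: sigma_algebra_bigcup. Qed.

HB.instance Definition _ := @isMeasurable.Build default_measure_display
  'rV[R]_n <<s rv_cylinder >> rv0 rvC rvU.

Lemma measurable_coord i (B : set R) : measurable B -> measurable [set x : 'rV[R]_n | B (x ord0 i)].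
Proof. by move=> mB; apply: sub_sigma_algebra; exists i, B. Qed.

End rV_measurable.
Section step.
Context (R : realType) (n : nat).

Definition rv_cons (x : measurableTypeR R * 'rV[R]_n) : 'rV[R]_n.+1 :=
  \row_i (if unlift ord0 i is Some j then x.2 ord0 j else x.1).

Lemma measurable_rv_cons : measurable_fun setT rv_cons.
Proof.
apply: (measurability (@rv_cylinder R n.+1)) => // _ [_ [i [B [mB ->]]] <-].
rewrite setTI.
case: (unliftP ord0 i) => [j ->|->].
- have -> : rv_cons @^-1` [set x | B (x ord0 (lift ord0 j))] = setT `*` [set x : 'rV[R]_n | B (x ord0 j)].
    by apply/seteqP; split=> [[a x]|[a x]] /=; rewrite mxE liftK //; move=> [].
  by apply: measurableX => //; exact: measurable_coord.
- have -> : rv_cons @^-1` [set x | B (x ord0 ord0)] = B `*` setT.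
    by apply/seteqP; split=> [[a x]|[a x]] /=; rewrite mxE unlift_none //; move=> [].
  exact: measurableX.
Qed.

Definition rv_uncons (x : 'rV[R]_n.+1) : measurableTypeR R * 'rV[R]_n :=
  (x ord0 ord0, \row_j x ord0 (lift ord0 j)).

Lemma rv_consK : cancel rv_cons rv_uncons.
Proof.
move=> [a x]; rewrite /rv_uncons /rv_cons; congr pair.
  by rewrite mxE unlift_none.
by apply/rowP => j; rewrite !mxE liftK.
Qed.

Lemma measurable_rv_uncons : measurable_fun setT rv_uncons.
Proof.
apply: measurable_fun_pair.
  by move=> _ B mB; rewrite setTI; exact: (@measurable_coord R n.+1 ord0).
apply: (measurability (@rv_cylinder R n)) => // _ [_ [i [B [mB ->]]] <-].
rewrite setTI.
rewrite (_ : _ @^-1` _ = [set x : 'rV[R]_n.+1 | B (x ord0 (lift ord0 i))]).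
  exact: (@measurable_coord R n.+1).
by apply/seteqP; split => x /=; rewrite mxE.
Qed.

Variable m : {sigma_finite_measure set 'rV[R]_n -> \bar R}.

Definition leb_cons : set 'rV[R]_n.+1 -> \bar R :=
  pushforward (@lebesgue_measure R \x m)%E rv_cons.

Let mpre A : measurable A -> measurable (rv_cons @^-1` A).
Proof. by move=> mA; rewrite -[X in measurable X]setTI; exact: measurable_rv_cons. Qed.

Let leb_cons0 : leb_cons set0 = 0%E.
Proof. by rewrite /leb_cons /pushforward preimage_set0 measure0. Qed.

Let leb_cons_ge0 A : (0 <= leb_cons A)%E.
Proof. by rewrite /leb_cons /pushforward measure_ge0. Qed.

Let leb_cons_sigma_additive : semi_sigma_additive leb_cons.
Proof.
move=> F mF tF mUF; rewrite /leb_cons /pushforward preimage_bigcup.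
apply: measure_semi_sigma_additive.
- by move=> k; exact: mpre.
- apply/trivIsetP => /= i j _ _ ij; rewrite -preimage_setI.
  by move/trivIsetP : tF => /(_ _ _ _ _ ij) ->//; rewrite preimage_set0.
- by rewrite -preimage_bigcup; exact: mpre.
Qed.

HB.instance Definition _ :=
  isMeasure.Build _ _ _ leb_cons leb_cons0 leb_cons_ge0 leb_cons_sigma_additive.

Let leb_cons_sigma_finite : sigma_finite setT leb_cons.
Proof.
have /sigma_finiteP[F [TF ndF Foo]] := sigma_finiteT (@lebesgue_measure R).
have /sigma_finiteP[G [TG ndG Goo]] := sigma_finiteT m.
exists (fun k => rv_uncons @^-1` (F k `*` G k)).
  rewrite -preimage_bigcup (_ : \bigcup_k (F k `*` G k) = setT) ?preimage_setT//.
  rewrite -setXTT TF TG predeqE => -[x y]; split.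
    by move=> [k _ []/= ? ?]; split; exists k.
  move=> [/= [k _ Fkx] [l _ Gly]]; exists (maxn k l) => //; split.
  - by move: x Fkx; exact/subsetPset/ndF/leq_maxl.
  - by move: y Gly; exact/subsetPset/ndG/leq_maxr.
move=> k; have [mF Fk] := Foo k; have [mG Gk] := Goo k; split.
  rewrite -[X in measurable X]setTI; apply: measurable_rv_uncons => //.
  exact: measurableX.
rewrite /leb_cons /pushforward -comp_preimage.
rewrite (_ : rv_uncons \o rv_cons = id); last by apply/funext; exact: rv_consK.
by rewrite preimage_id product_measure1E// lte_mul_pinfty// ge0_fin_numE.
Qed.

HB.instance Definition _ :=
  Measure_isSigmaFinite.Build _ _ _ leb_cons leb_cons_sigma_finite.

End step.

(* d-dimensional Lebesgue measure, see [leb_box] *)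
Fixpoint leb (R : realType) (n : nat) : {sigma_finite_measure set 'rV[R]_n -> \bar R} :=
  match n with
  | 0 => \d_(0 : 'rV[R]_0)
  | n'.+1 => leb_cons (leb R n')
  end.


Lemma measurable_box (R : realType) n (I : 'I_n -> interval R) :
  measurable [set x : 'rV[R]_n | forall i, x ord0 i \in I i].
Proof.
rewrite (_ : [set _ | _] = \big[setI/setT]_(i < n) [set x : 'rV[R]_n | [set` I i] (x ord0 i)]).
  by apply: bigsetI_measurable => i _; exact: measurable_coord.
rewrite -bigcap_seq; apply/seteqP; split => x /= xI i => [_|]; first exact: xI.
by apply: xI; rewrite /= mem_index_enum.
Qed.

Lemma leb_box (R : realType) n (a b : 'rV[R]_n) :
  (forall i, a ord0 i <= b ord0 i) ->
  leb R n [set x : 'rV[R]_n | forall i, x ord0 i \in `[a ord0 i, b ord0 i]] =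
  (\prod_i (b ord0 i - a ord0 i))%:E.
Proof.
elim: n a b => [|n IH] a b ab.
  by rewrite /= big_ord0 diracE mem_set// => -[].
have pre : rv_cons (n := n) @^-1` [set x : 'rV[R]_n.+1 | forall i, x ord0 i \in `[a ord0 i, b ord0 i]] =
  `[a ord0 ord0, b ord0 ord0] `*`
  [set x : 'rV[R]_n | forall i, x ord0 i \in `[(rv_uncons a).2 ord0 i, (rv_uncons b).2 ord0 i]].
  apply/seteqP; split => [[x0 x]|[x0 x]] /=.
    move=> xab; split; first by have := xab ord0; rewrite mxE unlift_none.
    by move=> i; rewrite !mxE; have := xab (lift ord0 i); rewrite mxE liftK.
  move=> [x0ab xab] i; rewrite mxE.
  by case: (unliftP ord0 i) => [j ->|->] //; have := xab j; rewrite !mxE.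
rewrite -[LHS]/((@lebesgue_measure R \x leb R n)%E (rv_cons (n := n) @^-1` _)) pre.
rewrite product_measure1E//; last exact: measurable_box.
rewrite IH => [|i]; last by rewrite !mxE.
rewrite big_ord_recl EFinM; congr (_ * (_)%:E)%E.
  transitivity (lebesgue_measure `[a ord0 ord0, b ord0 ord0]%classic) => //.
  rewrite lebesgue_measure_itv/= lte_fin; case: ltP => // ba.
  by rewrite (@le_anti _ _ (a ord0 ord0) (b ord0 ord0)) ?subrr// ba ab.
by apply: eq_bigr => i _; rewrite !mxE.
Qed.

Lemma open_measurable_rV (R : realType) n (A : set 'rV[R]_n) :
  open A -> measurable A.
Proof.
move=> oA.
pose box (q : 'rV[rat]_n * rat) : set 'rV[R]_n :=
  [set x | forall i, x ord0 i \in
    `]ratr (q.1 ord0 i) - ratr q.2, ratr (q.1 ord0 i) + ratr q.2[ ].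
have -> : A = \bigcup_(q in [set q | box q `<=` A]) box q.
  apply/seteqP; split; last by move=> x [q /= qA]; exact: qA.
  move=> x Ax.
  have /nbhs_ballP [e /= e0 eA] := open_nbhs_nbhs (conj oA Ax).
  have e20 : 0 < e / 2 by rewrite divr_gt0.
  have [r] := rat_in_itvoo e20; rewrite in_itv/= => /andP[r0 re].
  have /choice [q qx] : forall i, exists q : rat,
      ratr q \in `]x ord0 i - ratr r, x ord0 i + ratr r[.
    by move=> i; apply: rat_in_itvoo; rewrite ltrBlDr -addrA ltrDl addr_gt0.
  exists (\row_i q i, r) => /=.
    move=> y ybox; apply: eA; split => // i j; rewrite ord1 /ball/=.
    move: (ybox j) (qx j); rewrite !in_itv/= !mxE ltr_norml => /andP[y1 y2] /andP[q1 q2].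
    apply/andP; split; lra.
  move=> i; move: (qx i); rewrite !in_itv/= !mxE => /andP[q1 q2].
  apply/andP; split; lra.
rewrite bigcup_mkcond; apply: countable_bigcupT_measurable.
  exact: countableP.
by move=> q; case: ifPn => // _; exact: measurable_box.
Qed.

Section L2.
Context d (T : measurableType d) (R : realType) (mu : {measure set T -> \bar R}).

Definition L2dot (v w : LspaceType2 mu) : R := \int[mu]_x (v x * w x).

Definition orthonormal_basis (e : nat -> LspaceType2 mu) :=
  (forall m n, L2dot (e m) (e n) = (m == n)%:R) /\
  (forall v, series (fun n => L2dot v (e n) *: e n) @ \oo --> v).

End L2.

Section bochner.
Context d (T : measurableType d) (R : realType) (mu : {measure set T -> \bar R})
  (V : normedModType R).

Definition simple_val (k : nat) (A : nat -> set T) (v : nat -> V) (x : T) : V :=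
  \sum_(i < k) (\1_(A i) x : R) *: v i.

Definition simple_integral (k : nat) (A : nat -> set T) (v : nat -> V) : V :=
  \sum_(i < k) fine (mu (A i)) *: v i.

(* [F] is Bochner integrable over [D], with integral [I]: there are simple
   functions [simple_val (k n) (A n) (v n)] converging to [F] almost everywhere
   and in mean on [D], whose integrals converge to [I]. *)
Definition bochner_integral (D : set T) (F : T -> V) (I : V) :=
  exists (k : nat -> nat) (A : nat -> nat -> set T) (v : nat -> nat -> V),
  [/\ forall n i, [/\ measurable (A n i), A n i `<=` D & (mu (A n i) < +oo)%E],
      {ae mu, forall x, D x -> simple_val (k n) (A n) (v n) x @[n --> \oo] --> F x},
      (\int[mu]_(x in D) `|F x - simple_val (k n) (A n) (v n) x|%:E)%E
        @[n --> \oo] --> 0%E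
    & simple_integral (k n) (A n) (v n) @[n --> \oo] --> I].

End bochner.

Section domain.
Context (R : realType) (d : nat).
Implicit Types (U Omega : set 'rV[R]_d) (g psi : 'rV[R]_d -> R).

Definition partial (i : 'I_d) g : 'rV[R]_d -> R := 'D_(delta_mx 0 i) g.

Fixpoint Ck (k : nat) U g : Prop :=
  (forall x, U x -> {for x, continuous g}) /\
  match k with
  | 0 => True
  | k'.+1 => forall i, (forall x, U x -> derivable g x (delta_mx 0 i)) /\
                       Ck k' U (partial i g)
  end.

Definition laplacian g : 'rV[R]_d -> R := fun x => \sum_i partial i (partial i g) x.

Definition boundary Omega := closure Omega `\` Omega°.

(* near each boundary point, the domain is a strict sublevel set of a smooth
   function without critical points *)
Definition smooth_boundary Omega := forall x, boundary Omega x ->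
  exists (U : set 'rV[R]_d) psi,
  [/\ open U, U x, forall k, Ck k U psi,
      forall y, U y -> exists i, partial i psi y != 0
    & Omega `&` U = [set y | U y /\ psi y < 0]].

Definition bounded_smooth_domain Omega :=
  [/\ Omega !=set0, connected Omega, bounded_set Omega & smooth_boundary Omega].

(* Lebesgue measure restricted to [Omega] *)
Definition leb_on Omega (oOmega : open Omega) : {measure set 'rV[R]_d -> \bar R} :=
  mrestr (leb R d) (open_measurable_rV oOmega).

Local Notation L2 oOmega := (LspaceType2 (leb_on oOmega)).

(* Eigenfunctions are smooth up to a smooth boundary, so the equation and the
   boundary condition are understood classically, for the continuous
   representative [g] of [v]. *)
Definition dirichlet_eigenfunction Omega (oOmega : open Omega) (lambda : R)
    (v : L2 oOmega) :=
  exists g,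
  [/\ {ae leb_on oOmega, forall x, v x = g x},
      Ck 2 Omega g, {within closure Omega, continuous g},
      forall x, boundary Omega x -> g x = 0
    & forall x, Omega x -> - laplacian g x = lambda * g x].

End domain.
Notation L2 oOmega := (LspaceType2 (leb_on oOmega)).

Section fractional.
Context (R : realType).
Local Notation leb1 := (@lebesgue_measure R).

(* Euler's Gamma function, for [b > 0] *)
Definition Gamma (b : R) : R :=
  \int[leb1]_(x in `]0, +oo[) (x `^ (b - 1) * expR (- x)).

(* [g_b(t) = t^(b-1) / Gamma(b)] *)
Definition gker (b t : R) : R := t `^ (b - 1) / Gamma b.

Definition frac_conv (alpha : R) (w : R -> R) (t : R) : R :=
  \int[leb1]_(s in `[0, t]) (gker (1 - alpha) (t - s) * w s).

Definition RL_derivative (alpha : R) (w : R -> R) : R -> R := derive1 (frac_conv alpha w).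

(* [w' + mu (1 + gamma d^alpha/dt^alpha) w = 0] for [t > 0], [w 0 = 1] *)
Definition relaxation_solution (gamma alpha mu : R) (w : R -> R) :=
  [/\ {within `[0, +oo[, continuous w}, w 0 = 1,
      forall t : R, 0 < t -> derivable w t 1,
      forall t : R, 0 < t -> derivable (frac_conv alpha w) t 1
    & forall t : R, 0 < t ->
        derive1 w t + mu * (w t + gamma * RL_derivative alpha w t) = 0].

End fractional.

Section evolution.
Context (R : realType).

Definition conv_upto (k p : R -> R) (b t : R) : \bar R :=
  (\int[@lebesgue_measure R]_(s in `[0%R, b]) (k (t - s) * p s)%:E)%E.

Definition sup_conv (k p : R -> R) : \bar R :=
  ereal_sup [set conv_upto k p t t | t in [set t : R | 0 <= t]].

Definition resolvent d (T : measurableType d) (mu : {measure set T -> \bar R})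
    (omega : R -> R -> R) (lambda : nat -> R) (phi : nat -> LspaceType2 mu)
    (t : R) (v : LspaceType2 mu) : LspaceType2 mu :=
  limn (series (fun n => (omega t (lambda n) * L2dot v (phi n)) *: phi n)).

Context (V : normedModType R).

Definition mild_solution (S : R -> V -> V) (tau : R) (rho : R -> R)
    (f : R -> V -> V) (xi u : R -> V) :=
  [/\ {within `[- tau, +oo[, continuous u},
      forall s : R, - tau <= s <= 0 -> u s = xi s
    & forall t : R, 0 <= t -> exists2 I,
        bochner_integral (@lebesgue_measure R) `[0, t]
          (fun s => S (t - s) (f s (u (s - rho s)))) I
        & u t = S t (xi 0) + I].

(* Functions on [R+] are represented by functions on [R]. The topology of
   [{uniform` `[0, +oo[ -> V}] is that of uniform convergence on [R+], hence that
   of the sup norm of [BC0], and ignores the values at negative times. *)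
Definition BC0 : set {uniform` (`[0, +oo[%classic : set R) -> V} :=
  [set u : R -> V | {within `[0, +oo[, continuous u} /\ u t @[t --> +oo] --> 0].

Definition decay_solutions S tau rho f xi : set {uniform` (`[0, +oo[%classic : set R) -> V} :=
  [set u : R -> V | mild_solution S tau rho f xi u /\ BC0 u].

End evolution.

(* Main.v *)
(* The relaxation function [w = omega^~ mu] satisfies the Volterra equation
   [w + mu * (k * w) = 1] with [k t = 1 + gamma * t^(-alpha) / Gamma (1 - alpha)].
   Discretised with step [h], the increments of the primitive of [k] form a
   positive nonincreasing log-convex sequence, so by Kaluza's theorem the inverse
   series has nonpositive coefficients after the first one; letting [h] tend to 0,
   [w] is nonnegative, nonincreasing in time and in [mu], and
   [w t <= 1 / (1 + mu * t)].

   Hence the resolvent [S t] is a diagonal contraction that maps the high modes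
   uniformly close to 0 for [t] away from 0, and a mild solution with small
   history stays in a ball of radius [r] with [M * G s <= kappa * s] for [s <= r],
   where [M] is the supremum of the convolution and [kappa < 1]. Applying this
   estimate repeatedly at late times gives decay, uniformly over all solutions.
   Coordinates are equicontinuous and tails uniformly small, so along an
   ultrafilter solutions converge uniformly, to a solution, even for varying
   delays: for a fixed delay this is compactness, and applied to equations with
   delay enlarged by [1 / (k + 1)], which are solvable step by step, it gives
   existence. *)
Require Import Defs.
From mathcomp Require Import all_boot all_order all_algebra.
From mathcomp Require Import all_classical all_reals all_analysis.
From mathcomp Require Import measurable_realfun ring lra.

Set Implicit Arguments.
Unset Strict Implicit.
Unset Printing Implicit Defensive.
Import Order.TTheory GRing.Theory Num.Theory.
Import numFieldNormedType.Exports.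

Local Open Scope classical_set_scope.
Local Open Scope ring_scope.

(** Since [f] is merely continuous, solutions need not be unique and no contraction argument is
    available. Every estimate is therefore proved for the whole family of solutions at once, and for
    all admissible delays, so that one limit theorem yields both existence and compactness. The
    delay may vanish, which rules out solving directly by steps and is why it is enlarged first.

    The relaxation function is known only through its fractional equation. Its samples on a grid
    solve the discrete equation up to a small residual. The sign pattern of the inverse series gives
    more than signs: it bounds the sum of absolute values of its coefficients by [2 / b 0], and this
    stability makes the discrete solutions converge to the samples.

    The radius [(1 - kappa) * r / 2] allowed for the history leaves a margin: together with a
    forcing term of at most [kappa * r] it gives [(1 + kappa) / 2 * r], strictly below [r].
    Strictness is what prevents a solution from reaching the boundary of the ball, and the same
    ratio [(1 + kappa) / 2] drives the iteration for decay. *)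

Lemma continuous_clamp (T U : topologicalType) (A : set T) (c : T -> T) (f : T -> U) :
  continuous c -> (forall x, A (c x)) -> {within A, continuous f} ->
  continuous (f \o c).
Proof.
move=> cc Ac /subspace_continuousP cf x.
have /= h B := cf (c x) (Ac x) B.
move=> B fB; have H : \forall y \near c x, A y -> B (f y) := h B fB.
have {}H : \forall y \near x, A (c y) -> B (f (c y)) := cc x _ H.
suff : \forall y \near x, B (f (c y)) by [].
by apply: filterS H => y; apply; exact: Ac.
Qed.

Lemma within_continuous_eq (T U : topologicalType) (A : set T) (f g : T -> U) :
  (forall x, A x -> g x = f x) -> continuous g -> {within A, continuous f}.
Proof.
move=> fg cg; apply: (@subspace_eq_continuous _ _ _ (g : subspace A -> U)).
  by move=> x; rewrite inE => /fg.
exact: continuous_subspaceT.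
Qed.

Lemma continuous_maxl (R : realType) (a : R) : continuous (Num.max a).
Proof. by move=> x; apply: (@continuous_max R R); [exact: cvg_cst|exact: cvg_id]. Qed.

(* [g] on [0, +oo[, extended by [g 0]: turns continuity within a half-line into
   continuity on the whole line. *)
Definition nneg_ext (R : realType) (T : Type) (g : R -> T) (s : R) : T :=
  g (Num.max 0 s).

Lemma nneg_ext_id (R : realType) (T : Type) (g : R -> T) (s : R) : 0 <= s ->
  nneg_ext g s = g s.
Proof. by move=> s0; rewrite /nneg_ext max_r. Qed.

Lemma continuous_nneg_ext (R : realType) (U : topologicalType) (g : R -> U) :
  {within `[0, +oo[, continuous g} -> continuous (nneg_ext g).
Proof.
apply: continuous_clamp; first exact: continuous_maxl.
by move=> x; rewrite /= in_itv/= andbT le_max lexx.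
Qed.

(** Only [x] is confined to the segment; [y] may leave it, which spares all later uses a discussion
    of endpoints. The near-covering form of compactness is applied to the filter of small
    [del > 0]. *)
Lemma segment_uniform_continuous (R : realType) (V : normedModType R) (g : R -> V)
    (a b e : R) : continuous g -> 0 < e ->
  exists2 del, 0 < del & forall x y, a <= x <= b -> `|x - y| < del -> `|g x - g y| < e.
Proof.
move=> cg e0.
have /compact_near_coveringP/(_ R (0 : R)^'+
  (fun del x => forall y, `|x - y| < del -> `|g x - g y| < e)) := @segment_compact R a b.
have FF : Filter (0 : R)^'+ by exact: at_right_proper_filter.
move=> /(_ FF)[].
  move=> x0 _.
  have e20 : 0 < e / 2 by rewrite divr_gt0.
  have /cvgrPdist_lt/(_ _ e20)/nbhs_ballP[r /= r0 rg] := cg x0.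
  have r20 : 0 < r / 2 by rewrite divr_gt0.
  near=> x del => y xy.
  have gx : `|g x0 - g x| < e / 2.
    by apply: rg; near: x; exact: nbhsx_ballx.
  have gy : `|g x0 - g y| < e / 2.
    have x0x : `|x0 - x| < r / 2 by near: x; exact: (nbhsx_ballx x0 _ r20).
    apply: rg; rewrite /ball/= (le_lt_trans (ler_distD x _ _))// (splitr r) ltrD//.
    by rewrite (lt_trans xy)//=; near: del; exact: nbhs_right_lt.
  by rewrite (le_lt_trans (ler_distD (g x0) _ _))// (splitr e) ltrD// distrC.
move=> del /= del0 delP; exists (del / 2); first by rewrite divr_gt0.
move=> x y xab xy; apply: (delP (del / 2)) => //=.
  by rewrite sub0r normrN gtr0_norm ?divr_gt0// ltr_pdivrMr// ltr_pMr// ltr1n.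
by rewrite divr_gt0.
Unshelve. all: by end_near. Qed.

(** * Kaluza sequences *)

Section sequence_convolution.
Context (R : realFieldType).
Implicit Types (a b c : nat -> R).

(** Cauchy product: sequences stand for formal power series, with [sone] the unit series. *)
Definition sconv a b (n : nat) : R := \sum_(i < n.+1) a i * b (n - i)%N.

Definition sone (n : nat) : R := (n == 0%N)%:R.

(** Coefficients up to [N] of a product depend only on those of the factors up to [N], so truncation
    to polynomials transfers the ring laws of [{poly R}] to [sconv]. *)
Let P N a : {poly R} := \poly_(i < N.+1) a i.

Let coefP N a i : (i <= N)%N -> (P N a)`_i = a i.
Proof. by move=> iN; rewrite coef_poly ltnS iN. Qed.

Let sconvE N a b n : (n <= N)%N -> sconv a b n = (P N a * P N b)`_n.
Proof.
move=> nN; rewrite coefM; apply: eq_bigr => i _.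
by rewrite !coefP// (leq_trans _ nN)// ?leq_subr// -ltnS ltn_ord.
Qed.

Let sconv_coef N a b (p : {poly R}) n : (n <= N)%N ->
  (forall i, (i <= N)%N -> a i = p`_i) -> sconv a b n = (p * P N b)`_n.
Proof.
move=> nN ap; rewrite coefM; apply: eq_bigr => i _.
rewrite ap ?coefP ?(leq_trans _ nN)// ?leq_subr//.
by rewrite -ltnS ltn_ord.
Qed.

Lemma sconvC a b : sconv a b = sconv b a.
Proof. by apply/funext => n; rewrite !(@sconvE n)// mulrC. Qed.

Lemma sconvA a b c : sconv a (sconv b c) = sconv (sconv a b) c.
Proof.
apply/funext => n; rewrite sconvC.
rewrite (@sconv_coef n _ _ (P n b * P n c))//; last first.
  by move=> i iN; rewrite (@sconvE n).
rewrite (@sconv_coef n _ c (P n a * P n b))//; last first.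
  by move=> i iN; rewrite (@sconvE n).
by rewrite [in LHS]mulrC mulrA.
Qed.

Lemma sconv1 a : sconv a sone = a.
Proof.
apply/funext => n; rewrite /sconv big_ord_recr/= subnn /sone/= mulr1 big1 ?add0r//.
by move=> i _; rewrite subn_eq0 leqNgt ltn_ord/= mulr0.
Qed.

Lemma sconvDr a b c n : sconv a (fun i => b i + c i) n = sconv a b n + sconv a c n.
Proof. by rewrite /sconv -big_split/=; apply: eq_bigr => i _; rewrite mulrDr. Qed.

Lemma sconvBr a b c n : sconv a (fun i => b i - c i) n = sconv a b n - sconv a c n.
Proof. by rewrite /sconv -sumrB/=; apply: eq_bigr => i _; rewrite mulrBr. Qed.

Lemma sconvZr a b (x : R) n : sconv a (fun i => x * b i) n = x * sconv a b n.
Proof. by rewrite /sconv big_distrr/=; apply: eq_bigr => i _; rewrite mulrCA. Qed.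

Lemma sconv_ge0 a b n : (forall i, 0 <= a i) -> (forall i, 0 <= b i) ->
  0 <= sconv a b n.
Proof. by move=> a0 b0; apply: sumr_ge0 => i _; rewrite mulr_ge0. Qed.

End sequence_convolution.

Section kaluza.
Context (R : realFieldType).

Lemma sconv_inverse (b : nat -> R) : b 0%N != 0 -> exists d, sconv b d = @sone R.
Proof.
move=> b0.
pose v (s : seq R) m := - (\sum_(i < m.+1) b i.+1 * nth 0 s (m - i)) / b 0%N.
(* Course-of-values recursion: [h n] lists the first [n + 1] coefficients of the inverse, and [v]
   solves the next equation for the next coefficient. *)
pose h := fix h n := if n is m.+1 then rcons (h m) (v (h m) m) else [:: (b 0%N)^-1].
have sh n : size (h n) = n.+1 by elim: n => //= n IH; rewrite size_rcons IH.
have hn n m : (m <= n)%N -> nth 0 (h n) m = nth 0 (h m) m.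
  elim: n => [|n IH]; first by rewrite leqn0 => /eqP ->.
  rewrite leq_eqVlt => /predU1P[->//|]; rewrite ltnS => mn.
  by rewrite nth_rcons sh ltnS mn IH.
exists (fun n => nth 0 (h n) n); apply/funext => -[|n].
  by rewrite /sconv big_ord_recl big_ord0 addr0/= divff.
rewrite /sconv big_ord_recl/= subn0 nth_rcons sh ltnn eqxx.
rewrite {1}/v mulrCA divff// mulr1 addrC.
rewrite (eq_bigr (fun i : 'I_n.+1 => b i.+1 * nth 0 (h n) (n - i))) ?subrr//.
by move=> i _; rewrite /bump/= add1n subSS -(hn n)// leq_subr.
Qed.

Variables (b d : nat -> R).
Hypotheses (b_gt0 : forall n, 0 < b n) (b_ndecr : forall n, b n.+1 <= b n)
  (b_logconvex : forall n, b n.+1 ^+ 2 <= b n * b n.+2)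
  (bd : sconv b d = @sone R).

(** Log-convexity makes the ratios [b n.+1 / b n] nondecreasing; stated without division. *)
Lemma logconvex_ratio i m : (i <= m)%N -> b m * b i.+1 <= b m.+1 * b i.
Proof.
elim: m => [|m IH]; first by rewrite leqn0 => /eqP ->; rewrite mulrC.
rewrite leq_eqVlt => /predU1P[->|]; first by rewrite mulrC.
rewrite ltnS => /IH{}IH.
have bm := b_gt0 m; have bm1 := b_gt0 m.+1; have bi := b_gt0 i.
have := b_logconvex m; rewrite expr2 => lc.
rewrite -(ler_pM2l bm) mulrCA.
apply: (le_trans (y := b m.+1 * (b m.+1 * b i))).
  by rewrite ler_pM2l.
by rewrite mulrA [leRHS]mulrA ler_pM2r.
Qed.

Lemma kaluza0 : d 0%N = (b 0%N)^-1.
Proof.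
have /(congr1 (fun f => f 0%N)) := bd.
rewrite /sconv big_ord_recl big_ord0 addr0/= /sone/= => h.
by apply: (mulfI (lt0r_neq0 (b_gt0 0%N))); rewrite h divff// gt_eqF.
Qed.

(* Kaluza's theorem: eliminating [d 0] between two consecutive equations leaves
   a combination of earlier [d j] with nonnegative coefficients. *)
Lemma kaluza n : d n.+1 <= 0.
Proof.
elim/ltn_ind: n => n IH.
have eqn m : b m.+1 * d 0%N + \sum_(i < m.+1) b (m - i)%N * d i.+1 = 0.
  have /(congr1 (fun f => f m.+1)) := bd; rewrite sconvC /sconv big_ord_recl/= /sone/=.
  move=> h; rewrite -[RHS]h subn0 [d _ * _]mulrC; congr (_ + _).
  by apply: eq_bigr => i _; rewrite mulrC /bump/= add1n subSS.
have b0 := b_gt0 0%N.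
case: n IH => [|n] IH.
  have := eqn 0%N; rewrite big_ord1 subn0 => h.
  rewrite -(ler_pM2l b0) mulr0.
  have -> : b 0%N * d 1%N = - (b 1%N * d 0%N) by lra.
  by rewrite oppr_le0 mulr_ge0 ?(ltW (b_gt0 1%N))// kaluza0 invr_ge0 ltW.
have := eqn n.+1; rewrite big_ord_recr/= subnn => h2.
have h1 := eqn n.
have bn1 := b_gt0 n.+1; have bn2 := b_gt0 n.+2.
rewrite -(ler_pM2l b0) mulr0 -(ler_pM2l bn1) mulr0.
have -> : b n.+1 * (b 0%N * d n.+2) =
   \sum_(i < n.+1) (b n.+2 * b (n - i)%N - b n.+1 * b (n.+1 - i)%N) * d i.+1.
  under eq_bigr do rewrite mulrBl -!mulrA.
  rewrite sumrB -!mulr_sumr.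
  move: h1 h2; set s1 := \sum_(i < n.+1) _; set s2 := \sum_(i < n.+1) _ => h1 h2.
  have -> : b 0%N * d n.+2 = - (b n.+2 * d 0%N) - s2 by lra.
  have -> : s1 = - (b n.+1 * d 0%N) by lra.
  by ring.
apply: sumr_le0 => i _; apply: mulr_ge0_le0; last exact: IH.
have iN : (i <= n)%N by rewrite -ltnS.
by rewrite subr_ge0 subSn// logconvex_ratio// (leq_trans (leq_subr _ _)).
Qed.

(** The solution of [sconv b w = 1], discrete counterpart of the relaxation function. *)
Let w := sconv d (fun=> 1).

Lemma kaluza_sum n : w n = \sum_(i < n.+1) d i.
Proof. by apply: eq_bigr => i _; rewrite mulr1. Qed.

Lemma kaluza_ndecr n : w n.+1 <= w n.
Proof. by rewrite !kaluza_sum big_ord_recr/= gerDl kaluza. Qed.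

(** Subtracting consecutive equations of [sconv w b = 1] writes [w n.+1 * b 0] as a combination of
    earlier [w i] whose coefficients are nonnegative because [b] is nonincreasing. *)
Lemma kaluza_ge0 n : 0 <= w n.
Proof.
elim/ltn_ind: n => n IH.
have eqn m : \sum_(i < m.+1) w i * b (m - i)%N = 1.
  rewrite -[LHS]/(sconv w b m) sconvC /w sconvA bd sconvC sconv1//.
have b0 := b_gt0 0%N.
case: n IH => [|n] IH; first by rewrite kaluza_sum big_ord1 kaluza0 invr_ge0 ltW.
have := eqn n.+1; have := eqn n; rewrite [X in _ -> X = 1 -> _]big_ord_recr/= subnn => h1 h2.
rewrite -(pmulr_lge0 _ b0).
have -> : w n.+1 * b 0%N = \sum_(i < n.+1) w i * (b (n - i)%N - b (n.+1 - i)%N).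
  under eq_bigr do rewrite mulrBr.
  by rewrite sumrB h1; move: h2; set s := \sum_(i < n.+1) _ => h2; lra.
apply: sumr_ge0 => i _; have iN : (i <= n)%N by rewrite -ltnS.
by rewrite mulr_ge0 ?IH// subr_ge0 subSn// b_ndecr.
Qed.

(** All [d i] but the first are nonpositive and their partial sums are nonnegative, so the absolute
    values add up to at most [2 * d 0 = 2 / b 0]. *)
Lemma kaluza_stable (q : nat -> R) Q n : (forall i, (i <= n)%N -> `|q i| <= Q) ->
  `|sconv d q n| <= 2 * Q / b 0%N.
Proof.
move=> qQ; have Q0 : 0 <= Q by apply: le_trans (qQ 0%N _).
apply: (le_trans (y := \sum_(i < n.+1) `|d i| * Q)).
  rewrite (le_trans (ler_norm_sum _ _ _))// ler_sum// => i _.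
  by rewrite normrM ler_wpM2l// qQ// leq_subr.
rewrite -mulr_suml mulrAC ler_wpM2r//.
rewrite big_ord_recl/= kaluza0 gtr0_norm ?invr_gt0//.
have := kaluza_ge0 n; rewrite kaluza_sum big_ord_recl/= kaluza0.
under [X in _ -> _ + X <= _]eq_bigr do rewrite ler0_norm ?kaluza//.
by rewrite sumrN; set s := \sum_(i < n) _ => h; lra.
Qed.

End kaluza.

(** Adding [sone] only raises [b 0], which occurs solely on the larger side of the inequalities. *)
Lemma affine_logconvex (R : realFieldType) (a : nat -> R) (mu : R) :
  (forall n, 0 < a n) -> (forall n, a n.+1 <= a n) ->
  (forall n, a n.+1 ^+ 2 <= a n * a n.+2) -> 0 < mu ->
  let b n := sone R n + mu * a n in
  [/\ forall n, 0 < b n, forall n, b n.+1 <= b n &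
      forall n, b n.+1 ^+ 2 <= b n * b n.+2].
Proof.
move=> a0 a1 a2 mu0 /=; split=> m.
  - by rewrite ltr_wpDl ?ler0n// mulr_gt0.
  - by rewrite lerD// /sone ?ler_nat//= ?ler_wpM2l// ltW.
  - have := a2 m; have := a0 m; have := a0 m.+1; have := a0 m.+2.
    rewrite /sone/= => m2 m1 m0 lc; rewrite add0r add0r.
    rewrite exprMn mulrDl; apply: ler_wpDl.
      by rewrite mulr_ge0 ?ler0n// mulr_ge0 ?(ltW mu0) ?(ltW m2)//.
    by have := ler_wpM2l (exprn_ge0 2 (ltW mu0)) lc; lra.
Qed.

(** As [w1 - w2 = w1 * (b2 - b1) * d2] for the Cauchy product, with [b2 - b1 = (mu2 - mu1) a] and
    [mu2 a * d2 = sone - d2], the difference is a nonnegative multiple of [w1 * (sone - d2)]. By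
    Kaluza's theorem both factors are nonnegative. *)
Lemma kaluza_antimono (R : realFieldType) (a d1 d2 : nat -> R) (mu1 mu2 : R) n :
  (forall n, 0 < a n) -> (forall n, a n.+1 <= a n) ->
  (forall n, a n.+1 ^+ 2 <= a n * a n.+2) ->
  0 < mu1 -> mu1 <= mu2 ->
  sconv (fun n => sone R n + mu1 * a n) d1 = sone R ->
  sconv (fun n => sone R n + mu2 * a n) d2 = sone R ->
  sconv d2 (fun=> 1) n <= sconv d1 (fun=> 1) n.
Proof.
move=> a0 a1 a2 mu10 mu12.
have mu20 : 0 < mu2 by apply: lt_le_trans mu12.
have bP mu := affine_logconvex a0 a1 a2 (mu := mu).
set b1 := fun n => _; set b2 := (X in _ -> sconv X d2 = _ -> _) => bd1 bd2.
have [b10 b11 b12] := bP _ mu10; have [b20 b21 b22] := bP _ mu20.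
rewrite -subr_ge0.
set w1 := sconv d1 _; set w2 := sconv d2 _.
have key : w1 n - w2 n = (mu2 - mu1) / mu2 * sconv w1 (fun i => sone R i - d2 i) n.
  have e1 : w1 = sconv w1 (sconv b2 d2) by rewrite bd2 sconv1.
  have e2 : w2 = sconv w1 (sconv b1 d2).
    rewrite /w1 /w2 sconvA [sconv (sconv d1 _) b1]sconvC sconvA bd1.
    by rewrite [sconv (sone _) _]sconvC sconv1 sconvC.
  rewrite {1}e1 e2 -sconvBr -sconvZr; congr sconv; apply/funext => i.
  have b21E : b2 = fun i => b1 i + (mu2 - mu1) * a i.
    by apply/funext => j; rewrite /b1 /b2; ring.
  have d2aE : sone R i = d2 i + mu2 * sconv d2 a i.
    rewrite -[in LHS]bd2 sconvC sconvDr sconv1; congr (_ + _).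
    exact: sconvZr.
  have -> : sconv b2 d2 i = sconv b1 d2 i + (mu2 - mu1) * sconv d2 a i.
    by rewrite sconvC b21E sconvDr sconvZr (sconvC d2 b1).
  by rewrite d2aE; field; rewrite gt_eqF.
rewrite key; apply: mulr_ge0; first by rewrite divr_ge0 ?subr_ge0// ltW.
apply: sconv_ge0 => [i|[|i]]; first exact: (kaluza_ge0 b10 b11 bd1).
  rewrite (kaluza0 b20 bd2) subr_ge0 invf_le1//.
  by rewrite /b2 /sone/= lerDl mulr_ge0 ?(ltW mu20) ?(ltW (a0 _)).
by rewrite sub0r oppr_ge0; exact: (kaluza b20 b22 bd2).
Qed.

(** * The relaxation function *)

Section kernel.
Context (R : realType) (al c : R).
Hypotheses (al01 : 0 < al < 1) (c_ge0 : 0 <= c).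

Definition sing_kernel (t : R) : R := 1 + c * t `^ (- al).

Definition sing_primitive (t : R) : R := t + c / (1 - al) * t `^ (1 - al).

Local Notation k := sing_kernel.
Local Notation K := sing_primitive.

Let al1 : 0 < 1 - al. Proof. by have /andP[] := al01; lra. Qed.

(** No sign condition on [t]: [powR] is nonnegative everywhere, also at the singularity, so
    integrands need no case distinction. *)
Lemma sing_kernel_ge1 t : 1 <= k t.
Proof. by rewrite lerDl mulr_ge0// powR_ge0. Qed.

Lemma sing_primitive0 : K 0 = 0.
Proof. by rewrite /K powR0 ?mulr0 ?addr0// gt_eqF. Qed.

Lemma is_derive_sing_primitive (x : R) : 0 < x -> is_derive x 1 K (k x).
Proof.
move=> x0; have h := is_derive1_powR (1 - al) x0.
apply: (is_derive_eq (is_deriveD (is_derive_id x 1) (is_deriveZ (c / (1 - al)) h))).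
rewrite /k /= addrAC subrr add0r /GRing.scale/= mulrA divfK// gt_eqF//.
Qed.

Lemma cvg_sing_primitive0 : K x @[x --> 0^'+] --> (0 : R).
Proof.
rewrite -[X in _ --> X](addr0 (0 : R)); apply: cvgD.
  by apply: cvg_at_right_filter; exact: cvg_id.
rewrite -[X in _ --> X](mulr0 (c / (1 - al))); apply: cvgMr.
exact: powR_cvg0.
Qed.

(** The power has no usable derivative at 0, so continuity there comes from the one-sided limit. *)
Lemma continuous_sing_primitive : continuous (fun x : R => K (Num.max 0 x)).
Proof.
apply: (@continuous_clamp R R `[0, +oo[%classic (Num.max 0) K); first exact: continuous_maxl.
  by move=> x; rewrite /= in_itv/= andbT le_max lexx.
apply/continuous_within_itvcyP; split.
  move=> x; rewrite in_itv/= andbT => x0.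
  have := is_derive_sing_primitive x0 => -[dK _].
  by apply: differentiable_continuous; apply/derivable1_diffP.
rewrite sing_primitive0; exact: cvg_sing_primitive0.
Qed.

Lemma sing_kernel_antimono x y : 0 < x -> x <= y -> k y <= k x.
Proof.
move=> x0 xy; rewrite lerD2l ler_wpM2l// !powRN.
rewrite lef_pV2 ?posrE ?powR_gt0//; last exact: lt_le_trans xy.
by rewrite ge0_ler_powR ?nnegrE//; have /andP[] := al01; lra.
Qed.

(** For the pure power this is [x * (x + 2 * h) <= (x + h) ^+ 2] raised to a negative exponent; the
    added constant 1 produces linear terms, handled by the arithmetic-geometric mean inequality. *)
Lemma sing_kernel_logconvex x h : 0 < x -> 0 <= h ->
  k (x + h) ^+ 2 <= k x * k (x + 2 * h).
Proof.
move=> x0 h0.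
have y0 : 0 < x + h by lra.
have z0 : 0 < x + 2 * h by lra.
have X := powR_gt0 (- al) x0; have Y := powR_gt0 (- al) y0.
have Z := powR_gt0 (- al) z0.
have XZ : ((x + h) `^ (- al)) ^+ 2 <= x `^ (- al) * (x + 2 * h) `^ (- al).
  rewrite expr2 -!powRM ?(ltW x0) ?(ltW y0) ?(ltW z0)// !powRN.
  rewrite lef_pV2 ?posrE ?powR_gt0 ?mulr_gt0//.
  rewrite ge0_ler_powR ?nnegrE ?mulr_ge0 ?(ltW x0) ?(ltW y0) ?(ltW z0)//.
    by have /andP[] := al01; lra.
  by nra.
rewrite /k; move: X Y Z XZ; set X := x `^ _; set Y := (x + h) `^ _; set Z := _ `^ _.
move=> X0 Y0 Z0 XZ.
have XZ2 : 2 * Y <= X + Z.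
  rewrite -(ler_sqr (x := 2 * Y)) ?nnegrE ?addr_ge0 ?mulr_ge0 ?(ltW X0) ?(ltW Y0) ?(ltW Z0)//.
  have -> : (X + Z) ^+ 2 = (X - Z) ^+ 2 + 4 * (X * Z) by ring.
  by have := sqr_ge0 (X - Z); rewrite exprMn; lra.
by have := ler_wpM2l (sqr_ge0 c) XZ; have := ler_wpM2l c_ge0 XZ2; lra.
Qed.

Variable h : R.
Hypothesis h_gt0 : 0 < h.

(** The integral of the kernel over the [n]-th cell of the grid of step [h]. *)
Definition sing_incr (n : nat) : R := K (n.+1%:R * h) - K (n%:R * h).
Local Notation a := sing_incr.

Let KD (y s : R) : 0 <= y -> 0 < s -> is_derive s 1 (fun s : R => K (y + s)) (k (y + s)).
Proof.
move=> y0 s0.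
have d1 : is_derive s 1 (fun s : R => y + s) 1.
  by rewrite -[X in is_derive _ _ _ X]add0r; apply: is_deriveD.
have ys : 0 < y + s by lra.
have := is_derive1_comp (f := K) (is_derive_sing_primitive ys) d1.
by rewrite mulr1.
Qed.

Let KC (y : R) : 0 <= y -> {within `[0, h], continuous (fun s : R => K (y + s))}.
Proof.
move=> y0.
apply: (@within_continuous_eq _ _ _ _ (fun s : R => K (Num.max 0 (y + s)))).
  move=> s; rewrite /= in_itv/= => /andP[s0 _]; rewrite max_r//; lra.
move=> s; apply: (@continuous_comp _ _ _ (fun s => y + s) (fun x : R => K (Num.max 0 x))).
  by apply: cvgD; [exact: cvg_cst|exact: cvg_id].
exact: continuous_sing_primitive.
Qed.

Let nh n : 0 <= n%:R * h. Proof. by rewrite mulr_ge0// ltW. Qed.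
Let nS n : n.+1%:R * h = n%:R * h + h.
Proof. by rewrite -natr1 mulrDl mul1r. Qed.

Lemma sing_incr_gt0 n : 0 < a n.
Proof.
have [] := @MVT_segment R (fun s : R => K (n%:R * h + s))
  (fun s : R => k (n%:R * h + s)) 0 h (ltW h_gt0).
- by move=> x; rewrite in_itv/= => /andP[x0 _]; exact: KD.
- exact: KC.
- move=> x _; rewrite addr0 -nS subr0 /sing_incr => ->; rewrite mulr_gt0//.
  by apply: lt_le_trans (sing_kernel_ge1 _).
Qed.

Let k_pos x : 0 < k x. Proof. exact: lt_le_trans (sing_kernel_ge1 _). Qed.

Lemma sing_incr_ndecr n : a n.+1 <= a n.
Proof.
(* [F h - F 0 = a n - a n.+1], so it is enough that [F] is nondecreasing. *)
pose F (s : R) := K (n%:R * h + s) - K (n.+1%:R * h + s).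
have d (x : R) : 0 < x -> is_derive x 1 F (k (n%:R * h + x) - k (n.+1%:R * h + x)).
  by move=> x0; apply: is_deriveB; exact: KD.
have C : {within `[0, h], continuous F} by apply: within_continuousB; exact: KC.
have : F 0 <= F h.
  have D1 (x : R) : x \in `]0, h[ -> derivable F x 1.
    by rewrite in_itv/= => /andP[/d[]].
  suff D2 (x : R) : x \in `]0, h[ -> 0 <= derive1 F x.
    have h0 := ltW h_gt0.
    by apply: (ger0_derive1_le_cc D1 D2 C); rewrite // in_itv/= ?lexx ?h0.
  - rewrite in_itv/= => /andP[x0 _].
    rewrite derive1E (@derive_val _ _ _ _ _ _ _ (d x x0)) subr_ge0 sing_kernel_antimono//.
      by rewrite ltr_wpDl.
    by rewrite nS -addrA lerD2l lerDr ltW.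
by rewrite /F !addr0 -!nS /sing_incr; lra.
Qed.

Lemma sing_incr_logconvex n : a n.+1 ^+ 2 <= a n * a n.+2.
Proof.
have an := sing_incr_gt0 n; have an1 := sing_incr_gt0 n.+1.
(* It suffices to bound [2 a(n+1)] by [l a(n) + a(n+2) / l] for every [l > 0],
   which is linear in [a] and so follows by integrating the same bound for [k]. *)
suff key l : 0 < l -> 2 * a n.+1 <= l * a n + l^-1 * a n.+2.
  (* The optimal [l]: the bound becomes [2 * a n.+1 <= a n.+1 + a n * a n.+2 / a n.+1]. *)
  have /key : 0 < a n.+1 / a n by rewrite divr_gt0.
  rewrite divfK ?gt_eqF// invf_div => h2.
  rewrite -subr_ge0; have -> : a n * a n.+2 - a n.+1 ^+ 2 =
     a n.+1 * (a n.+1 + a n / a n.+1 * a n.+2 - 2 * a n.+1).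
    by field; rewrite gt_eqF.
  by apply: mulr_ge0; [exact: ltW|rewrite subr_ge0].
move=> l0.
pose F (s : R) := l * K (n%:R * h + s) + l^-1 * K (n.+2%:R * h + s) - 2 * K (n.+1%:R * h + s).
have d (x : R) : 0 < x -> is_derive x 1 F
   (l * k (n%:R * h + x) + l^-1 * k (n.+2%:R * h + x) - 2 * k (n.+1%:R * h + x)).
  move=> x0.
  have dZ m y : 0 <= y -> is_derive x 1 (fun s : R => m * K (y + s)) (m * k (y + x)).
    by move=> y0; exact: (is_deriveZ m (KD y0 x0)).
  by apply: is_deriveB; first apply: is_deriveD; apply: dZ.
have C : {within `[0, h], continuous F}.
  have CZ m y : 0 <= y -> {within `[0, h], continuous (fun s : R => m * K (y + s))}.
    by move=> y0 x; apply: cvgMr; exact: KC.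
  by apply: within_continuousB; [apply: within_continuousD|]; exact: CZ.
have : F 0 <= F h.
  have D1 (x : R) : x \in `]0, h[ -> derivable F x 1.
    by rewrite in_itv/= => /andP[/d[]].
  suff D2 (x : R) : x \in `]0, h[ -> 0 <= derive1 F x.
    have h0 := ltW h_gt0.
    by apply: (ger0_derive1_le_cc D1 D2 C); rewrite // in_itv/= ?lexx ?h0.
  - rewrite in_itv/= => /andP[x0 _].
    have y0 : 0 < n%:R * h + x by rewrite ltr_wpDl.
    have := sing_kernel_logconvex y0 (ltW h_gt0).
    have -> : n%:R * h + x + h = n.+1%:R * h + x by rewrite nS addrAC.
    have -> : n%:R * h + x + 2 * h = n.+2%:R * h + x by rewrite !nS; ring.
    rewrite derive1E (@derive_val _ _ _ _ _ _ _ (d x x0)).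
    have := k_pos (n%:R * h + x); have := k_pos (n.+1%:R * h + x).
    have := k_pos (n.+2%:R * h + x).
    move: (k _) (k _) (k _) => Z X Y Z0 Y0 X0 XZ.
    rewrite subr_ge0 -(ler_sqr (x := 2 * X)) ?nnegrE; last 2 first.
      by rewrite mulr_ge0// ltW.
      by rewrite addr_ge0// mulr_ge0 ?invr_ge0// ltW.
    have -> : (l * Z + l^-1 * Y) ^+ 2 = (l * Z - l^-1 * Y) ^+ 2 + 4 * (Z * Y).
      by field; rewrite gt_eqF.
    by have := sqr_ge0 (l * Z - l^-1 * Y); rewrite exprMn; lra.
by rewrite /F !addr0 -!nS /sing_incr; lra.
Qed.

End kernel.

(** * Integrals of the singular kernel *)

Section integrals.
Context (R : realType).
Local Notation mu := (@lebesgue_measure R).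

Lemma integrable_continuousM (g q : R -> R) (a b : R) : continuous g ->
  mu.-integrable `[a, b] (EFin \o q) ->
  mu.-integrable `[a, b] (EFin \o (fun s => g s * q s)).
Proof.
move=> cg iq.
have [M [_ /(_ (M + 1))]] : bounded_set (g @` `[a, b]).
  apply: compact_bounded; apply: continuous_compact; last exact: segment_compact.
  exact: continuous_subspaceT.
rewrite ltrDl ltr01 => /(_ isT) gM.
have M0 s : s \in `[a, b] -> `|g s| <= M + 1 by move=> sab; apply: gM; exists s.
have /(_ (measurable_itv _)) iMq := integrableZl _ (M + 1) iq.
have h := le_integrable _ _ _ iMq; apply: h => //.
- apply/measurable_EFinP; apply: measurable_funM.
    by apply: measurable_funTS; exact: continuous_measurable_fun.
  by apply/measurable_EFinP; exact: measurable_int iq.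
- move=> s sab; rewrite /= lee_fin !normrM ler_wpM2r// (le_trans (M0 _ _))//.
  by rewrite ler_norm.
Qed.

Lemma integrable_continuous (g : R -> R) (a b : R) : continuous g ->
  mu.-integrable `[a, b] (EFin \o g).
Proof.
move=> cg; apply: continuous_compact_integrable; first exact: segment_compact.
exact: continuous_subspaceT.
Qed.

End integrals.

Section kernel_integral.
Context (R : realType) (al c : R).
Hypotheses (al01 : 0 < al < 1) (c_ge0 : 0 <= c).
Local Notation mu := (@lebesgue_measure R).
Local Notation k := (sing_kernel al c).
Local Notation K := (sing_primitive al c).

Lemma measurable_sing_kernel (t : R) (D : set R) : measurable D ->
  measurable_fun D (fun s : R => (k (t - s))%:E).
Proof.
move=> mD; apply/measurable_EFinP; apply: measurable_funTS.
apply: measurable_funD => //; apply: measurable_funM => //.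
apply: (@measurableT_comp _ _ _ _ _ _ (fun x : R => x `^ (- al))).
  exact: measurable_powR.
exact: measurable_funB.
Qed.

Let ge0k x : 0 <= k x. Proof. exact: (le_trans ler01 (sing_kernel_ge1 al c_ge0 x)). Qed.

Let integral_lt (t x y : R) : x <= y -> y < t ->
  (\int[mu]_(s in `[x, y]) (k (t - s))%:E = (K (t - x) - K (t - y))%:E)%E.
Proof.
rewrite le_eqVlt => /predU1P[<- _|xy yt].
  by rewrite set_itv1 integral_set1 subrr.
have d s : s < t -> is_derive s 1 (fun s : R => - K (t - s)) (k (t - s)).
  move=> st; have ts0 : 0 < t - s by rewrite subr_gt0.
  have d1 : is_derive s 1 (fun s : R => t - s) (-1).
    by rewrite -[X in is_derive _ _ _ X]add0r; apply: is_deriveB.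
  have := is_deriveN (@is_derive1_comp _ K (fun s : R => t - s) s _ _
    (is_derive_sing_primitive c al01 ts0) d1).
  by rewrite mulrN1 opprK.
have cF s : s < t -> {for s, continuous (fun s : R => - K (t - s))}.
  move=> /d[ds _]; apply: differentiable_continuous; exact/derivable1_diffP.
rewrite (@continuous_FTC2 _ _ (fun s : R => - K (t - s)) _ _ xy).
- by rewrite EFinN -EFinB opprK addrC.
- apply: derivable_within_continuous => s; rewrite in_itv/= => /andP[_ sy].
  have ts0 : 0 < t - s by rewrite subr_gt0 (le_lt_trans sy).
  have d1 : is_derive s 1 (fun s : R => t - s) (-1).
    by rewrite -[X in is_derive _ _ _ X]add0r; apply: is_deriveB.
  have d2 := @is_derive1_comp _ (fun x : R => x `^ (- al)) (fun s : R => t - s) s _ _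
    (is_derive1_powR (- al) ts0) d1.
  by have [] := is_deriveD (is_derive_cst (1 : R) s 1) (is_deriveZ c d2).
- split.
  + by move=> s; rewrite in_itv/= => /andP[_ sy]; have [] := d s (lt_trans sy yt).
  + by apply: cvg_at_right_filter; apply: cF; apply: lt_trans yt.
  + by apply: cvg_at_left_filter; apply: cF.
- move=> s; rewrite in_itv/= => /andP[_ sy].
  by rewrite derive1E (@derive_val _ _ _ _ _ _ _ (d s (lt_trans sy yt))).
Qed.

(** For [y < t] the integrand is smooth and the fundamental theorem of calculus applies. At [y = t]
    it is singular, and the segment is exhausted from the left by monotone convergence. *)
Lemma integral_sing_kernel (t x y : R) : x <= y -> y <= t ->
  (\int[mu]_(s in `[x, y]) (k (t - s))%:E = (K (t - x) - K (t - y))%:E)%E.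
Proof.
move=> xy; rewrite le_eqVlt => /predU1P[yt|]; last exact: integral_lt.
move: xy; rewrite le_eqVlt => /predU1P[<-|xy].
  by rewrite set_itv1 integral_set1 subrr.
pose z (i : nat) := y - (y - x) / i.+1%:R.
have yx0 : 0 < y - x by rewrite subr_gt0.
have zy i : z i < y by rewrite ltrBlDr ltrDl divr_gt0.
have xz i : x <= z i.
  by rewrite lerBrDl -lerBrDr ler_pdivrMr// ler_peMr ?(ltW yx0)// ler1n.
rewrite -integral_itv_bndo_bndc; last exact: measurable_sing_kernel.
have -> : `[x, y[%classic = \bigcup_i `[x, z i]%classic.
  apply/seteqP; split => [s|s [i _]] /=; rewrite !in_itv/= => /andP[xs sy].
    have ys0 : 0 < y - s by rewrite subr_gt0.
    (* An index [i] with [(y - x) / i.+1 < y - s], so that [s < z i]. *)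
    exists (Num.truncn ((y - x) / (y - s))) => //=; rewrite in_itv/= xs/=.
    rewrite lerBrDl -lerBrDr ler_pdivrMr// -ler_pdivrMl// mulrC ltW//.
    by rewrite truncnS_gt.
  by rewrite xs (le_lt_trans sy (zy i)).
apply: (cvg_unique _ (ge0_nondecreasing_set_cvg_integral _ _ _ _)) => //.
- move=> i j ij; apply/subsetPset; apply: subset_itvl; rewrite bnd_simp.
  by rewrite lerD2l lerN2 ler_wpM2l ?(ltW yx0)// lef_pV2 ?posrE// ler_nat ltnS.
- by move=> i; exact: measurable_sing_kernel.
- by move=> i s _; rewrite lee_fin ge0k.
- have z0 : y - z i @[i --> \oo] --> (0 : R).
    rewrite -[X in _ --> X](mulr0 (y - x)).
    rewrite (_ : (fun i => _) = (fun i => (y - x) * @harmonic R i)); last first.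
      by apply/funext => i; rewrite /z opprB addrC subrK.
    by apply: cvgMr; exact: cvg_harmonic.
  have Kz : K (y - z i) @[i --> \oo] --> (0 : R).
    rewrite -(sing_primitive0 c al01) -[X in K X](maxxx (0 : R)).
    rewrite (_ : (fun i => _) = (fun i => K (Num.max 0 (y - z i)))); last first.
      by apply/funext => i; rewrite max_r// subr_ge0 ltW.
    exact: (cvg_comp _ _ z0 (@continuous_sing_primitive _ _ c al01 0)).
  rewrite /= -yt (_ : (fun i => _) = (fun i => (K (y - x) - K (y - z i))%:E)); last first.
    by apply/funext => i; rewrite integral_lt// yt.
  apply: cvg_EFin; first by near=> i.
  rewrite subrr sing_primitive0//; apply: cvgB => //; exact: cvg_cst.
Unshelve. all: by end_near. Qed.

End kernel_integral.

Section kernel_integrable.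
Context (R : realType) (al c : R).
Hypotheses (al01 : 0 < al < 1) (c_ge0 : 0 <= c).
Local Notation mu := (@lebesgue_measure R).
Local Notation k := (sing_kernel al c).
Local Notation K := (sing_primitive al c).

Lemma integrable_sing_kernel (t x y : R) : y <= t ->
  mu.-integrable `[x, y] (EFin \o (fun s : R => k (t - s))).
Proof.
move=> yt; have [xy|yx] := leP x y; last first.
  by rewrite set_itv_ge -?leNgt ?bnd_simp//; exact: integrable_set0.
apply/integrableP; split; first exact: measurable_sing_kernel.
under eq_integral do rewrite gee0_abs ?lee_fin ?(le_trans ler01 (sing_kernel_ge1 al c_ge0 _))//.
by rewrite integral_sing_kernel// ltry.
Qed.

Lemma Rintegral_sing_kernel (t x y : R) : x <= y -> y <= t ->
  \int[mu]_(s in `[x, y]) (k (t - s)) = K (t - x) - K (t - y).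
Proof. by move=> xy yt; rewrite /Rintegral integral_sing_kernel. Qed.

Lemma le_integral_sing_kernel (g : R -> R) (t x y B : R) : continuous g ->
  x <= y -> y <= t -> (forall s, x <= s <= y -> `|g s| <= B) ->
  `|\int[mu]_(s in `[x, y]) (k (t - s) * g s)| <= B * (K (t - x) - K (t - y)).
Proof.
move=> cg xy yt gB.
have ik := integrable_sing_kernel x yt.
have ig : mu.-integrable `[x, y] (EFin \o (fun s : R => k (t - s) * g s)).
  rewrite (_ : (fun s : R => _) = (fun s : R => g s * k (t - s))).
    exact: integrable_continuousM.
  by apply/funext => s; rewrite mulrC.
rewrite -Rintegral_sing_kernel// -RintegralZl//.
apply: (le_trans (le_normr_Rintegral _ ig)) => //.
apply: le_Rintegral => //.
- exact: (integrable_norm ig).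
- have /(_ (measurable_itv _)) := integrableZl _ B ik.
  by apply: eq_integrable => // s _; rewrite /= EFinM.
- move=> s /=; rewrite in_itv/= => xsy.
  have k0 : 0 <= k (t - s) := le_trans ler01 (sing_kernel_ge1 al c_ge0 _).
  by rewrite normrM mulrC ler_pM ?gB// ger0_norm.
Qed.

End kernel_integrable.

(** * From the fractional equation to the Volterra equation *)

Section volterra.
Context (R : realType) (gamma al mu : R) (w : R -> R).
Hypotheses (gamma_gt0 : 0 < gamma) (al01 : 0 < al < 1) (mu_gt0 : 0 < mu)
  (wP : relaxation_solution gamma al mu w).
Local Notation leb := (@lebesgue_measure R).
Local Notation c := (gamma / Gamma (1 - al)).
Local Notation k := (sing_kernel al c).
Local Notation K := (sing_primitive al c).

Local Notation W := (nneg_ext w).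

Lemma Gamma_ge0 (b : R) : 0 <= Gamma b.
Proof. by apply: Rintegral_ge0 => x _; rewrite mulr_ge0 ?powR_ge0// expR_ge0. Qed.

Let c_ge0 : 0 <= c. Proof. by rewrite divr_ge0 ?Gamma_ge0// ltW. Qed.

Lemma continuous_relaxation : continuous W.
Proof. by case: wP => + _ _ _ _; exact: continuous_nneg_ext. Qed.

Let J t := \int[leb]_(s in `[0, t]) (k (t - s) * W s).

Let JE (t : R) : 0 < t -> J t = \int[leb]_(s in `[0, t]) W s + gamma * frac_conv al w t.
Proof.
move=> t0.
have i1 : leb.-integrable `[0, t] (EFin \o (fun s : R => (t - s) `^ (- al))).
  have ik := integrable_sing_kernel al01 ler01 0 (lexx t).
  have i0 := integrable_continuous 0 t (@cst_continuous R R 1).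
  have /(_ (measurable_itv _)) := integrableB _ ik i0.
  apply: eq_integrable => // s _.
  by rewrite /= /sing_kernel mul1r -EFinB addrAC subrr add0r.
have iW := integrable_continuous 0 t continuous_relaxation.
have iPW := integrable_continuousM continuous_relaxation i1.
have -> : frac_conv al w t =
    (Gamma (1 - al))^-1 * \int[leb]_(s in `[0, t]) (W s * (t - s) `^ (- al)).
  rewrite -RintegralZl//; apply: eq_Rintegral => s.
  rewrite inE/= in_itv/= => /andP[s0 _].
  rewrite /gker nneg_ext_id//.
  have -> : 1 - al - 1 = - al by ring.
  by ring.
rewrite mulrA -RintegralZl//.
rewrite -RintegralD//; last first.
  have /(_ (measurable_itv _)) := integrableZl _ c iPW.
  by apply: eq_integrable => // s _; rewrite /= EFinM.
by apply: eq_Rintegral => s _; rewrite /sing_kernel; ring.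
Qed.

(** The fractional equation is the derivative of the Volterra equation: [J] is the primitive of [w]
    plus [gamma] times [frac_conv], and these differentiate to [w] and to the Riemann-Liouville
    derivative. *)
Let volt_deriv (t : R) : 0 < t -> is_derive t 1 (fun t : R => w t + mu * J t) 0.
Proof.
move=> t0; case: wP => cw w0 dw dF eqw.
have [dW W'] : derivable (fun x : R => \int[leb]_(s in `[0, x]) W s) t 1 /\
    derive1 (fun x : R => \int[leb]_(s in `[0, x]) W s) t = W t.
  have tt1 : t < t + 1 by rewrite ltrDl.
  apply: (continuous_FTC1_closed tt1) => //.
    by apply: integrable_continuous; exact: continuous_relaxation.
  exact: continuous_relaxation.
pose D := derive1 w t + mu * (W t + gamma * derive1 (frac_conv al w) t).
have -> : 0 = D by rewrite /D nneg_ext_id ?(ltW t0)// eqw.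
apply: (@near_eq_is_derive _ _ _ (fun x : R => w x + mu *
    (\int[leb]_(s in `[0, x]) W s + gamma * frac_conv al w x))).
  near=> x; rewrite JE//; near: x; exact: lt_nbhsr.
have d1 : is_derive t 1 w (derive1 w t) by rewrite derive1E; apply: derivableP; exact: dw.
have d2 : is_derive t 1 (frac_conv al w) (derive1 (frac_conv al w) t).
  by rewrite derive1E; apply: derivableP; exact: dF.
have d3 : is_derive t 1 (fun x : R => \int[leb]_(s in `[0, x]) W s) (W t).
  by rewrite -W' derive1E; exact: derivableP.
exact: (is_deriveD d1 (is_deriveZ mu (is_deriveD d3 (is_deriveZ gamma d2)))).
Unshelve. all: by end_near. Qed.

(** The left-hand side is constant for [t > 0]. Its value is read off from the limit at [0^'+],
    where [w] tends to 1 and the integral, at most [2 * K x] near 0, tends to 0. *)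
Lemma relaxation_volterra (t : R) : 0 <= t ->
  w t + mu * \int[leb]_(s in `[0, t]) (k (t - s) * W s) = 1.
Proof.
rewrite -/(J t) le_eqVlt => /predU1P[<-|t0].
  rewrite /J set_itv1 Rintegral_set1 mulr0 addr0.
  by case: wP.
pose Hf (x : R) := w x + mu * J x.
have Hcst s : 0 < s -> s <= t -> Hf s = Hf t.
  move=> s0 st.
  have [] := @MVT_segment R Hf (fun=> 0) s t st.
  - by move=> x; rewrite in_itv/= => /andP[sx _]; apply: volt_deriv; exact: lt_trans sx.
  - apply: derivable_within_continuous => x; rewrite in_itv/= => /andP[sx _].
    by have [] := volt_deriv (lt_le_trans s0 sx).
  - by move=> x _ e; apply/esym/subr0_eq; rewrite e mul0r.
have cW := continuous_relaxation.
have W1 : W x @[x --> 0^'+] --> (1 : R).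
  have w0 : W 0 = 1 by rewrite nneg_ext_id//; case: wP.
  by rewrite -w0; apply: cvg_at_right_filter; exact: cW.
have J0 : J x @[x --> 0^'+] --> (0 : R).
  have WB : \forall x \near (0 : R), `|W x| <= 2.
    have w0 : W 0 = 1 by rewrite nneg_ext_id//; case: wP.
    have /cvgrPdist_le/(_ 1 ltr01) := cW 0; rewrite w0.
    apply: filterS => x h; have := ler_normB 1 (1 - W x).
    rewrite opprB addrC subrK normr1; lra.
  have [r /= r0 rB] := WB.
  apply/norm_cvg0P; apply: (@squeeze_cvgr _ _ _ _ (fun=> 0) (fun x => 2 * K x)).
  - near=> x; rewrite normr_ge0/=.
    have x0 : 0 < x by near: x; exact: nbhs_right_gt.
    have := @le_integral_sing_kernel _ al c al01 c_ge0 W x 0 x 2 cW (ltW x0) (lexx x).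
    rewrite subrr sing_primitive0// !subr0; apply.
    move=> s /andP[s0 sx]; apply: rB; rewrite /ball_/= sub0r normrN ger0_norm//.
    rewrite (le_lt_trans sx)//; near: x; exact: nbhs_right_lt.
  - exact: cvg_cst.
  - rewrite -[X in _ --> X](mulr0 (2 : R)); apply: cvgMr; exact: cvg_sing_primitive0.
have H1 : W x + mu * J x @[x --> 0^'+] --> (1 : R).
  rewrite -[X in _ --> X]addr0; apply: cvgD => //.
  by rewrite -[X in _ --> X](mulr0 mu); apply: cvgMr.
have H2 : W x + mu * J x @[x --> 0^'+] --> Hf t.
  apply: cvg_near_cst; near=> x.
  have x0 : 0 < x by near: x; exact: nbhs_right_gt.
  have xt : x <= t by near: x; exact: nbhs_right_le.
  have -> : W x = w x by rewrite nneg_ext_id// ltW.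
  exact: (Hcst x x0 xt).
exact/esym/(@cvg_unique _ (@Rhausdorff R) _ _ _ _ H1 H2).
Unshelve. all: by end_near. Qed.

End volterra.

(** * Discretisation of the Volterra equation *)

Section quadrature.
Context (R : realType) (gamma al : R).
Hypotheses (gamma_gt0 : 0 < gamma) (al01 : 0 < al < 1).
Local Notation leb := (@lebesgue_measure R).
Local Notation c := (gamma / Gamma (1 - al)).
Local Notation k := (sing_kernel al c).
Local Notation K := (sing_primitive al c).
Local Notation a := (sing_incr al c).

Let c_ge0 : 0 <= c. Proof. by rewrite divr_ge0 ?Gamma_ge0// ltW. Qed.

Lemma sing_primitive_ndecr (x y : R) : 0 <= x -> x <= y -> K x <= K y.
Proof.
move=> x0 xy; rewrite lerD// ler_wpM2l//.
  by rewrite divr_ge0//; have /andP[] := al01; lra.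
by rewrite ge0_ler_powR ?nnegrE//; [have /andP[] := al01; lra|exact: le_trans xy].
Qed.

(** The kernel is integrated exactly over each cell and only [W] is frozen, at the right endpoint,
    so the singularity costs nothing: the error is the oscillation of [W] times the kernel mass. The
    upper limit [m] is separated from [n] to allow induction on it. *)
Lemma quadrature_error (W : R -> R) (h eta : R) (n m : nat) : continuous W ->
  0 < h -> (m <= n)%N ->
  (forall j s, (j < n)%N -> j%:R * h <= s <= j.+1%:R * h ->
     `|W s - W (j.+1%:R * h)| <= eta) ->
  `|\int[leb]_(s in `[0, m%:R * h]) (k (n%:R * h - s) * W s) -
    \sum_(j < m) a h (n.-1 - j) * W (j.+1%:R * h)| <=
  eta * (K (n%:R * h) - K ((n - m)%:R * h)).
Proof.
move=> cW h0 mn Weta.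
elim: m mn => [|m IH] mn.
  by rewrite mul0r set_itv1 Rintegral_set1 big_ord0 subn0 !subrr normr0 mulr0.
have mn' := ltnW mn.
have {IH} := IH mn'.
set n' := n%:R * h; set m0 := m%:R * h; set m1 := m.+1%:R * h.
have m00 : 0 <= m0 by rewrite mulr_ge0// ltW.
have m01 : m0 <= m1 by rewrite ler_wpM2r ?(ltW h0)// ler_nat.
have m1n : m1 <= n' by rewrite ler_wpM2r ?(ltW h0)// ler_nat.
have i1 : leb.-integrable `[0, m1] (EFin \o (fun s : R => k (n' - s) * W s)).
  rewrite (_ : (fun s : R => _) = (fun s : R => W s * k (n' - s))).
    by apply: integrable_continuousM => //; exact: integrable_sing_kernel.
  by apply/funext => s; rewrite mulrC.
have im : leb.-integrable `[m0, m1] (EFin \o (fun s : R => k (n' - s) * W s)).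
  apply: integrableS i1 => //; apply: subset_itvr; rewrite bnd_simp//.
have := @Rintegral_itvB _ _ _ _ m0 i1; rewrite !bnd_simp => /(_ m00 m01).
rewrite Rintegral_itv_obnd_cbnd; last first.
  by apply: integrableS i1 => //; apply: subset_itvr; rewrite bnd_simp.
rewrite big_ord_recr/=.
set I1 := \int[leb]_(t in `[0, m1]) _; set I0 := \int[leb]_(t in `[0, m0]) _.
set I2 := \int[leb]_(x in `[m0, m1]) _; set S := \sum_(i < m) _ => II IH.
have aE : a h (n.-1 - m) = K (n' - m0) - K (n' - m1).
  rewrite /sing_incr /n' /m0 /m1 -!mulrBl -!natrB//.
  by rewrite -subn1 -subnDA add1n -subSn.
have I2E : `|I2 - a h (n.-1 - m) * W m1| <= eta * (K (n' - m0) - K (n' - m1)).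
  have -> : I2 - a h (n.-1 - m) * W m1 =
      \int[leb]_(s in `[m0, m1]) (k (n' - s) * (W s - W m1)).
    rewrite aE -Rintegral_sing_kernel// -RintegralZr//; last exact: integrable_sing_kernel.
    rewrite -RintegralB//; last first.
      have ik := integrable_sing_kernel al01 c_ge0 m0 m1n.
      have /(_ (measurable_itv _)) := integrableZr _ (W m1) ik.
      by apply: eq_integrable => // s _; rewrite /= EFinM.
    by apply: eq_Rintegral => s _; rewrite mulrBr.
  apply: le_integral_sing_kernel => //.
    by move=> s; apply: cvgB; [exact: cW|exact: cvg_cst].
  by move=> s; exact: Weta.
have -> : I1 - (S + a h (n.-1 - m) * W m1) = (I0 - S) + (I2 - a h (n.-1 - m) * W m1).
  by rewrite -II; ring.
apply: (le_trans (ler_normD _ _)); apply: (le_trans (lerD IH I2E)).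
rewrite -mulrDr {1}/n' /m0 /m1 -!mulrBl -!natrB//.
set x := K _; set y := K _; set z := K _.
by have -> : x - y + (y - z) = x - z by ring.
Qed.

(** The samples [y] satisfy [sconv b y = 1 + q] with a small residual [q]; convolving with the
    inverse [d] shows that the error is [sconv d q], which [kaluza_stable] controls. *)
Lemma relaxation_approx (mu T e : R) (w : R -> R) : 0 < mu -> 0 < T -> 0 < e ->
  relaxation_solution gamma al mu w ->
  \forall N \near \oo, let h := T / N.+1%:R in
    forall d, sconv (fun n => sone R n + mu * a h n) d = sone R ->
    forall n, (n <= N.+1)%N -> `|w (n%:R * h) - sconv d (fun=> 1) n| <= e.
Proof.
move=> mu0 T0 e0 wP.
pose W := nneg_ext w.
have cW : continuous W := continuous_relaxation wP.
have W0 : W 0 = 1 by rewrite /W nneg_ext_id//; case: wP.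
have KT0 : 0 <= K T.
  by have := sing_primitive_ndecr (lexx 0) (ltW T0); rewrite sing_primitive0.
(* The error will be at most [2 * mu * (K h + eta * K T)]; each summand gets [e / (4 * mu)]. The
   added 1 only keeps the denominator positive. *)
pose eta := e / (4 * mu * (K T + 1)).
have KT1 : 0 < K T + 1 by rewrite ltr_wpDl.
have eta0 : 0 < eta by rewrite divr_gt0// !mulr_gt0.
have [del del0 Wdel] := segment_uniform_continuous 0 T cW eta0.
have h0 : T / N.+1%:R @[N --> \oo] --> (0 : R).
  by rewrite -[X in _ --> X](mulr0 T); apply: cvgMr; exact: cvg_harmonic.
have Kh0 : K (Num.max 0 (T / N.+1%:R)) @[N --> \oo] --> K (Num.max 0 0).
  exact: (cvg_comp _ _ h0 (@continuous_sing_primitive _ _ c al01 0)).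
rewrite maxxx sing_primitive0// in Kh0.
have e'0 : 0 < e / (4 * mu) by rewrite divr_gt0// mulr_gt0.
near=> N; set h := T / N.+1%:R; move=> d bd n nN.
have h_gt0 : 0 < h by rewrite divr_gt0.
have hdel : h < del.
  have : `|0 - T / N.+1%:R| < del by near: N; move/cvgrPdist_lt : h0; exact.
  by rewrite sub0r normrN gtr0_norm.
have Kh : K h <= e / (4 * mu).
  have : `|0 - K (Num.max 0 (T / N.+1%:R))| < e / (4 * mu).
    by near: N; move/cvgrPdist_lt : Kh0; exact.
  rewrite sub0r normrN max_r ?(ltW h_gt0)// => /ltW; apply: le_trans; exact: ler_norm.
have hT j : (j <= N.+1)%N -> j%:R * h <= T.
  move=> jN; rewrite mulrA ler_pdivrMr// mulrC ler_wpM2l ?(ltW T0)//.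
  by rewrite ler_nat.
have a0 := sing_incr_gt0 al01 c_ge0 h_gt0.
have a1 := sing_incr_ndecr al01 c_ge0 h_gt0.
have a2 := sing_incr_logconvex al01 c_ge0 h_gt0.
have a0K m : a h m <= K h.
  elim: m => [|m]; last exact: le_trans (a1 m).
  by rewrite /sing_incr mul1r mul0r sing_primitive0// subr0.
pose b n := sone R n + mu * a h n.
have [b0 b1 b2] : [/\ forall n, 0 < b n, forall n, b n.+1 <= b n &
      forall n, b n.+1 ^+ 2 <= b n * b n.+2].
  exact: affine_logconvex.
pose y j := W (j%:R * h).
pose q m := sconv b y m - 1.
have yw : w (n%:R * h) - sconv d (fun=> 1) n = sconv d q n.
  have nh0 : 0 <= n%:R * h by apply: mulr_ge0 => //; exact: ltW.
  rewrite -(nneg_ext_id w nh0) -/W -/(y n).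
  have -> : y = sconv d (sconv b y) by rewrite sconvA [sconv d b]sconvC bd sconvC sconv1.
  by rewrite -sconvBr.
rewrite yw.
have qQ m : (m <= n)%N -> `|q m| <= mu * (K h + eta * K T).
  move=> mn; have mN := leq_trans mn nN.
  have mh0 : 0 <= m%:R * h by apply: mulr_ge0 => //; exact: ltW.
  have := relaxation_volterra gamma_gt0 al01 wP mh0.
  rewrite -(nneg_ext_id w mh0) -/W -/(y m) => volt.
  set I1 := \int[leb]_(s in _) _ in volt.
  pose S1 := \sum_(j < m) a h (m.-1 - j) * W (j.+1%:R * h).
  (* The convolution exceeds the right-endpoint rule by the term of index 0, which is at most
     [K h]. *)
  have SE : sconv y (a h) m = a h m + S1.
    rewrite /sconv big_ord_recl/= /y mul0r W0 mul1r subn0; congr (_ + _).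
    apply: eq_bigr => j _; rewrite mulrC /bump/= add1n; congr (a h _ * _).
    by rewrite -subn1 -subnDA add1n.
  have qE : q m = mu * (a h m - (I1 - S1)).
    rewrite /q -[X in _ - X]volt sconvC sconvDr sconv1 sconvZr SE.
    move: (I1) (S1) (a h m) (y m) => ? ? ? ?; ring.
  have quad := @quadrature_error W h eta m m cW h_gt0 (leqnn m).
  rewrite qE normrM gtr0_norm// ler_pM2l//.
  apply: (le_trans (ler_normB _ _)); rewrite gtr0_norm//; apply: lerD => //.
  have {}quad : `|I1 - S1| <= eta * (K (m%:R * h) - K ((m - m)%:R * h)).
    apply: quad => j s jm /andP[js sj].
    have jT : j.+1%:R * h <= T by rewrite hT// (leq_trans jm).
    apply/ltW/Wdel.
      have jh0 : 0 <= j%:R * h by apply: mulr_ge0 => //; exact: ltW.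
      by rewrite (le_trans jh0 js) (le_trans sj jT).
    rewrite distrC ger0_norm ?subr_ge0//; apply: le_lt_trans hdel.
    by rewrite -natr1 mulrDl mul1r; move: js; set u := j%:R * h; lra.
  apply: (le_trans quad); rewrite subnn mul0r sing_primitive0// subr0.
  by rewrite ler_pM2l// sing_primitive_ndecr// hT.
apply: (le_trans (kaluza_stable b0 b1 b2 bd qQ)).
have b01 : 1 <= b 0%N by rewrite /b /sone/= lerDl mulr_ge0// ltW.
rewrite ler_pdivrMr//; apply: (@le_trans _ _ e); last by rewrite ler_peMr// ltW.
have eK : eta * K T <= e / (4 * mu).
  rewrite /eta mulrAC ler_pdivrMr ?mulr_gt0//.
  have -> : e / (4 * mu) * (4 * mu * (K T + 1)) = e * (K T + 1).
    by field; rewrite gt_eqF.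
  by rewrite ler_pM2l// lerDl.
have -> : e = 2 * (mu * (e / (4 * mu) + e / (4 * mu))).
  by field; rewrite gt_eqF.
by rewrite ler_pM2l// ler_pM2l// lerD.
Unshelve. all: by end_near. Qed.

End quadrature.

(** * Sign, monotonicity and decay of the relaxation function *)

Section relaxation.
Context (R : realType) (gamma al : R).
Hypotheses (gamma_gt0 : 0 < gamma) (al01 : 0 < al < 1).
Local Notation leb := (@lebesgue_measure R).
Local Notation c := (gamma / Gamma (1 - al)).
Local Notation a := (sing_incr al c).

Let c_ge0 : 0 <= c. Proof. by rewrite divr_ge0 ?Gamma_ge0// ltW. Qed.

Let kaluza_at (mu h : R) : 0 < mu -> 0 < h -> exists d,
  [/\ sconv (fun n => sone R n + mu * a h n) d = sone R,
    forall n, 0 <= sconv d (fun=> 1) n &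
    forall m n, (m <= n)%N -> sconv d (fun=> 1) n <= sconv d (fun=> 1) m].
Proof.
move=> mu0 h0.
have a0 := sing_incr_gt0 al01 c_ge0 h0.
have a1 := sing_incr_ndecr al01 c_ge0 h0.
have a2 := sing_incr_logconvex al01 c_ge0 h0.
have [b0 b1 b2] := affine_logconvex a0 a1 a2 mu0.
have [d bd] := @sconv_inverse _ (fun n => sone R n + mu * a h n) (lt0r_neq0 (b0 0%N)).
exists d; split => //; first exact: (kaluza_ge0 b0 b1 bd).
move=> m n /subnK <-; elim: (n - m)%N => // i.
by apply: le_trans; rewrite addSn; exact: (kaluza_ndecr b0 b2 bd).
Qed.

(** The grid is taken on [[0, t]], so that [t] is its last node, and the discrete inequality passes
    to the limit. *)
Lemma relaxation_ge0 (mu t : R) (w : R -> R) : 0 < mu ->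
  relaxation_solution gamma al mu w -> 0 <= t -> 0 <= w t.
Proof.
move=> mu0 wP; rewrite le_eqVlt => /predU1P[<-|t0].
  by case: wP => _ -> _ _ _; exact: ler01.
apply/ler_addgt0Pr => e e0.
have [N _ /(_ N (leqnn N)) /= Nap] := relaxation_approx gamma_gt0 al01 mu0 t0 e0 wP.
have h0 : 0 < t / N.+1%:R by rewrite divr_gt0.
have [d [bd d0 _]] := kaluza_at mu0 h0.
have := Nap d bd N.+1 (leqnn _); have := d0 N.+1.
by rewrite mulrCA divff ?pnatr_eq0// mulr1 ler_norml => ? /andP[]; lra.
Qed.

(** One grid is fine enough for both parameters, so the two discrete solutions can be compared at
    the same node. *)
Lemma relaxation_antimono_param (mu1 mu2 t : R) (w1 w2 : R -> R) : 0 < mu1 -> mu1 <= mu2 ->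
  relaxation_solution gamma al mu1 w1 -> relaxation_solution gamma al mu2 w2 ->
  0 <= t -> w2 t <= w1 t.
Proof.
move=> mu10 mu12 w1P w2P; rewrite le_eqVlt => /predU1P[<-|t0].
  by case: w1P => _ -> _ _ _; case: w2P => _ -> _ _ _.
have mu20 := lt_le_trans mu10 mu12.
apply/ler_addgt0Pr => e e0.
have e20 : 0 < e / 2 by rewrite divr_gt0.
have [N _ /(_ N (leqnn N)) /= [Nap1 Nap2]] := filterI
  (relaxation_approx gamma_gt0 al01 mu10 t0 e20 w1P)
  (relaxation_approx gamma_gt0 al01 mu20 t0 e20 w2P).
have h0 : 0 < t / N.+1%:R by rewrite divr_gt0.
have [d1 [bd1 _ _]] := kaluza_at mu10 h0.
have [d2 [bd2 _ _]] := kaluza_at mu20 h0.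
have := kaluza_antimono N.+1 (sing_incr_gt0 al01 c_ge0 h0)
  (sing_incr_ndecr al01 c_ge0 h0) (sing_incr_logconvex al01 c_ge0 h0) mu10 mu12 bd1 bd2.
have := Nap1 d1 bd1 N.+1 (leqnn _); have := Nap2 d2 bd2 N.+1 (leqnn _).
rewrite mulrCA divff ?pnatr_eq0// mulr1 !ler_norml => /andP[? ?] /andP[? ?]; lra.
Qed.

Lemma relaxation_antimono (mu s t : R) (w : R -> R) : 0 < mu ->
  relaxation_solution gamma al mu w -> 0 <= s -> s <= t -> w t <= w s.
Proof.
move=> mu0 wP s0; rewrite le_eqVlt => /predU1P[->//|st].
have t0 := le_lt_trans s0 st.
apply/ler_addgt0Pr => e e0.
have e30 : 0 < e / 3 by rewrite divr_gt0.
have [del del0 wdel] := segment_uniform_continuous 0 t (continuous_relaxation wP) e30.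
have h0 : t / N.+1%:R @[N --> \oo] --> (0 : R).
  by rewrite -[X in _ --> X](mulr0 t); apply: cvgMr; exact: cvg_harmonic.
have {}h0 : \forall N \near \oo, `|0 - t / N.+1%:R| < del.
  by move/cvgrPdist_lt : h0; exact.
have [N _ /(_ N (leqnn N)) /= [Nap hdel]] := filterI
  (relaxation_approx gamma_gt0 al01 mu0 t0 e30 wP) h0.
have {}h0 : 0 < t / N.+1%:R by rewrite divr_gt0.
rewrite sub0r normrN gtr0_norm// in hdel.
have [d [bd _ dm]] := kaluza_at mu0 h0.
have tN : N.+1%:R * (t / N.+1%:R) = t by rewrite mulrCA divff ?pnatr_eq0// mulr1.
set h := t / N.+1%:R in h0 hdel bd Nap tN.
(* The earlier time [s] need not be a node: it is replaced by the node just below, at the price of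
   the modulus of continuity, the third share of [e]. *)
pose n := Num.truncn (s / h).
have sh0 : 0 <= s / h by rewrite divr_ge0// ltW.
have ns : n%:R * h <= s by rewrite -ler_pdivlMr// truncn_le.
have sn : s < n.+1%:R * h by rewrite -ltr_pdivrMr// truncnS_gt.
have nN : (n <= N.+1)%N.
  rewrite -(ler_nat R) -(ler_pM2r h0) tN; exact: le_trans (ltW st).
have h1 := Nap d bd N.+1 (leqnn _); have h2 := Nap d bd n nN; have h3 := dm _ _ nN.
have := wdel s (n%:R * h); rewrite s0 (ltW st) => /(_ isT).
have nh0 : 0 <= n%:R * h by rewrite mulr_ge0// ltW.
rewrite !nneg_ext_id// ger0_norm ?subr_ge0//.
have -> : (s - n%:R * h < del).
  by apply: lt_trans hdel; rewrite ltrBlDl; move: sn; rewrite -natr1 mulrDl mul1r.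
move=> /(_ isT); move: h1 h2; rewrite tN !ler_norml ltr_norml.
by move=> /andP[? ?] /andP[? ?] /andP[? ?]; lra.
Qed.

Lemma relaxation_le1 (mu t : R) (w : R -> R) : 0 < mu ->
  relaxation_solution gamma al mu w -> 0 <= t -> w t <= 1.
Proof.
move=> mu0 wP t0; have := relaxation_antimono mu0 wP (lexx 0) t0.
by case: wP => _ -> _ _ _.
Qed.

(* Since [w] is nonincreasing and the kernel is at least 1, the Volterra equation
   gives [1 >= w t + mu * t * w t]. *)
Lemma relaxation_decay (mu t : R) (w : R -> R) : 0 < mu ->
  relaxation_solution gamma al mu w -> 0 <= t -> w t * (1 + mu * t) <= 1.
Proof.
move=> mu0 wP t0.
have cW := continuous_relaxation wP.
have W0 s : 0 <= nneg_ext w s by apply: (relaxation_ge0 mu0 wP); rewrite le_max lexx.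
have := relaxation_volterra gamma_gt0 al01 wP t0.
set I := Rintegral _ _ _ => volt.
suff Iw : t * w t <= I.
  have := ler_wpM2l (ltW mu0) Iw; move: volt.
  rewrite mulrDr mulr1; move: (mu * I) => mI volt.
  have -> : w t * (mu * t) = mu * (t * w t) by ring.
  by move: (mu * _) => x; lra.
have -> : t * w t = \int[leb]_(s in `[0, t]) w t.
  rewrite Rintegral_cst//; have := @lebesgue_measure_itv R `[0, t].
  move=> /= ->; rewrite lte_fin; case: ltP => [_|t1].
    by rewrite oppr0 adde0 mulrC.
  have -> : t = 0 by apply/eqP; rewrite eq_le t1 t0.
  by rewrite mul0r mulr0.
apply: le_Rintegral => //.
- by apply: integrable_continuous; exact: cst_continuous.
- rewrite (_ : (fun s : R => _) = (fun s : R => nneg_ext w s * sing_kernel al c (t - s))).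
    by apply: integrable_continuousM => //; exact: integrable_sing_kernel.
  by apply/funext => s; rewrite mulrC.
- move=> s; rewrite /= in_itv/= => /andP[s0 st].
  rewrite nneg_ext_id//; apply: (le_trans (relaxation_antimono mu0 wP s0 st)).
  by rewrite ler_peMl ?sing_kernel_ge1// (relaxation_ge0 mu0 wP).
Qed.

End relaxation.

(** * Hilbert space tools *)

Section L2_inner_product.
Context d (T : measurableType d) (R : realType) (mu : {measure set T -> \bar R}).
Local Notation L2 := (LspaceType2 mu).
Implicit Types u v w : L2.

Lemma Lspace2_Lfun v : (v : T -> R) \in Lfun mu 2%:E.
Proof.
by apply/andP; split; rewrite inE; [exact: measurable_Lspace|exact: Lebesgue_finite].
Qed.

Lemma Lspace2_integrable_mul v w : mu.-integrable setT (EFin \o (fun x => v x * w x)).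
Proof. exact/Lfun1_integrable/(Lfun2_mul_Lfun1 (Lspace2_Lfun v) (Lspace2_Lfun w)). Qed.

Lemma measurable_Lspace2_mul v w : measurable_fun setT (EFin \o (fun x => v x * w x)).
Proof. exact: measurable_int (Lspace2_integrable_mul v w). Qed.

Lemma L2dotC v w : L2dot v w = L2dot w v.
Proof. by apply: eq_Rintegral => x _; rewrite mulrC. Qed.

Lemma L2dot_linear (a : R) u v w : L2dot (a *: u + v) w = a * L2dot u w + L2dot v w.
Proof.
have iu := Lspace2_integrable_mul u w; have iv := Lspace2_integrable_mul v w.
rewrite /L2dot -RintegralZl// -RintegralD//; last first.
  have /(_ measurableT) := integrableZl _ a iu.
  by apply: eq_integrable => // x _; rewrite /= EFinM.
congr fine; apply: ae_eq_integral => //.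
- exact: measurable_Lspace2_mul.
- apply/measurable_EFinP; apply: measurable_funD.
    apply: measurable_funM => //; exact/measurable_EFinP/measurable_Lspace2_mul.
  exact/measurable_EFinP/measurable_Lspace2_mul.
- apply: (filterS _ (filterI (LspaceDE (a *: u) v) (LspaceZE a u))) => x [-> ->] _.
  by congr EFin; ring.
Qed.

Lemma L2norm_integral v : (`|v| ^+ 2)%:E = (\int[mu]_x (v x ^+ 2)%:E)%E.
Proof.
have nv : (`|v|%:E = 'N[mu]_2%:E[EFin \o v])%E.
  by rewrite Lspace_normE fineK// ge0_fin_numE ?Lnorm_ge0//; exact: Lebesgue_finite.
have := @poweR_Lnorm _ _ _ mu (EFin \o v) 2; rewrite -nv poweR_EFin powR_mulrn// => ->//.
apply: eq_integral => x _.
rewrite -[(EFin \o v) x]/((v x)%:E) abse_EFin poweR_EFin powR_mulrn//.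
by rewrite real_normK// num_real.
Qed.

Lemma L2dot_norm v : L2dot v v = `|v| ^+ 2.
Proof.
apply: EFin_inj; rewrite L2norm_integral /L2dot /Rintegral fineK.
  by apply: eq_integral => x _; rewrite expr2.
exact: integrable_fin_num (Lspace2_integrable_mul v v).
Qed.

Lemma measurable_sqr (f : T -> R) : measurable_fun setT f ->
  measurable_fun setT (fun x => (f x ^+ 2)%:E).
Proof. by move=> mf; apply/measurable_EFinP; exact: measurable_funX. Qed.

Lemma LspaceBE u v : \forall x \ae mu, (u - v : L2) x = u x - v x.
Proof.
rewrite -scaleN1r.
apply: (filterS _ (filterI (LspaceDE u (-1 *: v)) (LspaceZE (-1) v))) => x [-> ->].
by rewrite mulN1r.
Qed.

Lemma L2norm_sub_integral u v :
  (`|u - v| ^+ 2)%:E = (\int[mu]_x ((u x - v x) ^+ 2)%:E)%E.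
Proof.
rewrite L2norm_integral; apply: ae_eq_integral => //.
- by apply: measurable_sqr; exact: measurable_Lspace.
- by apply: measurable_sqr; apply: measurable_funB; exact: measurable_Lspace.
- by apply: filterS (LspaceBE u v) => x ->.
Qed.

Lemma Lspace2_of (f : T -> R) : measurable_fun setT f ->
  (\int[mu]_x (f x ^+ 2)%:E < +oo)%E ->
  exists v : L2, \forall x \ae mu, v x = f x.
Proof.
move=> mf f2.
have ff : finite_norm mu 2%:E f.
  apply: (@lty_poweRy _ _ 2) => //; rewrite poweR_Lnorm//.
  rewrite (eq_integral (fun x => (f x ^+ 2)%:E))// => x _.
  by rewrite -[(EFin \o f) x]/((f x)%:E) abse_EFin poweR_EFin powR_mulrn// real_normK// num_real.
exists (@Lspace_of _ T R mu _ (lee1n 2) f mf ff).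
by apply: filterS (Lspace_ofE (lee1n 2) mf ff) => x /(_ I).
Qed.

End L2_inner_product.

(** * Completeness of L2 *)

Section geometric_cauchy.
Context (R : realType).

Lemma sum_half (n : nat) (f : nat -> R) (B : R) :
  (forall k, f k <= B * 2^-1 ^+ k) -> forall m, 
  \sum_(n <= k < n + m) f k <= 2 * B * 2^-1 ^+ n - 2 * B * 2^-1 ^+ (n + m).
Proof.
move=> fB; elim=> [|m IH]; first by rewrite addn0 big_geq// subrr.
rewrite addnS big_nat_recr ?leq_addr//=; have := fB (n + m)%N.
by move: IH; rewrite exprS; move: (2^-1 ^+ (n + m)) => x; lra.
Qed.

Lemma geometric_cvg (V : completeNormedModType R) (y : nat -> V) (B : R) :
  (forall k, `|y k.+1 - y k| <= B * 2^-1 ^+ k) ->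
  exists2 l, y @ \oo --> l & forall n, `|l - y n| <= 2 * B * 2^-1 ^+ n.
Proof.
move=> yB.
have B0 : 0 <= B by have := yB 0%N; rewrite mulr1; apply: le_trans.
have ynm n m : `|y (n + m)%N - y n| <= 2 * B * 2^-1 ^+ n.
  rewrite -telescope_sumr ?leq_addr//.
  apply: (le_trans (ler_norm_sum _ _ _)).
  apply: (le_trans (sum_half n yB m)).
  by rewrite gerBl mulr_ge0// mulr_ge0.
have half0 : (2 * B * 2^-1 ^+ n) @[n --> \oo] --> (0 : R).
  rewrite -[X in _ --> X](mulr0 (2 * B)); apply: cvgMr.
  by apply: cvg_expr; rewrite ger0_norm ?invr_ge0// invf_lt1// ltr1n.
have cy : cvg (y @ \oo).
  apply/cauchy_cvgP/cauchy_exP => e e0.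
  have [N _ /(_ N (leqnn N))] := iffLR (cvgrPdist_lt _ _) half0 e e0.
  rewrite sub0r normrN ger0_norm ?mulr_ge0// => Ne.
  exists (y N); exists N => // n /= Nn; rewrite -ball_normE/= distrC.
  by rewrite -(subnKC Nn) (le_lt_trans (ynm _ _)).
exists (lim (y @ \oo)) => // n.
apply: (@closed_cvg _ _ (y @ \oo) _ (fun z => z) [set z | `|z - y n| <= 2 * B * 2^-1 ^+ n]) => //.
- apply: (@closed_comp _ _ (fun z => `|z - y n|) [set r : R | r <= 2 * B * 2^-1 ^+ n]).
    move=> z _; apply: cvg_norm; apply: cvgB; [exact: cvg_id|exact: cvg_cst].
  exact: closed_le.
- by exists n => // m /= nm; rewrite -(subnKC nm).
Qed.

Lemma sqr_geometric_cvg (y : nat -> R) (M : R) :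
  (forall k, 4 ^+ k * (y k.+1 - y k) ^+ 2 <= M) ->
  exists2 l, y @ \oo --> l & forall n, (l - y n) ^+ 2 <= 4 * M * 4^-1 ^+ n.
Proof.
move=> yM.
have M0 : 0 <= M by apply: le_trans (yM 0%N); rewrite mulr_ge0 ?sqr_ge0.
have q4 k : (4^-1 : R) ^+ k = (2^-1 ^+ k) ^+ 2.
  by rewrite -exprM mulnC exprM; congr (_ ^+ _); rewrite exprVn; congr (_^-1); ring.
have [] := @geometric_cvg R y (Num.sqrt M).
  move=> k; rewrite -(ler_sqr (x := `|_|)) ?nnegrE ?mulr_ge0 ?sqrtr_ge0 ?exprn_ge0//.
  rewrite exprMn sqr_sqrtr// real_normK ?num_real// -q4 exprVn.
  by rewrite ler_pdivlMr ?exprn_gt0// mulrC.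
move=> l yl lB; exists l => // n.
have := lB n; rewrite -(ler_sqr (x := `|_|)) ?nnegrE ?mulr_ge0 ?sqrtr_ge0 ?exprn_ge0//.
rewrite !exprMn sqr_sqrtr// real_normK ?num_real// -q4.
by have -> : (2 : R) ^+ 2 = 4 by ring.
Qed.

End geometric_cauchy.

Section L2_complete.
Context d (T : measurableType d) (R : realType) (mu : {measure set T -> \bar R}).
Local Notation L2 := (LspaceType2 mu).

(* Since [sum_k 4^k |u (k+1) - u k|^2] is integrable, it is finite almost
   everywhere, and there it dominates the squared distance to the limit. *)
Lemma Lspace2_geometric_cvg (u : nat -> L2) :
  (forall k, `|u k.+1 - u k| <= 4^-1 ^+ k) ->
  exists v C, forall n, `|v - u n| ^+ 2 <= C * 4^-1 ^+ n.
Proof.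
move=> uB.
pose h k x : \bar R := (4 ^+ k * (u k.+1 x - u k x) ^+ 2)%:E.
have mu_ k : measurable_fun setT (u k) by exact: measurable_Lspace.
have mh k : measurable_fun setT (h k).
  apply/measurable_EFinP; apply: measurable_funM => //.
  by apply: measurable_funX; exact: measurable_funB (mu_ _) (mu_ _).
have h0 k x : (0 <= h k x)%E by rewrite lee_fin; apply: mulr_ge0; [exact: exprn_ge0|exact: sqr_ge0].
pose Phi x := (\sum_(0 <= k <oo) h k x)%E.
have mPhi : measurable_fun setT Phi.
  by apply: (@ge0_emeasurable_sum _ _ _ _ h xpredT) => k *; [exact: h0|exact: mh].
have Phi0 x : (0 <= Phi x)%E by apply: nneseries_ge0 => *; exact: h0.
(* The [n]-th term integrates to at most [4^n * 16^-n = 4^-n]. The partial sums are compared with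
   [2 - 2 * 4^-n], a form that induction preserves. *)
have iPhi : (\int[mu]_x Phi x <= 2%:E)%E.
  rewrite integral_nneseries//; apply: lime_le.
    by apply: is_cvg_nneseries => n _ _; exact: integral_ge0.
  apply: nearW => n; apply: (@le_trans _ _ (2 - 2 * 4^-1 ^+ n)%:E); last first.
    by rewrite lee_fin gerBl mulr_ge0// exprn_ge0.
  elim: n => [|n IH]; first by rewrite big_geq// mulr1 subrr.
  rewrite big_nat_recr//=; apply: (le_trans (leeD IH (_ : _ <= (4^-1 ^+ n)%:E)%E)).
    under eq_integral do rewrite /h EFinM.
    have A x : setT x -> (0 <= ((u n.+1 x - u n x) ^+ 2)%:E)%E.
      by rewrite lee_fin sqr_ge0.
    have B : measurable_fun setT (fun x => ((u n.+1 x - u n x) ^+ 2)%:E).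
      by apply: measurable_sqr; exact: measurable_funB (mu_ _) (mu_ _).
    have C : 0 <= (4 : R) ^+ n by exact: exprn_ge0.
    rewrite (ge0_integralZl_EFin _ measurableT A B C) -L2norm_sub_integral -EFinM lee_fin.
    have h2 : `|u n.+1 - u n| ^+ 2 <= (4^-1 ^+ n) ^+ 2.
      by rewrite ler_sqr ?nnegrE ?exprn_ge0.
    have p4 : 0 < (4 : R) ^+ n by rewrite exprn_gt0.
    have := ler_wpM2l (ltW p4) h2.
    rewrite [X in _ <= X -> _](_ : _ = 4^-1 ^+ n)//.
    by rewrite exprVn expr2 mulrA divff ?gt_eqF// mul1r.
  have q0 : 0 <= (4^-1 : R) ^+ n by exact: exprn_ge0.
  by rewrite -EFinD lee_fin exprS; lra.
have Phiae : \forall x \ae mu, Phi x \is a fin_num.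
  have : mu.-integrable setT Phi.
    apply/integrableP; split => //.
    under eq_integral do rewrite gee0_abs//.
    by apply: le_lt_trans iPhi _; rewrite ltry.
  by move=> /(integrable_ae measurableT); apply: filterS => x; exact.
(* The upper limit is measurable without any convergence; wherever [Phi] is finite it is the
   limit. *)
pose f x := fine (limn_esup (fun n => (u n x)%:E)).
have mf : measurable_fun setT f.
  apply: (measurableT_comp (f := fine)) => //.
  by apply: measurable_fun_limn_esup => n; exact/measurable_EFinP/mu_.
have key x : Phi x \is a fin_num -> forall n,
    (((f x - u n x) ^+ 2)%:E <= (4 * 4^-1 ^+ n)%:E * Phi x)%E.
  move=> fx; have PhiE : Phi x = (fine (Phi x))%:E by rewrite fineK.
  have [] := @sqr_geometric_cvg R (fun n => u n x) (fine (Phi x)).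
    move=> k; rewrite -lee_fin -PhiE.
    apply: le_trans (@nneseries_lim_ge _ (h ^~ x) xpredT 0 k.+1 _) => //.
    rewrite big_nat_recr//= leeDr//; exact: sume_ge0.
  move=> l ul lB n.
  have -> : f x = l.
    rewrite /f (_ : limn_esup _ = l%:E)//.
    by apply: (cvg_limn_einf_sup _).2; apply: cvg_EFin => //; exact: nearW.
  by rewrite PhiE -EFinM lee_fin mulrAC lB.
have intkey n : (\int[mu]_x ((f x - u n x) ^+ 2)%:E <= (4 * 4^-1 ^+ n)%:E * 2%:E)%E.
  have c0 : 0 <= (4 : R) * 4^-1 ^+ n by rewrite mulr_ge0// exprn_ge0.
  apply: (@le_trans _ _ (\int[mu]_x ((4 * 4^-1 ^+ n)%:E * Phi x))%E).
    apply: ae_ge0_le_integral => //.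
    - by move=> x _; rewrite lee_fin sqr_ge0.
    - by apply: measurable_sqr; exact: measurable_funB mf (mu_ _).
    - by move=> x _; rewrite mule_ge0.
    - exact: measurable_funeM.
    - by apply: filterS Phiae => x /key.
  by rewrite ge0_integralZl_EFin// lee_pmul2l// lte_fin mulr_gt0// exprn_gt0.
have f2 : (\int[mu]_x (f x ^+ 2)%:E < +oo)%E.
  apply: (@le_lt_trans _ _ (\int[mu]_x (2%:E * ((f x - u 0%N x) ^+ 2)%:E +
      2%:E * (u 0%N x ^+ 2)%:E))%E).
    have m1 : measurable_fun setT (fun x => (2%:E * ((f x - u 0%N x) ^+ 2)%:E)%E).
      by apply: measurable_funeM; apply: measurable_sqr; exact: measurable_funB mf (mu_ _).
    have m2 : measurable_fun setT (fun x => (2%:E * (u 0%N x ^+ 2)%:E)%E).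
      by apply: measurable_funeM; exact: measurable_sqr (mu_ _).
    apply: ge0_le_integral => //.
    - by move=> x _; rewrite lee_fin sqr_ge0.
    - exact: measurable_sqr.
    - exact: emeasurable_funD.
    - move=> x _; rewrite -!EFinM -EFinD lee_fin.
      by have := sqr_ge0 (f x - 2 * u 0%N x); lra.
  have m1 : measurable_fun setT (fun x => ((f x - u 0%N x) ^+ 2)%:E).
    by apply: measurable_sqr; exact: measurable_funB mf (mu_ _).
  have m2 := measurable_sqr (mu_ 0%N).
  have p1 x : setT x -> (0 <= ((f x - u 0%N x) ^+ 2)%:E)%E by rewrite lee_fin sqr_ge0.
  have p2 x : setT x -> (0 <= (u 0%N x ^+ 2)%:E)%E by rewrite lee_fin sqr_ge0.
  have z2 : 0 <= 2 :> R by [].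
  rewrite ge0_integralD//; first rewrite (ge0_integralZl_EFin _ measurableT p1 m1 z2).
  - rewrite (ge0_integralZl_EFin _ measurableT p2 m2 z2).
    rewrite -L2norm_integral lte_add_pinfty// ?ltry// lte_mul_pinfty//.
    by apply: le_lt_trans (intkey 0%N) _; rewrite ltry.
  - by move=> x /p1 h1; rewrite mule_ge0.
  - exact: measurable_funeM.
  - by move=> x /p2 h2; rewrite mule_ge0.
  - exact: measurable_funeM.
have [v vf] := Lspace2_of mf f2.
exists v, 8 => n; rewrite -lee_fin L2norm_sub_integral.
rewrite (ae_eq_integral (fun x => ((f x - u n x) ^+ 2)%:E)) //.
- apply: (le_trans (intkey n)); rewrite -EFinM lee_fin.
  by move: (_ ^+ n) => x; lra.
- by apply: measurable_sqr; apply: measurable_funB => //; exact: measurable_Lspace.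
- by apply: measurable_sqr; exact: measurable_funB mf (mu_ _).
- by apply: filterS vf => x ->.
Qed.

(** A Cauchy filter contains balls of radius [4^-n / 2]. Balls of successive radii meet, so their
    centres form a sequence as in [Lspace2_geometric_cvg], whose limit is the limit of the
    filter. *)
Lemma Lspace2_complete (F : set_system L2) : ProperFilter F -> cauchy F -> cvg F.
Proof.
move=> PF /cauchyP Fc.
have c0 n : 0 < 4^-1 ^+ n / 2 :> R by rewrite divr_gt0// exprn_gt0// invr_gt0.
have /choice [u uF] : forall n, exists x : L2, F (ball x (4^-1 ^+ n / 2)).
  by move=> n; exact: Fc.
have [] := @Lspace2_geometric_cvg u.
  move=> k; have [z [zk zk1]] := filter_ex (filterI (uF k) (uF k.+1)).
  move: zk zk1; rewrite -!ball_normE/= => /ltW zk /ltW zk1.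
  apply: (le_trans (ler_distD z _ _)); rewrite [X in _ + X]distrC.
  apply: (le_trans (lerD zk1 zk)); rewrite exprS.
  have q0 : 0 <= (4^-1 : R) ^+ k by exact: exprn_ge0.
  by lra.
move=> v [C vC].
have C0 : 0 <= C by have := vC 0%N; rewrite mulr1; apply: le_trans; exact: sqr_ge0.
apply/cvg_ex; exists v; apply/cvgrPdist_lt => e e0.
have q0 : (4^-1 : R) ^+ n @[n --> \oo] --> (0 : R).
  by apply: cvg_expr; rewrite ger0_norm ?invr_ge0// invf_lt1// ltr1n.
have e20 : 0 < (e / 2) ^+ 2 / (C + 1) by rewrite divr_gt0 ?ltr_wpDl// exprn_gt0// divr_gt0.
have [n [n1 n2]] : exists n, (4^-1 : R) ^+ n < (e / 2) ^+ 2 / (C + 1) /\ (4^-1 : R) ^+ n < e.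
  have [N _ /(_ N (leqnn N)) /= [h1 h2]] := filterI
    (iffLR (cvgrPdist_lt _ _) q0 _ e20) (iffLR (cvgrPdist_lt _ _) q0 _ e0).
  by exists N; move: h1 h2; rewrite sub0r normrN ger0_norm.
have vn : `|v - u n| < e / 2.
  rewrite -(ltr_pXn2r (n := 2)) ?nnegrE ?divr_ge0 ?(ltW e0)//.
  apply: (le_lt_trans (vC n)).
  move: n1; rewrite ltr_pdivlMr ?ltr_wpDl// mulrC; apply: le_lt_trans.
  by rewrite ler_wpM2r// lerDl.
apply: filterS (uF n) => z; rewrite -ball_normE/= => zn.
rewrite (le_lt_trans (ler_distD (u n) _ _))// (splitr e) ltrD//.
by rewrite (lt_trans zn)// ltr_pM2r.
Qed.

End L2_complete.

(** * Orthonormal expansions in an abstract Hilbert space *)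

Section hilbert.
Context (R : realType) (V : normedModType R) (dot : V -> V -> R).
Hypotheses (dotC : forall u v, dot u v = dot v u)
  (dot_linear : forall a u v w, dot (a *: u + v) w = a * dot u w + dot v w)
  (dot_norm : forall v, dot v v = `|v| ^+ 2).
Implicit Types u v w x y : V.

Lemma dotDl u v w : dot (u + v) w = dot u w + dot v w.
Proof. by rewrite -[u]scale1r dot_linear mul1r scale1r. Qed.

Lemma dot0l w : dot 0 w = 0.
Proof. by have /eqP := dotDl 0 0 w; rewrite addr0 eq_sym -subr_eq0 addrK => /eqP. Qed.

Lemma dotZl a u w : dot (a *: u) w = a * dot u w.
Proof. by rewrite -[a *: u]addr0 dot_linear dot0l addr0. Qed.

Lemma dotBl u v w : dot (u - v) w = dot u w - dot v w.
Proof. by rewrite dotDl -scaleN1r dotZl mulN1r. Qed.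

Lemma dotBr u v w : dot w (u - v) = dot w u - dot w v.
Proof. by rewrite dotC dotBl !(dotC w). Qed.

Lemma dotZr a u w : dot w (a *: u) = a * dot w u.
Proof. by rewrite dotC dotZl (dotC w). Qed.

Lemma dot_suml (I : Type) (r : seq I) (P : pred I) (F : I -> V) w :
  dot (\sum_(i <- r | P i) F i) w = \sum_(i <- r | P i) dot (F i) w.
Proof.
elim/big_rec2 : _ => [|i y1 y2 _ <-]; first exact: dot0l.
by rewrite dotDl.
Qed.

Lemma dot_cauchy_schwarz u v : `|dot u v| <= `|u| * `|v|.
Proof.
have [->|u0] := eqVneq u 0; first by rewrite dot0l !normr0 mul0r.
have nu : 0 < `|u| by rewrite normr_gt0.
rewrite -ler_sqr ?nnegrE ?mulr_ge0// exprMn real_normK ?num_real//.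
(* The squared norm of this vector is [|u|^2 * (|u|^2 * |v|^2 - (dot u v)^2)]. *)
have := dot_norm (dot u v *: u - `|u| ^+ 2 *: v).
rewrite dotBl !dotBr !dotZl !dotZr !dot_norm (dotC v u) => h.
have : 0 <= `|u| ^+ 2 * (`|u| ^+ 2 * `|v| ^+ 2 - dot u v ^+ 2).
  have := sqr_ge0 `|dot u v *: u - `|u| ^+ 2 *: v|; rewrite -h.
  by congr (_ <= _); ring.
by rewrite pmulr_rge0 ?exprn_gt0// subr_ge0.
Qed.

Lemma dot_cvg (J : Type) (F : set_system J) {FF : Filter F} (f : J -> V) x w :
  f j @[j --> F] --> x -> dot (f j) w @[j --> F] --> dot x w.
Proof.
move=> /cvgrPdist_lt fx; apply/cvgrPdist_lt => eps eps0.
have w0 : 0 < `|w| + 1 by rewrite ltr_wpDl.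
have ew0 : 0 < eps / (`|w| + 1) by rewrite divr_gt0.
apply: filterS (fx _ ew0) => j; rewrite ltr_pdivlMr// => h.
rewrite -dotBl (le_lt_trans (dot_cauchy_schwarz _ _))//.
by apply: le_lt_trans h; rewrite ler_wpM2l// lerDl.
Qed.

Hypothesis V_complete : forall F : set_system V, ProperFilter F -> cauchy F -> cvg F.

Variable e : nat -> V.
Hypotheses (e_orth : forall m n, dot (e m) (e n) = (m == n)%:R)
  (e_basis : forall v, series (fun n => dot v (e n) *: e n) @ \oo --> v).

Definition coord_proj N v : V := series (fun n => dot v (e n) *: e n) N.
Definition coord_tail N v : V := v - coord_proj N v.
Local Notation proj := coord_proj.
Local Notation tail := coord_tail.

Lemma dot_series (a : nat -> R) N n :
  dot (series (fun k => a k *: e k) N) (e n) = if (n < N)%N then a n else 0.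
Proof.
rewrite /series/= dot_suml.
under eq_bigr do rewrite dotZl e_orth.
elim: N => [|N IH]; first by rewrite big_geq.
rewrite big_nat_recr//= IH ltnS [(n <= N)%N]leq_eqVlt.
have [->|nN] := eqVneq n N; first by rewrite ltnn ?eqxx mulr1 add0r.
by rewrite /= mulr0 addr0.
Qed.

Lemma dot_proj N v n : dot (proj N v) (e n) = if (n < N)%N then dot v (e n) else 0.
Proof. exact: dot_series. Qed.

Lemma dot_tail N v n : dot (tail N v) (e n) = if (n < N)%N then 0 else dot v (e n).
Proof. by rewrite dotBl dot_proj; case: ifP => _; rewrite ?subrr ?subr0. Qed.

Lemma proj_cvg v : proj N v @[N --> \oo] --> v.
Proof. exact: e_basis. Qed.

Lemma norm_proj N v : `|proj N v| ^+ 2 = \sum_(0 <= k < N) dot v (e k) ^+ 2.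
Proof.
have projE x : dot (proj N v) x = \sum_(0 <= k < N) dot v (e k) * dot (e k) x.
  by rewrite /coord_proj/series/= dot_suml; apply: eq_bigr => k _; rewrite dotZl.
rewrite -dot_norm projE; apply: eq_big_nat => k /andP[_ kN].
by rewrite [dot (e k) _]dotC dot_proj kN expr2.
Qed.

(** Parseval's identity for the finite projections, then the limit. Injectivity of coordinates, the
    contraction property and all tail bounds are instances. *)
Lemma le_norm_coord (C : R) x y : 0 <= C ->
  (forall n, `|dot x (e n)| <= C * `|dot y (e n)|) -> `|x| <= C * `|y|.
Proof.
move=> C0 xy.
have xN N : `|proj N x| <= C * `|proj N y|.
  rewrite -ler_sqr ?nnegrE ?mulr_ge0// exprMn !norm_proj mulr_sumr.
  apply: ler_sum => k _; rewrite -[X in X <= _]real_normK ?num_real//.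
  rewrite -[X in _ * X]real_normK ?num_real// -exprMn.
  by rewrite ler_sqr ?nnegrE ?mulr_ge0.
have cx : `|proj N x| @[N --> \oo] --> `|x| by apply: cvg_norm; exact: proj_cvg.
have cy : C * `|proj N y| @[N --> \oo] --> C * `|y|.
  by apply: cvgMr; apply: cvg_norm; exact: proj_cvg.
exact: (ler_cvg_to cx cy (nearW _ xN)).
Qed.

Lemma coord_inj x y : (forall n, dot x (e n) = dot y (e n)) -> x = y.
Proof.
move=> xy; apply/eqP; rewrite -subr_eq0 -normr_le0 -(mul0r `|0 : V|).
by apply: le_norm_coord => // n; rewrite dotBl xy subrr normr0 mul0r.
Qed.

Lemma le_norm_tail (C : R) N x y : 0 <= C ->
  (forall n, (N <= n)%N -> `|dot x (e n)| <= C * `|dot y (e n)|) ->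
  `|tail N x| <= C * `|y|.
Proof.
move=> C0 xy; apply: le_norm_coord => // n; rewrite dot_tail.
by case: ltnP => [_|/xy//]; rewrite normr0 mulr_ge0.
Qed.

Lemma tail_cvg0 v : `|tail N v| @[N --> \oo] --> (0 : R).
Proof.
rewrite -(normr0 V) -(subrr v); apply: cvg_norm.
by apply: cvgB; [exact: cvg_cst|exact: proj_cvg].
Qed.

Lemma tailD N x y : tail N (x + y) = tail N x + tail N y.
Proof.
apply: coord_inj => n; rewrite dotDl !dot_tail; case: ifP => _; rewrite ?addr0//.
exact: dotDl.
Qed.

(** Differences of partial sums are dominated, coordinate by coordinate, by [C] times differences of
    the projections of [v], which are Cauchy. *)
Lemma diagonal_cvg (C : R) (m : nat -> R) v : (forall n, `|m n| <= C) ->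
  cvgn (series (fun n => (m n * dot v (e n)) *: e n)).
Proof.
move=> mC; have C0 : 0 <= C by apply: le_trans (mC 0%N).
set s := series _.
apply: V_complete; apply: cauchy_exP => eps eps0.
have eC : 0 < eps / (C + 1) by rewrite divr_gt0// ltr_wpDl.
have eC2 : 0 < eps / (C + 1) / 2 by rewrite divr_gt0.
have [N _ hN] := iffLR (cvgrPdist_lt _ _) (@proj_cvg v) _ eC2.
exists (s N); exists N => // n /= Nn; rewrite -ball_normE/=.
have PnN : `|proj N v - proj n v| < eps / (C + 1).
  rewrite (le_lt_trans (ler_distD v _ _))// (splitr (eps / _)) ltrD//.
    by rewrite distrC; exact: (hN N (leqnn N)).
  exact: (hN n Nn).
apply: (@le_lt_trans _ _ (C * `|proj N v - proj n v|)).
  apply: le_norm_coord => // k; rewrite !dotBl !dot_proj !dot_series.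
  case: ifP => _; case: ifP => _; rewrite ?subrr ?subr0 ?sub0r ?normr0 ?mulr0//.
  - by rewrite normrM ler_wpM2r.
  - by rewrite !normrN normrM ler_wpM2r.
apply: (@le_lt_trans _ _ ((C + 1) * `|proj N v - proj n v|)).
  by rewrite ler_wpM2r// lerDl.
by rewrite mulrC -ltr_pdivlMr// ltr_wpDl.
Qed.

Lemma dot_diagonal (C : R) (m : nat -> R) v n : (forall n, `|m n| <= C) ->
  dot (limn (series (fun n => (m n * dot v (e n)) *: e n))) (e n) = m n * dot v (e n).
Proof.
move=> mC; have cs := diagonal_cvg (v := v) mC.
have h := @dot_cvg nat \oo _ _ _ (e n) cs.
have h2 : dot (series (fun n => (m n * dot v (e n)) *: e n) j) (e n) @[j --> \oo] -->
    m n * dot v (e n).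
  by apply: cvg_near_cst; exists n.+1 => // k /= nk; rewrite dot_series nk.
exact: (@cvg_unique _ (@Rhausdorff R) _ _ _ _ (h _) h2).
Qed.

(** The compactness criterion used throughout: close coordinates and uniformly small tails give
    closeness in norm. An arbitrary filter on an arbitrary index type lets it serve for continuity,
    for equicontinuity over a family and for the Cauchy property. *)
Lemma near_norm_coord (J : Type) (F : set_system J) (x y : J -> V) : Filter F ->
  (forall n eps, 0 < eps -> \forall j \near F, `|dot (x j) (e n) - dot (y j) (e n)| <= eps) ->
  (forall eps, 0 < eps -> exists N, \forall j \near F,
     `|tail N (x j)| <= eps /\ `|tail N (y j)| <= eps) ->
  forall eps, 0 < eps -> \forall j \near F, `|x j - y j| <= eps.
Proof.
move=> FF xy xyt eps eps0.
have e30 : 0 < eps / 3 by rewrite divr_gt0.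
have [N tN] := xyt _ e30.
have pN M d : 0 < d -> \forall j \near F, `|proj M (x j) - proj M (y j)| <= d.
  elim: M d => [|M IH] d d0.
    by apply: nearW => j; rewrite /coord_proj/series/= !big_geq// subrr normr0 ltW.
  have d20 : 0 < d / 2 by rewrite divr_gt0.
  have e10 : 0 < `|e M| + 1 by rewrite ltr_wpDl.
  have de0 : 0 < d / 2 / (`|e M| + 1) by rewrite divr_gt0.
  apply: filterS (filterI (IH _ d20) (xy M _ de0)) => j [h1 h2].
  rewrite /coord_proj/series/= !big_nat_recr//=.
  rewrite opprD addrACA -scalerBl (le_trans (ler_normD _ _))//.
  rewrite (splitr d) lerD//.
  rewrite normrZ; apply: (le_trans (y := d / 2 / (`|e M| + 1) * (`|e M| + 1))).
    by rewrite ler_pM// lerDl.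
  by rewrite divfK ?gt_eqF.
apply: filterS (filterI tN (pN N _ e30)) => j [[h1 h2] h3].
have -> : x j - y j = tail N (x j) - tail N (y j) + (proj N (x j) - proj N (y j)).
  by rewrite addrACA -opprD !subrK.
apply: (le_trans (ler_normD _ _)); have := ler_normB (tail N (x j)) (tail N (y j)).
by move: h1 h2 h3; lra.
Qed.

End hilbert.

(** * Bochner integrals of continuous functions *)

(** For nonnegative functions the integral is a supremum over simple functions below, hence monotone
    without measurability. Norms of vector-valued functions are not known to be measurable here. *)
Lemma ge0_le_integral_nomeas d (T : measurableType d) (R : realType)
    (mu : {measure set T -> \bar R}) (D : set T) (f g : T -> \bar R) :
  (forall x, D x -> (0 <= f x)%E) -> (forall x, D x -> (f x <= g x)%E) ->
  (\int[mu]_(x in D) f x <= \int[mu]_(x in D) g x)%E.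
Proof.
move=> f0 fg.
have g0 x : D x -> (0 <= g x)%E by move=> Dx; apply: le_trans (fg x Dx); exact: f0.
rewrite !ge0_integralE//; apply: le_ereal_sup => _ [h /= hf <-]; exists h => //= x.
apply: le_trans (hf x) _; rewrite /patch; case: ifPn => //; rewrite inE; exact: fg.
Qed.

Lemma ge0_cvge0 (R : realType) (X : nat -> \bar R) : (forall n, (0 <= X n)%E) ->
  (forall e : R, 0 < e -> \forall n \near \oo, (X n <= e%:E)%E) -> X @ \oo --> 0%E.
Proof.
move=> X0 Xe; apply/fine_cvgP; split.
  apply: filterS (Xe 1 ltr01) => n Xn.
  by rewrite ge0_fin_numE// (le_lt_trans Xn)// ltry.
apply/cvgrPdist_le => e e0; apply: filterS (Xe e e0) => n Xn.
have Xf : X n \is a fin_num by rewrite ge0_fin_numE// (le_lt_trans Xn)// ltry.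
by rewrite sub0r normrN ger0_norm ?fine_ge0// -lee_fin fineK.
Qed.

Section bochner_dot.
Context (R : realType) (V : normedModType R) (dot : V -> V -> R).
Hypotheses (dotC : forall u v, dot u v = dot v u)
  (dot_linear : forall a u v w, dot (a *: u + v) w = a * dot u w + dot v w)
  (dot_norm : forall v, dot v v = `|v| ^+ 2).
Context d (T : measurableType d) (mu : {measure set T -> \bar R}) (D : set T).
Hypothesis mD : measurable D.

Let dotl_suml := dot_suml dot_linear.

Lemma simple_integral_dot (k : nat) (A : nat -> set T) (v : nat -> V) z :
  (forall i, [/\ measurable (A i), A i `<=` D & (mu (A i) < +oo)%E]) ->
  mu.-integrable D (EFin \o (fun x => dot (simple_val (R := R) k A v x) z)) /\
  dot (simple_integral mu k A v) z = \int[mu]_(x in D) dot (simple_val (R := R) k A v x) z.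
Proof.
move=> AP.
have i1 i : mu.-integrable D (EFin \o (fun x => (\1_(A i) x : R) * dot (v i) z)).
  have [mA AD Afin] := AP i.
  have : mu.-integrable D (EFin \o (\1_(A i) : T -> R)).
    apply/integrableP; split; first exact/measurable_EFinP.
    under eq_integral do rewrite /= ger0_norm//.
    rewrite integral_indic// setIidl//.
  move=> /(integrableZr mD (dot (v i) z)).
  by apply: eq_integrable => // x _; rewrite /= EFinM.
have v1 i : \int[mu]_(x in D) ((\1_(A i) x : R) * dot (v i) z) =
    fine (mu (A i)) * dot (v i) z.
  have [mA AD Afin] := AP i.
  rewrite RintegralZr//; last first.
    apply/integrableP; split; first exact/measurable_EFinP.
    under eq_integral do rewrite /= ger0_norm//.
    by rewrite integral_indic// setIidl.
  by rewrite /Rintegral integral_indic// setIidl.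
have E x : dot (simple_val (R := R) k A v x) z =
    \sum_(i < k) (\1_(A i) x : R) * dot (v i) z.
  by rewrite dotl_suml; apply: eq_bigr => i _; rewrite (dotZl dot_linear).
have -> : (fun x => dot (simple_val (R := R) k A v x) z) =
    (fun x => \sum_(i < k) (\1_(A i) x : R) * dot (v i) z) by apply/funext.
rewrite dotl_suml; under eq_bigr do rewrite (dotZl dot_linear) -v1.
elim: k {E} => [|k [IH1 IH2]].
  under eq_fun do rewrite big_ord0.
  rewrite big_ord0; split; first exact: integrable0.
  by rewrite Rintegral_cst// mul0r.
have S x : \sum_(i < k.+1) (\1_(A i) x : R) * dot (v i) z =
  \sum_(i < k) (\1_(A i) x : R) * dot (v i) z + \1_(A k) x * dot (v k) z.
  by rewrite big_ord_recr.
under eq_fun do rewrite S.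
split; last by rewrite big_ord_recr/= IH2 RintegralD.
by have := integrableD mD IH1 (i1 k); apply: eq_integrable.
Qed.

(** Testing against vectors determines a Bochner integral through scalar integrals; every later
    estimate of such integrals rests on this. *)
Lemma bochner_dot (F : T -> V) (I z : V) :
  mu.-integrable D (EFin \o (fun x => dot (F x) z)) ->
  bochner_integral mu D F I -> dot I z = \int[mu]_(x in D) dot (F x) z.
Proof.
move=> iF bI.
(* Scaling makes pairing with [z] a contraction, so that convergence in mean bounds the error
   directly. *)
wlog z1 : z iF / `|z| <= 1.
  move=> H; pose a := `|z| + 1; have a0 : 0 < a by rewrite ltr_wpDl.
  have zE : z = a *: (a^-1 *: z) by rewrite scalerA divff ?gt_eqF// scale1r.
  have dE u : dot u z = a * dot u (a^-1 *: z).
    by rewrite {1}zE dotC (dotZl dot_linear) (dotC u).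
  have iFz : mu.-integrable D (EFin \o (fun x => dot (F x) (a^-1 *: z))).
    have := integrableZl mD a^-1 iF; apply: eq_integrable => // x _.
    by rewrite /= dE -EFinM mulKf// gt_eqF.
  rewrite dE H//; last first.
    rewrite normrZ gtr0_norm ?invr_gt0// mulrC ler_pdivrMr// mul1r /a.
    by rewrite lerDl.
  by rewrite -RintegralZl//; apply: eq_Rintegral => x _; rewrite -dE.
case: bI => k [A [v [AP _ Fint simpI]]].
have h1 := @dot_cvg _ _ _ dotC dot_linear dot_norm nat \oo _ _ _ z simpI.
suff h2 : dot (simple_integral mu (k n) (A n) (v n)) z @[n --> \oo] -->
    \int[mu]_(x in D) dot (F x) z.
  exact: (@cvg_unique _ (@Rhausdorff R) _ _ _ _ (h1 _) h2).
apply/cvgrPdist_lt => eps eps0.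
have /fine_cvgP[fin /cvgrPdist_lt/(_ _ eps0) fe] := Fint.
apply: filterS (filterI fin fe) => n [finn].
have [isv ->] := simple_integral_dot (k n) (v n) z (AP n).
rewrite sub0r normrN => lt_eps; apply: le_lt_trans lt_eps.
apply: le_trans (ler_norm _); rewrite -RintegralB//.
rewrite -lee_fin fineK//.
have iB : mu.-integrable D (EFin \o (fun x =>
    dot (F x) z - dot (simple_val (R := R) (k n) (A n) (v n) x) z)).
  by have := integrableB mD iF isv; apply: eq_integrable.
apply: (le_trans (y := (\int[mu]_(x in D) `|dot (F x) z -
    dot (simple_val (R := R) (k n) (A n) (v n) x) z|%:E)%E)).
  rewrite EFin_normr_Rintegral//; apply: le_trans (le_abse_integral mu mD _) _ => //.
  exact: measurable_int iB.
apply: ge0_le_integral_nomeas => x Dx; first by rewrite lee_fin.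
rewrite lee_fin -(dotBl dot_linear).
apply: le_trans (dot_cauchy_schwarz dotC dot_linear dot_norm _ _) _.
by rewrite ler_piMr.
Qed.

End bochner_dot.

Lemma eq_bochner_integral d (T : measurableType d) (R : realType)
    (mu : {measure set T -> \bar R}) (V : normedModType R) (D : set T) (F G : T -> V) I :
  (forall x, D x -> F x = G x) -> bochner_integral mu D F I -> bochner_integral mu D G I.
Proof.
move=> FG [k [A [v [AP Fae Fint simpI]]]]; exists k, A, v; split => //.
- by apply: filterS Fae => x Fx Dx; rewrite -FG//; exact: Fx.
- rewrite (_ : (fun n => _) = (fun n => (\int[mu]_(x in D)
     `|F x - simple_val (R := R) (k n) (A n) (v n) x|%:E)%E))//.
  by apply/funext => n; apply: eq_integral => x; rewrite inE => /FG ->.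
Qed.

Section bochner_continuous.
Context (R : realType) (V : normedModType R) (dot : V -> V -> R).
Hypotheses (dotC : forall u v, dot u v = dot v u)
  (dot_linear : forall a u v w, dot (a *: u + v) w = a * dot u w + dot v w)
  (dot_norm : forall v, dot v v = `|v| ^+ 2).
Hypothesis V_complete : forall F : set_system V, ProperFilter F -> cauchy F -> cvg F.
Local Notation leb := (@lebesgue_measure R).

Lemma continuous_dot (F : R -> V) z : continuous F -> continuous (fun s => dot (F s) z).
Proof.
by move=> cF s; apply: (dot_cvg dotC dot_linear dot_norm); exact: cF.
Qed.

Let itv_fin (t : R) : (leb `[0%R, t]%classic < +oo)%E.
Proof.
by have /= -> := @lebesgue_measure_itv R `[0, t]; case: ifP => _; rewrite ?ltry// -EFinB ltry.
Qed.

(** Using [t + 1] instead of [t] keeps the mesh positive at [t = 0] and lets the half-open cells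
    cover the endpoint [t]. *)
Let mesh (t : R) (n : nat) : R := (t + 1) / n.+1%:R.
Let cell t n i : set R := `[i%:R * mesh t n, i.+1%:R * mesh t n[%classic `&` `[0, t]%classic.

Let cellP t n i : [/\ measurable (cell t n i), cell t n i `<=` `[0, t]%classic &
  (leb (cell t n i) < +oo)%E].
Proof.
have mc : measurable (cell t n i) by exact: measurableI.
split => //; first exact: subIsetr.
by apply: le_lt_trans (itv_fin t); apply: le_measure; rewrite ?inE//; exact: subIsetr.
Qed.

Let step (F : R -> V) t n s :=
  simple_val (R := R) n.+1 (cell t n) (fun i => F (i%:R * mesh t n)) s.

Let step_approx (F : R -> V) t e : continuous F -> 0 <= t -> 0 < e ->
  \forall n \near \oo, forall s, 0 <= s <= t -> `|F s - step F t n s| <= e.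
Proof.
move=> cF t0 e0.
have t1 : 0 < t + 1 by rewrite ltr_wpDl.
have [del del0 Fdel] := segment_uniform_continuous 0 t cF e0.
have mesh0 : mesh t n @[n --> \oo] --> (0 : R).
  by rewrite -[X in _ --> X](mulr0 (t + 1)); apply: cvgMr; exact: cvg_harmonic.
move/cvgrPdist_lt : mesh0 => /(_ _ del0); apply: filterS => n.
have m0 : 0 < mesh t n by rewrite divr_gt0.
rewrite sub0r normrN gtr0_norm// => mdel s /andP[s0 st].
pose i := Num.truncn (s / mesh t n).
have sm0 : 0 <= s / mesh t n by rewrite divr_ge0// ltW.
have i1 : i%:R * mesh t n <= s by rewrite -ler_pdivlMr// truncn_le.
have i2 : s < i.+1%:R * mesh t n by rewrite -ltr_pdivrMr// truncnS_gt.
have iN : (i < n.+1)%N.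
  rewrite -(ltr_nat R) -(ltr_pM2r m0) (le_lt_trans i1)//.
  by rewrite /mesh mulrCA divff ?pnatr_eq0// mulr1; lra.
have -> : step F t n s = F (i%:R * mesh t n).
  rewrite /step /simple_val (bigD1 (Ordinal iN))//= big1 ?addr0.
    rewrite indicE mem_set ?scale1r//; split => /=; rewrite in_itv/= ?i1 ?i2//.
    by rewrite s0 st.
  move=> j ji; rewrite indicE memNset ?scale0r// => -[/=]; rewrite in_itv/= => /andP[j1 j2] _.
  move/eqP : ji; apply; apply/val_inj => /=; apply/eqP; rewrite eqn_leq.
  apply/andP; split; rewrite -ltnS -(ltr_nat R) -(ltr_pM2r m0).
    exact: le_lt_trans j1 i2.
  exact: le_lt_trans i1 j2.
apply/ltW/Fdel; first by rewrite s0 st.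
rewrite ger0_norm ?subr_ge0//; apply: lt_trans mdel.
by rewrite ltrBlDl; move: i2; rewrite -natr1 mulrDl mul1r.
Qed.

Lemma continuous_bochner_integral (F : R -> V) (t : R) : continuous F -> 0 <= t ->
  exists I, bochner_integral leb `[0, t] F I.
Proof.
move=> cF t0.
pose S n := simple_integral leb n.+1 (cell t n) (fun i => F (i%:R * mesh t n)).
have SE n z : leb.-integrable `[0, t] (EFin \o (fun s => dot (step F t n s) z)) /\
    dot (S n) z = \int[leb]_(s in `[0, t]) dot (step F t n s) z.
  by apply: (simple_integral_dot dot_linear) => //; exact: cellP.
have mt : fine (leb `[0%R, t]%classic) = t.
  have /= -> := @lebesgue_measure_itv R `[0, t]; rewrite lte_fin.
  case: ltP => [_|t1]; first by rewrite /= subr0.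
  by apply/eqP; rewrite eq_le t0 t1.
(* The difference of two step integrals is tested against itself, which reduces its norm to a scalar
   integral. *)
have SC e n m : 0 < e -> (forall s, 0 <= s <= t -> `|F s - step F t n s| <= e) ->
    (forall s, 0 <= s <= t -> `|F s - step F t m s| <= e) -> `|S n - S m| <= 2 * e * t.
  move=> e0 Fn Fm.
  have [->|z0] := eqVneq (S n - S m) 0; first by rewrite normr0 mulr_ge0// mulr_ge0// ltW.
  have nz0 : 0 < `|S n - S m| by rewrite normr_gt0.
  rewrite -(ler_pM2r nz0) -expr2 -dot_norm {1}/S (dotBl dot_linear).
  set z := S n - S m in nz0 z0 *.
  have [in_ ->] := SE n z; have [im ->] := SE m z.
  rewrite -RintegralB//; apply: le_trans (ler_norm _) _.
  have iB : leb.-integrable `[0, t] (EFin \o (fun s =>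
      dot (step F t n s) z - dot (step F t m s) z)).
    by have := integrableB _ in_ im; move=> /(_ (measurable_itv _)); apply: eq_integrable.
  apply: (le_trans (le_normr_Rintegral _ iB)) => //.
  have -> : 2 * e * t * `|z| = \int[leb]_(s in `[0, t]) (2 * e * `|z|).
    by rewrite Rintegral_cst// mt mulrAC.
  apply: le_Rintegral => //.
  - exact: (integrable_norm iB).
  - by apply: integrable_continuous; exact: cst_continuous.
  - move=> s /=; rewrite in_itv/= => st; rewrite -(dotBl dot_linear).
    apply: le_trans (dot_cauchy_schwarz dotC dot_linear dot_norm _ _) _.
    rewrite ler_wpM2r//; apply: le_trans (ler_distD (F s) _ _) _.
    by have := Fn s st; have := Fm s st; rewrite [X in _ -> _ -> X + _ <= _]distrC; lra.
have Scvg : cvgn S.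
  apply: V_complete; apply: cauchy_exP => e e0.
  have e'0 : 0 < e / (2 * t + 2) by rewrite divr_gt0// ltr_wpDl// mulr_ge0.
  have [N _ hN] := step_approx cF t0 e'0.
  exists (S N); exists N => // n /= Nn; rewrite -ball_normE/=.
  apply: le_lt_trans (SC _ _ _ e'0 (hN N (leqnn N)) (hN n Nn)) _.
  have -> : 2 * (e / (2 * t + 2)) * t = e * ((2 * t) / (2 * t + 2)) by ring.
  by rewrite gtr_pMr// ltr_pdivrMr ?ltr_wpDl ?mulr_ge0// mul1r ltrDl.
exists (limn S), (fun n => n.+1), (cell t), (fun n i => F (i%:R * mesh t n)); split => //.
- by move=> n i; exact: cellP.
- apply: aeW => s /=; rewrite in_itv/= => st; apply/cvgrPdist_le => e e0.
  by apply: filterS (step_approx cF t0 e0) => n; exact.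
- apply: ge0_cvge0 => [n|e e0]; first by apply: integral_ge0 => s _; rewrite lee_fin.
  have e'0 : 0 < e / (t + 1) by rewrite divr_gt0// ltr_wpDl.
  apply: filterS (step_approx cF t0 e'0) => n hn.
  apply: (@le_trans _ _ (\int[leb]_(s in `[0%R, t]) (e / (t + 1))%:E)%E).
    apply: ge0_le_integral_nomeas => s; first by rewrite lee_fin.
    by rewrite /= in_itv/= lee_fin => /hn.
  rewrite integral_cst//; set lt := (X in (_ * X)%E).
  have -> : lt = t%:E.
    have <- : leb `[0%R, t]%classic = t%:E by rewrite -[LHS]fineK ?mt// ge0_fin_numE.
    by [].
  rewrite -EFinM lee_fin -mulrA ler_piMr ?(ltW e0)// mulrC ler_pdivrMr ?ltr_wpDl//.
  by rewrite mul1r lerDl.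
Qed.

Lemma bochner_dot_continuous (F : R -> V) (t : R) I z : continuous F ->
  bochner_integral leb `[0, t] F I ->
  dot I z = \int[leb]_(s in `[0, t]) dot (F s) z.
Proof.
move=> cF; apply: (bochner_dot dotC dot_linear dot_norm) => //.
by apply: integrable_continuous; exact: continuous_dot.
Qed.

(** Testing against [I] itself gives [|I|^2] on the left and at most [|I|] times the integral of [q]
    on the right. *)
Lemma le_norm_bochner (F : R -> V) (q : R -> R) (t : R) I : continuous F ->
  leb.-integrable `[0, t] (EFin \o q) -> (forall s, 0 <= s <= t -> `|F s| <= q s) ->
  bochner_integral leb `[0, t] F I -> `|I| <= \int[leb]_(s in `[0, t]) q s.
Proof.
move=> cF iq Fq bI.
have [->|I0] := eqVneq I 0.
  rewrite normr0; apply: Rintegral_ge0 => s; rewrite /= in_itv/= => st.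
  exact: le_trans (Fq s st).
have nI : 0 < `|I| by rewrite normr_gt0.
rewrite -(ler_pM2r nI) -expr2 -dot_norm (bochner_dot_continuous I cF bI) -RintegralZr//.
apply: le_Rintegral => //.
- by apply: integrable_continuous; exact: continuous_dot.
- by have /(_ (measurable_itv _)) := integrableZr _ `|I| iq; apply: eq_integrable.
- move=> s /=; rewrite in_itv/= => st; apply: le_trans (ler_norm _) _.
  apply: le_trans (dot_cauchy_schwarz dotC dot_linear dot_norm _ _) _.
  by rewrite ler_wpM2r// Fq.
Qed.

End bochner_continuous.

(** * The delayed integral equation *)

Section tail_bochner.
Context (R : realType) (V : normedModType R) (dot : V -> V -> R).
Hypotheses (dotC : forall u v, dot u v = dot v u)
  (dot_linear : forall a u v w, dot (a *: u + v) w = a * dot u w + dot v w)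
  (dot_norm : forall v, dot v v = `|v| ^+ 2).
Hypothesis V_complete : forall F : set_system V, ProperFilter F -> cauchy F -> cvg F.
Variable e : nat -> V.
Hypotheses (e_orth : forall m n, dot (e m) (e n) = (m == n)%:R)
  (e_basis : forall v, series (fun n => dot v (e n) *: e n) @ \oo --> v).
Local Notation leb := (@lebesgue_measure R).
Local Notation tail := (coord_tail dot e).
Local Notation proj := (coord_proj dot e).

(** [tail] is an orthogonal projection; this lets the tail of an integral be tested against itself
    in the next lemma. *)
Lemma dot_tailC N x y : dot x (tail N y) = dot (tail N x) (tail N y).
Proof.
rewrite [in RHS]/coord_tail (dotBl dot_linear).
suff projE z : dot (proj N x) z = \sum_(0 <= k < N) dot x (e k) * dot (e k) z.
  rewrite projE big1_seq ?subr0// => k; rewrite mem_index_iota => /andP[_ /andP[_ kN]].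
  by rewrite [dot (e k) _]dotC (dot_tail dot_linear e_orth) kN mulr0.
rewrite /coord_proj/series/= (dot_suml dot_linear); apply: eq_bigr => k _.
by rewrite (dotZl dot_linear).
Qed.

Lemma le_tail_bochner (F : R -> V) (q : R -> R) (t : R) N I : continuous F ->
  leb.-integrable `[0, t] (EFin \o q) ->
  (forall s, 0 <= s <= t -> `|tail N (F s)| <= q s) ->
  bochner_integral leb `[0, t] F I -> `|tail N I| <= \int[leb]_(s in `[0, t]) q s.
Proof.
move=> cF iq Fq bI.
have [->|I0] := eqVneq (tail N I) 0.
  rewrite normr0; apply: Rintegral_ge0 => s; rewrite /= in_itv/= => st.
  exact: le_trans (Fq s st).
have nI : 0 < `|tail N I| by rewrite normr_gt0.
rewrite -(ler_pM2r nI) -expr2 -dot_norm -dot_tailC.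
rewrite (bochner_dot_continuous dotC dot_linear dot_norm _ cF bI) -RintegralZr//.
apply: le_Rintegral => //.
- apply: integrable_continuous; exact: (continuous_dot dotC dot_linear dot_norm).
- by have /(_ (measurable_itv _)) := integrableZr _ `|tail N I| iq; apply: eq_integrable.
- move=> s /=; rewrite in_itv/= => st; apply: le_trans (ler_norm _) _.
  rewrite dot_tailC; apply: le_trans (dot_cauchy_schwarz dotC dot_linear dot_norm _ _) _.
  by rewrite ler_wpM2r// Fq.
Qed.

Lemma norm_tail_le N x : `|tail N x| <= `|x|.
Proof.
rewrite -[leRHS]mul1r; apply: (le_norm_coord dotC dot_linear dot_norm e_orth e_basis) => // n.
by rewrite (dot_tail dot_linear e_orth) mul1r; case: ifP; rewrite ?normr0.
Qed.

End tail_bochner.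

(** * Scalar convolutions with a locally integrable bound *)

Section integral_continuity.
Context (R : realType).
Local Notation leb := (@lebesgue_measure R).

Lemma integral_small (q : R -> R) (T eps : R) : 0 < eps ->
  leb.-integrable `[0, T] (EFin \o q) -> (forall s, 0 <= s -> 0 <= q s) ->
  exists2 del, 0 < del & forall a b, 0 <= a -> a <= b -> b <= T -> b - a < del ->
    \int[leb]_(s in `[a, b]) q s <= eps.
Proof.
move=> eps0 iq q0.
have iqT : leb.-integrable setT (EFin \o (q \_ `[0, T])).
  rewrite -restrict_EFin; apply/integrable_restrict => //=; rewrite setTI//.
have [del [del0 dP]] := integral_normr_continuous iqT eps0.
exists del => // a b a0 ab bT bad.
have abT : `[a, b] `<=` `[0, T].
  by move=> s /=; rewrite !in_itv/= => /andP[? ?]; apply/andP; split; lra.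
apply: le_trans (ltW (dP `[a, b]%classic _ _)) => //.
  rewrite le_eqVlt; apply/orP; left; apply/eqP; apply: eq_Rintegral => s.
  rewrite inE => sab; rewrite patchE mem_set; last exact: abT.
  by rewrite ger0_norm// q0//; move: sab; rewrite /= in_itv/= => /andP[+ _]; exact: le_trans.
have /= -> := @lebesgue_measure_itv R `[a, b]; rewrite lte_fin; case: ifP => _.
  by rewrite -EFinB lte_fin.
by rewrite lte_fin.
Qed.

Lemma le_integral_itv (q : R -> R) (a b t : R) : 0 <= a -> b <= t ->
  leb.-integrable `[0, t] (EFin \o q) -> (forall s, 0 <= s -> 0 <= q s) ->
  \int[leb]_(s in `[a, b]) q s <= \int[leb]_(s in `[0, t]) q s.
Proof.
move=> a0 bt iq q0.
have abt : `[a, b] `<=` `[0, t].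
  by move=> s /=; rewrite !in_itv/= => /andP[? ?]; apply/andP; split; lra.
have iab : leb.-integrable `[a, b] (EFin \o q) by apply: integrableS iq.
apply: fine_le; [exact: integrable_fin_num|exact: integrable_fin_num|].
apply: ge0_subset_integral => //; first by case/integrableP : iq.
by move=> s /=; rewrite in_itv/= lee_fin => /andP[/q0].
Qed.

End integral_continuity.

Section scalar_convolution.
Context (R : realType) (w : nat -> R -> R).
Hypotheses (w_cont : forall n, continuous (w n)) (w_ge0 : forall n s, 0 <= w n s)
  (w_le1 : forall n s, w n s <= 1)
  (w_small : forall eta eps : R, 0 < eta -> 0 < eps ->
     exists N, forall s, eta <= s -> w N s <= eps).
Local Notation leb := (@lebesgue_measure R).
Variable q : R -> R.
Hypotheses (q_int : forall t, 0 <= t -> leb.-integrable `[0, t] (EFin \o q))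
  (q_ge0 : forall s, 0 <= s -> 0 <= q s).

Lemma continuous_reflect (h : R -> R) (t : R) : continuous h ->
  continuous (fun s => h (t - s)).
Proof.
move=> ch s; apply: (@continuous_comp _ _ _ (fun s => t - s) h); last exact: ch.
by apply: cvgB; [exact: cvg_cst|exact: cvg_id].
Qed.

Lemma integrable_conv n (t b : R) (g : R -> R) : leb.-integrable `[0, b] (EFin \o g) ->
  leb.-integrable `[0, b] (EFin \o (fun s => w n (t - s) * g s)).
Proof. by apply: integrable_continuousM; exact: continuous_reflect. Qed.

(** Split at [s = t - del / 2]. Near [t] the bound [w <= 1] and absolute continuity of the integral
    of [q] suffice; for earlier [s] the argument [t - s] stays away from 0, where [w N] is small. *)
Lemma conv_uniform_small (T eps : R) : 0 <= T -> 0 < eps ->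
  exists N, forall t, 0 <= t <= T -> \int[leb]_(s in `[0, t]) (w N (t - s) * q s) <= eps.
Proof.
move=> T0 eps0.
have e20 : 0 < eps / 2 by rewrite divr_gt0.
have [del del0 qdel] := integral_small e20 (q_int T0) q_ge0.
pose Q := \int[leb]_(s in `[0, T]) q s.
have Q0 : 0 <= Q by apply: Rintegral_ge0 => s; rewrite /= in_itv/= => /andP[/q_ge0].
have Q1 : 0 < Q + 1 by rewrite ltr_wpDl.
have del20 : 0 < del / 2 by rewrite divr_gt0.
have eQ : 0 < eps / 2 / (Q + 1) by rewrite divr_gt0.
have [N wN] := w_small del20 eQ.
exists N => t /andP[t0 tT].
pose E : set R := `[t - del / 2, t]%classic.
have iE : leb.-integrable `[0, t] (EFin \o (q \_ E)).
  have iE0 : leb.-integrable (`[0, t] `&` E) (EFin \o q).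
    apply: integrableS (q_int t0) => //; first by apply: measurableI; exact: measurable_itv.
  by rewrite -restrict_EFin; apply/integrable_restrict => //; exact: measurable_itv.
have iq := q_int t0.
have iZ : leb.-integrable `[0, t] (EFin \o (fun s => eps / 2 / (Q + 1) * q s)).
  by have /(_ (measurable_itv _)) := integrableZl _ (eps / 2 / (Q + 1)) iq; apply: eq_integrable.
apply: (@le_trans _ _ (\int[leb]_(s in `[0, t]) (eps / 2 / (Q + 1) * q s + (q \_ E) s))).
  apply: le_Rintegral => //; first exact: integrable_conv.
    by have /(_ (measurable_itv _)) := integrableD _ iZ iE; apply: eq_integrable.
  move=> s; rewrite /= in_itv/= => /andP[s0 st]; have qs := q_ge0 s0.
  rewrite patchE; have [sE|sE] := pselect (E s).
    rewrite mem_set//; apply: (@le_trans _ _ (q s)); first by rewrite ler_piMl.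
    by rewrite lerDr mulr_ge0// ltW.
  rewrite memNset// addr0 ler_wpM2r// wN//.
  by move: sE; rewrite /E /= in_itv/= st andbT => /negP; rewrite -ltNge; lra.
rewrite RintegralD// RintegralZl// [X in _ <= X]splitr; apply: lerD.
  apply: (@le_trans _ _ (eps / 2 / (Q + 1) * Q)).
    by rewrite ler_pM2l//; apply: le_integral_itv => //; exact: q_int.
  by rewrite mulrAC ler_pdivrMr// ler_pM2l// lerDl.
rewrite -Rintegral_mkcondr.
have -> : `[0, t]%classic `&` E = `[Num.max 0 (t - del / 2), t]%classic.
  apply/seteqP; split => s; rewrite /E /= !in_itv/= ge_max.
    by move=> [/andP[-> ->] /andP[-> _]].
  by move=> /andP[/andP[-> ->] ->].
apply: qdel => //; rewrite ?le_max ?lexx// ?ge_max ?t0/=; first by lra.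
by rewrite ltrBlDr -ltrBlDl lt_max; apply/orP; right; lra.
Qed.

(** One [del] serves all [g] dominated by [q]: the new piece [[a, b]] is small by absolute
    continuity, and on [[0, a]] only the kernel changes, which is uniformly continuous. *)
Lemma conv_equicontinuous n (T eps : R) : 0 <= T -> 0 < eps ->
  exists2 del, 0 < del & forall g : R -> R, continuous g ->
    (forall s, 0 <= s -> `|g s| <= q s) ->
    forall a b, 0 <= a -> a <= b -> b <= T -> b - a < del ->
    `|\int[leb]_(s in `[0, b]) (w n (b - s) * g s) -
      \int[leb]_(s in `[0, a]) (w n (a - s) * g s)| <= eps.
Proof.
move=> T0 eps0.
have e20 : 0 < eps / 2 by rewrite divr_gt0.
have [del1 del10 qdel] := integral_small e20 (q_int T0) q_ge0.
pose Q := \int[leb]_(s in `[0, T]) q s.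
have Q0 : 0 <= Q by apply: Rintegral_ge0 => s; rewrite /= in_itv/= => /andP[/q_ge0].
have Q1 : 0 < Q + 1 by rewrite ltr_wpDl.
have eQ : 0 < eps / 2 / (Q + 1) by rewrite divr_gt0.
have [del2 del20 wdel] := segment_uniform_continuous 0 T (@w_cont n) eQ.
exists (Num.min del1 del2); first by rewrite lt_min del10.
move=> g cg gq a b a0 ab bT; rewrite lt_min => /andP[ba1 ba2].
have b0 := le_trans a0 ab.
have ig c d : leb.-integrable `[c, d] (EFin \o g) by exact: integrable_continuous.
have iwg c t : leb.-integrable `[0, c] (EFin \o (fun s => w n (t - s) * g s)).
  exact: integrable_conv.
have iwg' c d t : leb.-integrable `[c, d] (EFin \o (fun s => w n (t - s) * g s)).
  by apply: integrable_continuousM => //; exact: continuous_reflect.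
have := @Rintegral_itvB _ _ _ _ a (iwg b b); rewrite !bnd_simp => /(_ a0 ab).
rewrite Rintegral_itv_obnd_cbnd; last first.
  by apply: integrableS (iwg' a b b) => //; apply: subset_itvr; rewrite bnd_simp.
set I1 := \int[leb]_(s in `[0, b]) _; set I2 := \int[leb]_(s in `[0, a]) (w n (b - s) * g s).
set I3 := \int[leb]_(s in `[a, b]) _; set I4 := \int[leb]_(s in `[0, a]) (w n (a - s) * g s).
move=> II.
have -> : I1 - I4 = I3 + (I2 - I4) by rewrite -II; move: (I1) (I2) (I4) => x y z; ring.
apply: (le_trans (ler_normD _ _)); rewrite (splitr eps); apply: lerD.
  apply: (le_trans (le_normr_Rintegral _ (iwg' a b b))) => //.
  apply: le_trans (qdel a b a0 ab bT ba1).
  apply: le_Rintegral => //; first exact: (integrable_norm (iwg' a b b)).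
    apply: integrableS (q_int b0) => // s /=; rewrite !in_itv/= => /andP[as_ ->].
    by rewrite (le_trans a0).
  move=> s; rewrite /= in_itv/= => /andP[as_ sb].
  rewrite normrM ger0_norm// (le_trans (ler_piMl _ _))// gq//; exact: le_trans as_.
have -> : I2 - I4 = \int[leb]_(s in `[0, a]) (w n (b - s) * g s - w n (a - s) * g s).
  by rewrite RintegralB.
have iB : leb.-integrable `[0, a] (EFin \o (fun s => w n (b - s) * g s - w n (a - s) * g s)).
  by have /(_ (measurable_itv _)) := integrableB _ (iwg a b) (iwg a a); apply: eq_integrable.
apply: (le_trans (le_normr_Rintegral _ iB)) => //.
apply: (@le_trans _ _ (\int[leb]_(s in `[0, a]) (eps / 2 / (Q + 1) * q s))).
  apply: le_Rintegral => //; first exact: (integrable_norm iB).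
    by have /(_ (measurable_itv _)) := integrableZl _ (eps / 2 / (Q + 1)) (q_int a0);
       apply: eq_integrable.
  move=> s; rewrite /= in_itv/= => /andP[s0 sa].
  rewrite -mulrBl normrM ler_pM//; last exact: gq.
  apply/ltW/wdel; first by apply/andP; split; lra.
  have -> : b - s - (a - s) = b - a by ring.
  by rewrite ger0_norm// subr_ge0.
rewrite RintegralZl//; last exact: q_int.
apply: (@le_trans _ _ (eps / 2 / (Q + 1) * Q)).
  rewrite ler_pM2l//; apply: le_integral_itv => //; [lra|exact: q_int].
by rewrite mulrAC ler_pdivrMr// ler_pM2l// lerDl.
Qed.

End scalar_convolution.

(** * Families of solutions with a dominated forcing *)

Section forced_equation.
Context (R : realType) (V : normedModType R) (dot : V -> V -> R).
Hypotheses (dotC : forall u v, dot u v = dot v u)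
  (dot_linear : forall a u v w, dot (a *: u + v) w = a * dot u w + dot v w)
  (dot_norm : forall v, dot v v = `|v| ^+ 2).
Variable e : nat -> V.
Hypotheses (e_orth : forall m n, dot (e m) (e n) = (m == n)%:R)
  (e_basis : forall v, series (fun n => dot v (e n) *: e n) @ \oo --> v).
Variable w : nat -> R -> R.
Hypotheses (w_cont : forall n, continuous (w n)) (w_ge0 : forall n s, 0 <= w n s)
  (w_le1 : forall n s, w n s <= 1)
  (w_antimono : forall m n s, (m <= n)%N -> w n s <= w m s)
  (w_small : forall eta eps : R, 0 < eta -> 0 < eps ->
     exists N, forall s, eta <= s -> w N s <= eps).
Variable S : R -> V -> V.
Hypothesis S_coord : forall t v n, dot (S t v) (e n) = w n t * dot v (e n).
Local Notation leb := (@lebesgue_measure R).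
Local Notation tail := (coord_tail dot e).

Lemma norm_resolvent t v : `|S t v| <= w 0%N t * `|v|.
Proof.
apply: (le_norm_coord dotC dot_linear dot_norm e_orth e_basis) => // n.
by rewrite S_coord normrM ger0_norm// ler_wpM2r// w_antimono.
Qed.

Lemma norm_tail_resolvent N t v : `|tail N (S t v)| <= w N t * `|v|.
Proof.
apply: (le_norm_tail dotC dot_linear dot_norm e_orth e_basis) => // n Nn.
by rewrite S_coord normrM ger0_norm// ler_wpM2r// w_antimono.
Qed.

Lemma norm_tail_resolvent_le N t v : `|tail N (S t v)| <= `|tail N v|.
Proof.
rewrite -[leRHS]mul1r.
apply: (le_norm_coord dotC dot_linear dot_norm e_orth e_basis) => // n.
rewrite !(dot_tail dot_linear e_orth) mul1r; case: ifP => // _.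
by rewrite S_coord normrM ger0_norm// ler_piMl.
Qed.

(** Coordinates are products of continuous functions, and the resolvent does not enlarge tails, so
    those near [s0] are controlled by the tail of [g s0]. *)
Lemma continuous_resolvent (g : R -> V) (t : R) : continuous g ->
  continuous (fun s => S (t - s) (g s)).
Proof.
move=> cg s0; apply/cvgrPdist_le => eps eps0.
apply: (near_norm_coord (dot := dot) (e := e) (x := fun=> S (t - s0) (g s0))
  (y := fun s => S (t - s) (g s))) => //.
- move=> n d d0; under eq_near do rewrite !S_coord.
  have ch : continuous (fun s => w n (t - s) * dot (g s) (e n)).
    move=> s; apply: cvgM; first exact: continuous_reflect.
    exact: (continuous_dot dotC dot_linear dot_norm).
  by have /cvgrPdist_le/(_ _ d0) := ch s0.
- move=> d d0; have d20 : 0 < d / 2 by rewrite divr_gt0.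
  have [N _ /(_ N (leqnn N)) /=] := iffLR (cvgrPdist_le _ _) (tail_cvg0 e_basis (g s0)) _ d20.
  rewrite sub0r normrN normr_id => tN; exists N.
  have /cvgrPdist_le/(_ _ d20) := cg s0; apply: filterS => s gs; split.
    by apply: le_trans (norm_tail_resolvent_le _ _ _) _; lra.
  apply: le_trans (norm_tail_resolvent_le _ _ _) _.
  have -> : g s = g s0 + (g s - g s0) by rewrite addrC subrK.
  rewrite (tailD dotC dot_linear dot_norm e_orth e_basis).
  apply: le_trans (ler_normD _ _) _; rewrite (splitr d) lerD//.
  apply: le_trans (norm_tail_le dotC dot_linear dot_norm e_orth e_basis _ _) _.
  by rewrite distrC.
Qed.

Section fixed_forcing.
Variables (g : R -> V) (q : R -> R) (t : R) (x0 I : V).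
Hypotheses (g_cont : continuous g) (q_int : leb.-integrable `[0, t] (EFin \o q))
  (gq : forall s, 0 <= s <= t -> `|g s| <= q s)
  (I_int : bochner_integral leb `[0, t] (fun s => S (t - s) (g s)) I).

Lemma forced_norm :
  `|S t x0 + I| <= w 0%N t * `|x0| + \int[leb]_(s in `[0, t]) (w 0%N (t - s) * q s).
Proof.
apply: le_trans (ler_normD _ _) _; apply: lerD; first exact: norm_resolvent.
apply: (le_norm_bochner dotC dot_linear dot_norm) I_int.
- exact: continuous_resolvent.
- exact: integrable_conv.
- by move=> s st; apply: le_trans (norm_resolvent _ _) _; rewrite ler_wpM2l// gq.
Qed.

Lemma forced_tail N :
  `|tail N (S t x0 + I)| <= `|tail N x0| + \int[leb]_(s in `[0, t]) (w N (t - s) * q s).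
Proof.
rewrite (tailD dotC dot_linear dot_norm e_orth e_basis).
apply: le_trans (ler_normD _ _) _; apply: lerD; first exact: norm_tail_resolvent_le.
apply: (le_tail_bochner dotC dot_linear dot_norm e_orth) I_int.
- exact: continuous_resolvent.
- exact: integrable_conv.
- by move=> s st; apply: le_trans (norm_tail_resolvent _ _ _) _; rewrite ler_wpM2l// gq.
Qed.

Lemma forced_coord n : dot (S t x0 + I) (e n) =
  w n t * dot x0 (e n) + \int[leb]_(s in `[0, t]) (w n (t - s) * dot (g s) (e n)).
Proof.
rewrite (dotDl dot_linear) S_coord; congr (_ + _).
rewrite (bochner_dot_continuous dotC dot_linear dot_norm _ _ I_int); last first.
  exact: continuous_resolvent.
by apply: eq_Rintegral => s _; rewrite S_coord.
Qed.

End fixed_forcing.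

(** What remains of a solution once its delay and the nonlinearity are forgotten. Solutions for all
    delays lie in one such family, which makes the bounds below uniform in the delay. *)
Definition forced (q : R -> R) (x0 : V) (y : R -> V) := exists g : R -> V,
  [/\ continuous g, forall s, 0 <= s -> `|g s| <= q s &
    forall t, 0 <= t -> exists2 I,
      bochner_integral leb `[0, t] (fun s => S (t - s) (g s)) I & y t = S t x0 + I].

Variables (q : R -> R) (x0 : V).
Hypotheses (q_int : forall t, 0 <= t -> leb.-integrable `[0, t] (EFin \o q))
  (q_ge0 : forall s, 0 <= s -> 0 <= q s).

Lemma forced_tail_uniform (T eps : R) : 0 <= T -> 0 < eps ->
  exists N, forall y t, forced q x0 y -> 0 <= t <= T -> `|tail N (y t)| <= eps.
Proof.
move=> T0 eps0; have e20 : 0 < eps / 2 by rewrite divr_gt0.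
have [N1 hN1] := conv_uniform_small w_cont w_le1 w_small q_int q_ge0 T0 e20.
have [N2 _ hN2] := iffLR (cvgrPdist_le _ _) (tail_cvg0 e_basis x0) _ e20.
pose N := maxn N1 N2; exists N => y t [g [cg gq yt]] /andP[t0 tT].
have [I bI ->] := yt t t0.
apply: (le_trans (forced_tail x0 cg (q_int t0) _ bI N)).
  by move=> s /andP[s0 _]; exact: gq.
rewrite (splitr eps); apply: lerD.
  by have := hN2 N (leq_maxr _ _); rewrite /= sub0r normrN normr_id.
apply: le_trans (hN1 t _); last by rewrite t0 tT.
have iq := q_int t0.
apply: le_Rintegral => //; [exact: integrable_conv|exact: integrable_conv|].
move=> s; rewrite /= in_itv/= => /andP[s0 _].
by rewrite ler_wpM2r ?q_ge0// w_antimono// leq_maxl.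
Qed.

Lemma forced_coord_equicontinuous n (t0 eps : R) : 0 <= t0 -> 0 < eps ->
  \forall t \near t0, forall y, forced q x0 y -> 0 <= t ->
    `|dot (y t) (e n) - dot (y t0) (e n)| <= eps.
Proof.
move=> t00 eps0; have e20 : 0 < eps / 2 by rewrite divr_gt0.
have T0 : 0 <= t0 + 1 by rewrite addr_ge0.
(* Dividing by [c] brings the scalar forcing below [q], as [conv_equicontinuous] requires. *)
pose c := `|e n| + 1; have c0 : 0 < c by rewrite ltr_wpDl.
have ec : 0 < eps / 2 / c by rewrite divr_gt0.
have [del del0 hdel] := conv_equicontinuous w_cont w_ge0 w_le1 q_int q_ge0 n T0 ec.
have cw : w n t * dot x0 (e n) @[t --> t0] --> w n t0 * dot x0 (e n).
  by apply: cvgMl; exact: w_cont.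
have m0 : 0 < Num.min del 1 by rewrite lt_min del0/=.
near=> t => y [g [cg gq yt]] t_ge0.
have tdel : `|t0 - t| < Num.min del 1 by near: t; exact: (nbhsx_ballx t0 _ m0).
have [td t1'] : `|t0 - t| < del /\ `|t0 - t| < 1 by apply/andP; rewrite -lt_min.
have [I bI ->] := yt t t_ge0; have [I' bI' ->] := yt t0 t00.
rewrite (forced_coord x0 cg bI) (forced_coord x0 cg bI').
pose h s := dot (g s) (e n) / c.
have ch : continuous h.
  by move=> s; apply: cvgMl; exact: (continuous_dot dotC dot_linear dot_norm).
have hq s : 0 <= s -> `|h s| <= q s.
  move=> s0; rewrite normrM normfV (gtr0_norm c0) ler_pdivrMr//.
  apply: le_trans (dot_cauchy_schwarz dotC dot_linear dot_norm _ _) _.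
  by rewrite ler_pM// ?gq// lerDl.
have hE b : 0 <= b -> \int[leb]_(s in `[0, b]) (w n (b - s) * dot (g s) (e n)) =
    c * \int[leb]_(s in `[0, b]) (w n (b - s) * h s).
  move=> b0; rewrite -RintegralZl//; last first.
    by apply: integrable_conv => //; exact: integrable_continuous.
  by apply: eq_Rintegral => s _; rewrite /h mulrCA [c * _]mulrC divfK// gt_eqF.
rewrite !hE// opprD addrACA -mulrBr.
have t1 : t <= t0 + 1 by move: t1'; rewrite ltr_norml => /andP[+ _]; lra.
apply: (le_trans (ler_normD _ _)); rewrite (splitr eps); apply: lerD.
  rewrite distrC; near: t; move/cvgrPdist_le : cw; exact.
rewrite normrM (gtr0_norm c0) mulrC -ler_pdivlMr//.
have [tt0|/ltW t0t] := leP t t0.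
  rewrite distrC; apply: hdel => //; first by lra.
  by move: td; rewrite ger0_norm ?subr_ge0.
apply: hdel => //.
by move: td; rewrite distrC ger0_norm ?subr_ge0.
Unshelve. all: by end_near. Qed.

Lemma forced_equicontinuous (t0 eps : R) : 0 <= t0 -> 0 < eps ->
  \forall t \near t0, forall y, forced q x0 y -> 0 <= t -> `|y t - y t0| <= eps.
Proof.
move=> t00 eps0.
(* The filter of pairs with [t] near [t0] and [y] an arbitrary member of the family encodes
   uniformity in [y]. *)
pose F : set_system (R * (R -> V)) := fun A =>
  \forall t \near t0, forall y, forced q x0 y -> 0 <= t -> A (t, y).
have FF : Filter F.
  split.
  - by apply: (@filterS _ (nbhs t0) _ setT) => //; exact: filterT.
  - move=> A B FA FB; apply: (@filterS _ (nbhs t0) _ _ _ _ (@filterI _ (nbhs t0) _ _ _ FA FB)).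
    by move=> t [tA tB] y fy t_ge0; split; [exact: tA|exact: tB].
  - move=> A B AB FA; apply: (@filterS _ (nbhs t0) _ _ _ _ FA).
    by move=> t tA y fy t_ge0; apply: AB; exact: tA.
have := @near_norm_coord _ _ dot e _ F (fun ty => ty.2 ty.1) (fun ty => ty.2 t0) FF.
apply => //.
- by move=> n d d0; exact: forced_coord_equicontinuous.
- move=> d d0; have T0 : 0 <= t0 + 1 by rewrite addr_ge0.
  have [N hN] := forced_tail_uniform T0 d0; exists N.
  have t1 : \forall t \near t0, t < t0 + 1 by apply: lt_nbhsl; rewrite ltrDl.
  apply: (@filterS _ (nbhs t0) _ _ _ _ t1) => t tt y fy t_ge0 /=.
  split; apply: (hN _ _ fy); first by rewrite t_ge0 ltW.
  by rewrite t00 lerDl ler01.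
Qed.


End forced_equation.

(** * The delayed equation: invariant ball and uniform decay *)

Section delayed_equation.
Context (R : realType) (V : normedModType R) (dot : V -> V -> R).
Hypotheses (dotC : forall u v, dot u v = dot v u)
  (dot_linear : forall a u v w, dot (a *: u + v) w = a * dot u w + dot v w)
  (dot_norm : forall v, dot v v = `|v| ^+ 2).
Variable e : nat -> V.
Hypotheses (e_orth : forall m n, dot (e m) (e n) = (m == n)%:R)
  (e_basis : forall v, series (fun n => dot v (e n) *: e n) @ \oo --> v).
Variable w : nat -> R -> R.
Hypotheses (w_cont : forall n, continuous (w n)) (w_ge0 : forall n s, 0 <= w n s)
  (w_le1 : forall n s, w n s <= 1)
  (w_antimono : forall m n s, (m <= n)%N -> w n s <= w m s)
  (w_small : forall eta eps : R, 0 < eta -> 0 < eps ->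
     exists N, forall s, eta <= s -> w N s <= eps)
  (w_lim : forall eps : R, 0 < eps -> exists T, forall s, T <= s -> w 0%N s <= eps).
Variable S : R -> V -> V.
Hypothesis S_coord : forall t v n, dot (S t v) (e n) = w n t * dot v (e n).
Local Notation leb := (@lebesgue_measure R).
Local Notation tail := (coord_tail dot e).
Variables (f : R -> V -> V) (p G : R -> R) (M r kappa : R).
Hypotheses (f_cont : continuous (fun tv : R * V => f tv.1 tv.2))
  (p_int : forall t, 0 <= t -> leb.-integrable `[0, t] (EFin \o p))
  (p_ge0 : forall s, 0 <= s -> 0 <= p s)
  (G_ge0 : forall s, 0 <= s -> 0 <= G s)
  (G_ndecr : forall a b, 0 <= a -> a <= b -> G a <= G b)
  (f_le : forall t v, 0 <= t -> `|f t v| <= p t * G `|v|)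
  (p_conv : forall t, 0 <= t -> \int[leb]_(s in `[0, t]) (w 0%N (t - s) * p s) <= M)
  (r_gt0 : 0 < r) (kappa01 : 0 <= kappa < 1)
  (G_kappa : forall s, 0 < s <= r -> M * G s <= kappa * s)
  (p_tail : forall eps, 0 < eps -> exists T, forall t, T <= t ->
     \int[leb]_(s in `[0, t / 2]) (w 0%N (t - s) * p s) <= eps).
Variables (xi : R -> V) (theta0 : R -> R).
Hypotheses (xi_cont : continuous xi) (xi_le : forall s, `|xi s| <= (1 - kappa) * r / 2)
  (theta0_cont : continuous theta0) (theta0_le : forall s, 0 <= s -> theta0 s <= s)
  (theta0_lim : forall A, exists T, forall s, T <= s -> A <= theta0 s).

Definition delay (theta : R -> R) := continuous theta /\
  forall s, 0 <= s -> theta s <= s /\ theta0 s - 1 <= theta s.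

(* [xi] is defined on the whole negative half-line, so that the delay may be
   enlarged without leaving the domain of the history. *)
Definition delayed_solution (theta : R -> R) (u : R -> V) :=
  [/\ continuous u, forall s, s <= 0 -> u s = xi s &
    forall t, 0 <= t -> exists2 I,
      bochner_integral leb `[0, t] (fun s => S (t - s) (f s (u (theta s)))) I &
      u t = S t (xi 0) + I].

Let kappa0 : 0 <= kappa. Proof. by have /andP[] := kappa01. Qed.
Let kappa1 : kappa < 1. Proof. by have /andP[] := kappa01. Qed.

Lemma continuous_forcing (u : R -> V) (theta : R -> R) : continuous u ->
  continuous theta -> continuous (fun s => f s (u (theta s))).
Proof.
move=> cu ct s.
have cut : u (theta z) @[z --> s] --> u (theta s).
  by apply: (@continuous_comp _ _ _ theta u); [exact: ct|exact: cu].
have h : (z, u (theta z)) @[z --> s] --> (s, u (theta s)).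
  exact: (@cvg_pair _ _ _ (nbhs s) (nbhs s) (nbhs (u (theta s))) _ _ _ id
    (u \o theta) (@cvg_id _ _) cut).
exact: (cvg_comp _ _ h (@f_cont (s, u (theta s)))).
Qed.

Let Gr := G r.
Let q s := p s * Gr.
Let Gr0 : 0 <= Gr. Proof. by apply: G_ge0; exact: ltW. Qed.

Lemma ball_forcing_integrable t : 0 <= t -> leb.-integrable `[0, t] (EFin \o q).
Proof.
move=> t0; have /(_ (measurable_itv _)) := integrableZr _ Gr (p_int t0).
exact: eq_integrable.
Qed.

Lemma ball_forcing_ge0 s : 0 <= s -> 0 <= q s.
Proof. by move=> s0; rewrite mulr_ge0// p_ge0. Qed.

Lemma ball_forcing_le s v : 0 <= s -> `|v| <= r -> `|f s v| <= q s.
Proof.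
move=> s0 vr; apply: le_trans (f_le _ s0) _.
by rewrite ler_wpM2l ?p_ge0// G_ndecr.
Qed.

(** The history contributes at most [(1 - kappa) * r / 2] and the forcing at most
    [M * G r <= kappa * r]. *)
Lemma ball_step (g : R -> V) (t : R) I : 0 <= t -> continuous g ->
  (forall s, 0 <= s <= t -> `|g s| <= q s) ->
  bochner_integral leb `[0, t] (fun s => S (t - s) (g s)) I ->
  `|S t (xi 0) + I| <= (1 + kappa) / 2 * r.
Proof.
move=> t0 cg gq bI.
have := forced_norm dotC dot_linear dot_norm e_orth e_basis w_cont w_ge0 w_le1 w_antimono
  S_coord (xi 0) cg (ball_forcing_integrable t0) gq bI.
have -> : \int[leb]_(s in `[0, t]) (w 0%N (t - s) * q s) =
    (\int[leb]_(s in `[0, t]) (w 0%N (t - s) * p s)) * Gr.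
  rewrite -RintegralZr//; first by apply: eq_Rintegral => s _; rewrite mulrA.
  by apply: integrable_conv => //; exact: p_int.
have h1 : w 0%N t * `|xi 0| <= (1 - kappa) * r / 2.
  by apply: le_trans (xi_le 0); rewrite ler_piMl.
have h2 := ler_wpM2r Gr0 (p_conv t0).
have := G_kappa (s := r); rewrite r_gt0 lexx -/Gr => /(_ isT) h3 h4.
apply: le_trans h4 _; move: h1 h2 h3; set X := w 0%N t * _; set Y := Rintegral _ _ _ * _.
by move: (M * Gr) => Z; lra.
Qed.

(** At the first time [m] where the norm reaches [r], the delayed argument has only met values in
    the ball, so [ball_step] puts [u m] strictly inside, a contradiction. *)
Lemma delayed_solution_le (theta : R -> R) (u : R -> V) : delay theta ->
  delayed_solution theta u -> forall t, `|u t| <= r.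
Proof.
move=> [ct tle] [cu uxi ueq] t.
have xir s : `|xi s| < r.
  apply: le_lt_trans (xi_le s) _.
  by have := mulr_ge0 kappa0 (ltW r_gt0); have := r_gt0; lra.
have [t0|/ltW t0] := leP t 0; first by rewrite uxi// ltW.
rewrite leNgt; apply/negP => ut.
pose E : set R := [set s | 0 <= s /\ r <= `|u s|].
have E0 : has_inf E.
  by split; [exists t; split => //; exact: ltW|exists 0 => s []].
pose m := inf E.
have m0 : 0 <= m by apply: lb_le_inf; [exists t; split => //; exact: ltW|move=> s []].
have below s : s < m -> `|u s| < r.
  move=> sm; have [s0|s0] := leP s 0; first by rewrite uxi.
  rewrite ltNge; apply/negP => us; move: sm; rewrite ltNge => /negP; apply.
  by apply: ge_inf; [exists 0 => z []|split => //; exact: ltW].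
have cnu : {for m, continuous (fun s => `|u s|)} by apply: cvg_norm; exact: cu.
have um1 : `|u m| <= r.
  rewrite leNgt; apply/negP => um.
  have : \forall s \near m, r < `|u s| by exact: (cvgr_gt _ cnu _ um).
  move=> /nbhs_ballP[d /= d0 dP].
  have : r < `|u (m - d / 2)|.
    apply: dP; rewrite /ball/= opprB addrCA subrr addr0 gtr0_norm ?divr_gt0//.
    by rewrite ltr_pdivrMr// ltr_pMr// ltr1n.
  by rewrite ltNge ltW// below// gtrBl divr_gt0.
have um2 : r <= `|u m|.
  rewrite leNgt; apply/negP => um.
  have : \forall s \near m, `|u s| < r by exact: (cvgr_lt _ cnu _ um).
  move=> /nbhs_ballP[d /= d0 dP].
  have [s [s0 us] sm] := inf_adherent d0 E0.
  have ms : m <= s by apply: ge_inf; [exists 0 => z []|split].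
  suff : `|u s| < r by rewrite ltNge us.
  apply: dP; rewrite /ball/= distrC ger0_norm ?subr_ge0//.
  by rewrite ltrBlDl.
have [I bI umE] := ueq m m0.
have gq s : 0 <= s <= m -> `|f s (u (theta s))| <= q s.
  move=> /andP[s0 sm]; apply: ball_forcing_le => //.
  have [ts _] := tle s s0; have := le_trans ts sm.
  by rewrite le_eqVlt => /predU1P[->//|/below/ltW].
have := ball_step m0 (continuous_forcing cu ct) gq bI.
rewrite -umE => h; have := le_trans um2 h.
have : 0 < (1 - kappa) * r by rewrite mulr_gt0// subr_gt0.
by lra.
Qed.

Lemma delayed_solution_forced (theta : R -> R) (u : R -> V) : delay theta ->
  delayed_solution theta u -> forced S q (xi 0) u.
Proof.
move=> dt su; have ur := delayed_solution_le dt su.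
case: dt su => ct tle [cu uxi ueq].
exists (fun s => f s (u (theta s))); split => //; first exact: continuous_forcing.
by move=> s s0; exact: ball_forcing_le.
Qed.

(* If [|u| <= l] at all late times, then the times with a late delayed argument
   contribute at most [M * G l <= kappa * l] to the integral, and the contribution
   of the earlier times vanishes by [p_tail]; hence [|u| <= (1 + kappa) / 2 * l]
   eventually. *)
Lemma delayed_solution_decay eps : 0 < eps -> exists T, forall theta u,
  delay theta -> delayed_solution theta u -> forall t, T <= t -> `|u t| <= eps.
Proof.
move=> eps0.
pose k := (1 + kappa) / 2.
have k1 : 0 < k by rewrite /k; move: kappa0; lra.
have k2 : k < 1 by rewrite /k; move: kappa1; lra.
have kk : 0 < k - kappa by rewrite /k; move: kappa1; lra.
suff step j : exists T, forall theta u, delay theta -> delayed_solution theta u ->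
    forall t, T <= t -> `|u t| <= k ^+ j * r.
  have kj0 : k ^+ j * r @[j --> \oo] --> (0 : R).
    rewrite -[X in _ --> X](mul0r r); apply: cvgMl.
    by apply: cvg_expr; rewrite gtr0_norm.
  have [j _ /(_ j (leqnn j))] := iffLR (cvgrPdist_le _ _) kj0 _ eps0.
  rewrite sub0r normrN ger0_norm; last by rewrite mulr_ge0 ?exprn_ge0 ?ltW.
  move=> kj; have [T HT] := step j.
  exists T => theta u dt su t Tt; exact: le_trans (HT _ _ dt su t Tt) kj.
elim: j => [|j [Tj IH]].
  by exists 0 => theta u dt su t _; rewrite mul1r; exact: delayed_solution_le su t.
pose l := k ^+ j * r.
have l0 : 0 < l by rewrite mulr_gt0// exprn_gt0.
have lr : l <= r by rewrite ler_piMl ?(ltW r_gt0)// exprn_ile1 ?ltW.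
(* The gap between [kappa * l] and [k * l] is [2 * d]: one [d] for the history, one for the early
   half of the integral. *)
pose d := (k - kappa) * l / 2.
have d0 : 0 < d by rewrite divr_gt0// mulr_gt0.
have dr : 0 < d / r by rewrite divr_gt0.
have dG : 0 < d / (Gr + 1) by rewrite divr_gt0// ltr_wpDl.
(* The extra 1 absorbs the slack between [theta0] and [theta]. *)
have [A hA] := theta0_lim (Tj + 1).
have [T1 hT1] := w_lim dr.
have [T2 hT2] := p_tail dG.
pose T := Num.max (2 * `|A|) (Num.max T1 T2).
exists T => theta u dt su t Tt.
have [A2t T1t T2t] : [/\ 2 * `|A| <= t, T1 <= t & T2 <= t].
  by move: Tt; rewrite !ge_max => /andP[? /andP[? ?]].
have t0 : 0 <= t by apply: le_trans A2t; rewrite mulr_ge0.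
have ur := delayed_solution_le dt su.
have ul := IH _ _ dt su.
case: dt su => ct tle [cu uxi ueq].
have [I bI ->] := ueq t t0.
pose E : set R := `[0, t / 2]%classic.
(* A bound for the forcing: [G l] suffices once [s >= t / 2 >= A], while on [[0, t / 2]] only the a
   priori bound [G r] is available. *)
pose q' s := G l * p s + (p \_ E) s * Gr.
have mE : measurable E by exact: measurable_itv.
have ip := p_int t0.
have iE : leb.-integrable `[0, t] (EFin \o (p \_ E)).
  have iE0 : leb.-integrable (`[0, t] `&` E) (EFin \o p).
    by apply: integrableS ip => //; apply: measurableI; exact: measurable_itv.
  by rewrite -restrict_EFin; apply/integrable_restrict => //; exact: measurable_itv.
have i1 : leb.-integrable `[0, t] (EFin \o (fun s => G l * p s)).
  by have /(_ (measurable_itv _)) := integrableZl _ (G l) ip; apply: eq_integrable.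
have i2 : leb.-integrable `[0, t] (EFin \o (fun s => (p \_ E) s * Gr)).
  by have /(_ (measurable_itv _)) := integrableZr _ Gr iE; apply: eq_integrable.
have iq' : leb.-integrable `[0, t] (EFin \o q').
  by have /(_ (measurable_itv _)) := integrableD _ i1 i2; apply: eq_integrable.
have Gl0 : 0 <= G l by apply: G_ge0; exact: ltW.
have gq s : 0 <= s <= t -> `|f s (u (theta s))| <= q' s.
  move=> /andP[s0 st]; have ps := p_ge0 s0.
  rewrite /q' patchE; have [sE|sE] := pselect (E s).
    rewrite mem_set//; apply: le_trans (ball_forcing_le s0 (ur _)) _.
    by rewrite lerDr mulr_ge0.
  rewrite memNset// mul0r addr0; apply: le_trans (f_le _ s0) _.
  rewrite mulrC ler_wpM2r// G_ndecr// ul//.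
  have ts : t / 2 <= s.
    by move: sE; rewrite /E /= in_itv/= s0/= => /negP; rewrite -ltNge => /ltW.
  have [_] := tle s s0; apply: le_trans.
  suff : Tj + 1 <= theta0 s by lra.
  apply: hA; apply: le_trans ts; apply: le_trans (ler_norm _) _.
  by rewrite ler_pdivlMr// mulrC.
have := forced_norm dotC dot_linear dot_norm e_orth e_basis w_cont w_ge0 w_le1 w_antimono
  S_coord (xi 0) (continuous_forcing cu ct) iq' gq bI.
have jp := integrable_conv w_cont 0%N t ip.
have jE := integrable_conv w_cont 0%N t iE.
have -> : \int[leb]_(s in `[0, t]) (w 0%N (t - s) * q' s) =
    G l * (\int[leb]_(s in `[0, t]) (w 0%N (t - s) * p s)) +
    (\int[leb]_(s in `[0, t / 2]) (w 0%N (t - s) * p s)) * Gr.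
  have -> : \int[leb]_(s in `[0, t / 2]) (w 0%N (t - s) * p s) =
      \int[leb]_(s in `[0, t]) (w 0%N (t - s) * (p \_ E) s).
    have <- : `[0, t]%classic `&` E = `[0, t / 2]%classic.
      apply/seteqP; split => s; rewrite /E /= !in_itv/=; first by move=> [_ ->].
      move=> /andP[s0 st]; rewrite s0 st; split => //; rewrite (le_trans st)//.
      by rewrite ler_pdivrMr// ler_peMr// ler1n.
    rewrite Rintegral_mkcondr; apply: eq_Rintegral => s _.
    by rewrite !patchE; case: ifP => _; rewrite ?mulr0.
  rewrite -RintegralZl// -RintegralZr// -RintegralD//.
  - by apply: eq_Rintegral => s _; rewrite /q'; ring.
  - by have /(_ (measurable_itv _)) := integrableZl _ (G l) jp; apply: eq_integrable.
  - by have /(_ (measurable_itv _)) := integrableZr _ Gr jE; apply: eq_integrable.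
have h1 : w 0%N t * `|xi 0| <= d.
  apply: (@le_trans _ _ (d / r * r)); last by rewrite divfK// gt_eqF.
  rewrite ler_pM ?hT1//; apply: le_trans (xi_le 0) _.
  by have := mulr_ge0 kappa0 (ltW r_gt0); have := r_gt0; lra.
have h2 : \int[leb]_(s in `[0, t / 2]) (w 0%N (t - s) * p s) * Gr <= d.
  have := ler_wpM2r Gr0 (hT2 t T2t); move/le_trans; apply.
  by rewrite mulrAC ler_pdivrMr ?ltr_wpDl// ler_pM2l// lerDl.
have h3 : G l * (\int[leb]_(s in `[0, t]) (w 0%N (t - s) * p s)) <= kappa * l.
  apply: le_trans (ler_wpM2l Gl0 (p_conv t0)) _; rewrite mulrC G_kappa// l0//.
move=> h; apply: le_trans h _; rewrite exprS -mulrA -/l.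
move: h1 h2 h3; rewrite /d.
set X := w 0%N t * _; set Y := Rintegral _ _ _ * _; set Z := _ * Rintegral _ _ _.
by move: X Y Z => X Y Z; lra.
Qed.


Lemma bochner_dist (F1 F2 : R -> V) (t d : R) I1 I2 : continuous F1 -> continuous F2 ->
  0 <= t -> 0 <= d -> (forall s, 0 <= s <= t -> `|F1 s - F2 s| <= d) ->
  bochner_integral leb `[0, t] F1 I1 -> bochner_integral leb `[0, t] F2 I2 ->
  `|I1 - I2| <= d * t.
Proof.
move=> cF1 cF2 t0 d0 Fd b1 b2.
have [->|z0] := eqVneq (I1 - I2) 0; first by rewrite normr0 mulr_ge0.
have nz0 : 0 < `|I1 - I2| by rewrite normr_gt0.
rewrite -(ler_pM2r nz0) -expr2 -dot_norm (dotBl dot_linear).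
set z := I1 - I2 in nz0 z0 *.
rewrite (bochner_dot_continuous dotC dot_linear dot_norm _ cF1 b1).
rewrite (bochner_dot_continuous dotC dot_linear dot_norm _ cF2 b2).
have cd (F : R -> V) : continuous F -> continuous (fun s => dot (F s) z).
  by move=> cF; exact: (continuous_dot dotC dot_linear dot_norm).
have i1 := integrable_continuous 0 t (cd _ cF1).
have i2 := integrable_continuous 0 t (cd _ cF2).
rewrite -RintegralB//; apply: le_trans (ler_norm _) _.
have iB : leb.-integrable `[0, t] (EFin \o (fun s => dot (F1 s) z - dot (F2 s) z)).
  by have /(_ (measurable_itv _)) := integrableB _ i1 i2; apply: eq_integrable.
apply: (le_trans (le_normr_Rintegral _ iB)) => //.
have -> : d * t * `|z| = \int[leb]_(s in `[0, t]) (d * `|z|).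
  rewrite Rintegral_cst//.
  have /= -> := @lebesgue_measure_itv R `[0, t]; rewrite lte_fin.
  case: ltP => [_|t1]; first by rewrite /= subr0 mulrAC.
  have -> : t = 0 by apply/eqP; rewrite eq_le t0 t1.
  by rewrite !mulr0 mul0r.
apply: le_Rintegral => //.
- exact: (integrable_norm iB).
- by apply: integrable_continuous; exact: cst_continuous.
- move=> s /=; rewrite in_itv/= => st; rewrite -(dotBl dot_linear).
  apply: le_trans (dot_cauchy_schwarz dotC dot_linear dot_norm _ _) _.
  by rewrite ler_wpM2r// Fd.
Qed.

Lemma resolvent_dist t u v : `|S t u - S t v| <= `|u - v|.
Proof.
rewrite -[leRHS]mul1r; apply: (le_norm_coord dotC dot_linear dot_norm e_orth e_basis) => // n.
rewrite !(dotBl dot_linear) !S_coord -mulrBr normrM ger0_norm//.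
by rewrite ler_wpM2r.
Qed.

Hypothesis V_complete : forall F : set_system V, ProperFilter F -> cauchy F -> cvg F.

(** On a compact interval an ultrafilter has a cluster point, and a cluster point of an ultrafilter
    is its limit. *)
Lemma ultra_bounded_cvg (J : Type) (U : set_system J) (h : J -> R) (B : R) :
  UltraFilter U -> (\forall j \near U, `|h j| <= B) -> cvg (h j @[j --> U]).
Proof.
move=> UU hB.
have hB' : \forall j \near U, `[- B, B]%classic (h j).
  by apply: filterS hB => j; rewrite /= in_itv/= -ler_norml.
have [l [_ cl]] := @segment_compact R (- B) B (h @ U) _ hB'.
apply/cvg_ex; exists l => A nA.
have [//|UC] := in_ultra_setVsetC (h @^-1` A) UU.
by have [x [xA]] := cl (~` A) A UC nA.
Qed.

(** * Limits of solutions along an ultrafilter, with varying delays *)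

Section limit.
Context (J : Type) (U : set_system J) (UU : UltraFilter U).
Variables (th : J -> R -> R) (us : J -> R -> V).
Hypotheses (us_sol : \forall j \near U, delay (th j) /\ delayed_solution (th j) (us j))
  (th_cvg : forall d, 0 < d -> \forall j \near U, forall s, `|th j s - theta0 s| <= d).

Let us_forced : \forall j \near U, forced S q (xi 0) (us j).
Proof. by apply: filterS us_sol => j [dj sj]; exact: delayed_solution_forced sj. Qed.

Let us_le : \forall j \near U, forall t, `|us j t| <= r.
Proof. by apply: filterS us_sol => j [dj sj]; exact: delayed_solution_le sj. Qed.

(** Each coordinate is bounded, hence converges along [U]; with uniformly small tails,
    [near_norm_coord] on the product filter gives the Cauchy property. *)
Let pointwise_cvg t : 0 <= t -> cvg (us j t @[j --> U]).
Proof.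
move=> t0; apply: V_complete; apply: cauchy_exP => d d0.
have d20 : 0 < d / 2 by rewrite divr_gt0.
have [] : \forall ij \near filter_prod U U, `|us ij.1 t - us ij.2 t| <= d / 2.
  apply: (near_norm_coord (dot := dot) (e := e)) => //.
  - move=> n a a0; have a20 : 0 < a / 2 by rewrite divr_gt0.
    have /cvg_ex[l hl] : cvg (dot (us j t) (e n) @[j --> U]).
      apply: (@ultra_bounded_cvg _ _ _ (r * `|e n|)).
      apply: filterS us_le => j jr.
      apply: le_trans (dot_cauchy_schwarz dotC dot_linear dot_norm _ _) _.
      by rewrite ler_wpM2r.
    have hl2 := iffLR (cvgrPdist_le _ _) hl _ a20.
    exists ([set j | `|l - dot (us j t) (e n)| <= a / 2],
            [set j | `|l - dot (us j t) (e n)| <= a / 2]); first by split; exact: hl2.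
    move=> [i j] /= [hi hj].
    by apply: le_trans (ler_distD l _ _) _; rewrite (splitr a) lerD// distrC.
  - move=> a a0.
    have [N hN] := forced_tail_uniform dotC dot_linear dot_norm e_orth e_basis w_cont w_ge0
      w_le1 w_antimono w_small S_coord (xi 0) ball_forcing_integrable ball_forcing_ge0 t0 a0.
    exists N; exists ([set j | `|tail N (us j t)| <= a], [set j | `|tail N (us j t)| <= a]).
      by split; apply: filterS us_forced => j fj; apply: hN fj _; rewrite t0 lexx.
    by move=> [i j] /= [].
move=> [A B] /= [UA UB] AB.
have [i Ai] := filter_ex UA.
exists (us i t); apply: filterS UB => j Bj; rewrite -ball_normE/=.
apply: (@le_lt_trans _ _ (d / 2)); first exact: (AB (i, j)).
by rewrite ltr_pdivrMr// ltr_pMr// ltr1n.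
Qed.

Let u (t : R) : V := if t <= 0 then xi t else lim (us j t @[j --> U]).

Let us_xi : \forall j \near U, forall t, t <= 0 -> us j t = u t.
Proof.
apply: filterS us_sol => j [_ [_ uxi _]] t t0; rewrite uxi// /u t0//.
Qed.

Let us_cvg t : us j t @[j --> U] --> u t.
Proof.
have [t0|t0] := leP t 0.
  by apply: cvg_near_cst; apply: filterS us_xi => j ->.
by rewrite /u leNgt t0/=; exact: (pointwise_cvg (ltW t0)).
Qed.

Let le_cvg (a : R) (y : J -> V) l : y j @[j --> U] --> l ->
  (\forall j \near U, `|y j| <= a) -> `|l| <= a.
Proof.
move=> yl ya; apply/ler_addgt0Pr => d d0.
have [j [yj lj]] := filter_ex (filterI ya (iffLR (cvgrPdist_le _ _) yl _ d0)).
rewrite -[l](subrK (y j)) addrC; apply: le_trans (ler_normD _ _) _.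
exact: lerD.
Qed.

(** Equicontinuity of the family upgrades convergence at [t0] to uniform convergence near [t0], in
    three steps of [d / 3]. *)
Let local_cvg (t0 d : R) : 0 <= t0 -> 0 < d ->
  \forall t \near t0 & j \near U, 0 <= t -> `|us j t - u t| <= d.
Proof.
move=> t00 d0; have d30 : 0 < d / 3 by rewrite divr_gt0.
have heq := forced_equicontinuous dotC dot_linear dot_norm e_orth e_basis w_cont w_ge0
  w_le1 w_antimono w_small S_coord (xi 0) ball_forcing_integrable ball_forcing_ge0 t00 d30.
have hu : \forall t \near t0, 0 <= t -> `|u t - u t0| <= d / 3.
  apply: filterS heq => t ht t_ge0.
  apply: (@le_cvg _ (fun j => us j t - us j t0)); first exact: cvgB.
  by apply: filterS us_forced => j fj; exact: ht.
have h0 : \forall j \near U, `|u t0 - us j t0| <= d / 3.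
  by have /cvgrPdist_le/(_ _ d30) := @us_cvg t0.
exists ([set t | (forall y, forced S q (xi 0) y -> 0 <= t -> `|y t - y t0| <= d / 3) /\
   (0 <= t -> `|u t - u t0| <= d / 3)],
  [set j | forced S q (xi 0) (us j) /\ `|u t0 - us j t0| <= d / 3]).
  by split; apply: filterI.
move=> [t j] /= [[h1 h2] [h3 h4]] t_ge0.
have := h1 _ h3 t_ge0; have := h2 t_ge0; move: h4 => h4 h5 h6.
apply: le_trans (ler_distD (us j t0) _ _) _.
apply: le_trans (lerD h6 (ler_distD (u t0) _ _)) _.
rewrite distrC [X in _ + (_ + X)]distrC; have := lerD h4 h5.
by rewrite [X in X + _ <= _]distrC; lra.
Qed.

(** Beyond [T] uniform decay makes both functions small, [[0, T]] is covered by local uniform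
    convergence, and on the history they coincide. *)
Lemma ultra_limit_uniform (d : R) : 0 < d ->
  \forall j \near U, forall t, `|us j t - u t| <= d.
Proof.
move=> d0; have d20 : 0 < d / 2 by rewrite divr_gt0.
have [T hT] := delayed_solution_decay d20.
have us_dec : \forall j \near U, forall t, T <= t -> `|us j t| <= d / 2.
  by apply: filterS us_sol => j [dj sj] t; exact: (hT _ _ dj sj t).
have u_dec t : T <= t -> `|u t| <= d / 2.
  by move=> Tt; apply: le_cvg (@us_cvg t) _; apply: filterS us_dec => j; exact.
have cov : \forall j \near U, forall t, 0 <= t <= T -> `|us j t - u t| <= d.
  have /compact_near_coveringP cT := @segment_compact R 0 T.
  suff H : forall t0, `[0, T]%classic t0 -> \forall t \near t0 & j \near U,
      0 <= t -> `|us j t - u t| <= d.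
    have := cT J U (fun j t => 0 <= t -> `|us j t - u t| <= d) _ H.
    have FU : Filter U by exact: _.
    move=> /(_ FU) hU; apply: filterS hU => j hj t /andP[t0 tT].
    by apply: hj => //; rewrite /= in_itv/= t0.
  by move=> t0; rewrite /= in_itv/= => /andP[t00 _]; exact: local_cvg.
apply: filterS (filterI us_xi (filterI us_dec cov)) => j [jxi [jdec jcov]] t.
have [t0|/ltW t0] := leP t 0; first by rewrite jxi// subrr normr0 ltW.
have [Tt|/ltW tT] := leP T t; last by apply: jcov; rewrite t0.
apply: le_trans (ler_normB _ _) _; rewrite (splitr d) lerD//; first exact: jdec.
exact: u_dec.
Qed.

Lemma ultra_limit_continuous : continuous u.
Proof.
move=> t0; apply/cvgrPdist_le => d d0; have d30 : 0 < d / 3 by rewrite divr_gt0.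
have [j [ju [_ [cj _ _]]]] := filter_ex (filterI (ultra_limit_uniform d30) us_sol).
have /cvgrPdist_le/(_ _ d30) := cj t0; apply: filterS => t jt.
have h1 := ju t0; have h2 := ju t.
apply: le_trans (ler_distD (us j t0) _ _) _.
apply: le_trans (lerD (lexx _) (ler_distD (us j t) _ _)) _.
by rewrite [X in X + _ <= _]distrC; lra.
Qed.

(** In infinite dimension [f] need not be uniformly continuous on bounded sets. It is controlled
    only near the compact curve of points [(s, u (theta0 s))], whence the covering argument in
    [s]. *)
Let forcing_cvg t d : 0 <= t -> 0 < d -> \forall j \near U, forall s, 0 <= s <= t ->
  `|f s (us j (th j s)) - f s (u (theta0 s))| <= d.
Proof.
move=> t0 d0; have d20 : 0 < d / 2 by rewrite divr_gt0.
have /compact_near_coveringP cT := @segment_compact R 0 t.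
suff H : forall s0, `[0, t]%classic s0 -> \forall s \near s0 & j \near U,
    `|f s (us j (th j s)) - f s (u (theta0 s))| <= d.
  have := cT J U (fun j s => `|f s (us j (th j s)) - f s (u (theta0 s))| <= d) _ H.
  have FU : Filter U by exact: _.
  by move=> /(_ FU) hU; apply: filterS hU => j hj s st; apply: hj; rewrite /= in_itv.
move=> s0 _.
have cg := continuous_forcing ultra_limit_continuous theta0_cont.
have /cvgrPdist_le/(_ _ d20) g0 := cg s0.
have /cvgrPdist_le/(_ _ d20)[[/= A B] [nA nB] AB] := @f_cont (s0, u (theta0 s0)).
have /nbhs_ballP[a /= a0 aB] := nB.
have a20 : 0 < a / 2 by rewrite divr_gt0.
have /cvgrPdist_lt/(_ _ a20)/nbhs_ballP[b /= b0 bu] := ultra_limit_continuous (x := theta0 s0).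
have b20 : 0 < b / 2 by rewrite divr_gt0.
have a40 : 0 < a / 4 by rewrite divr_gt0.
have b40 : 0 < b / 4 by rewrite divr_gt0.
have hs : \forall s \near s0, [/\ A s, `|theta0 s0 - theta0 s| < b / 2 &
    `|f s0 (u (theta0 s0)) - f s (u (theta0 s))| <= d / 2].
  have ct : \forall s \near s0, `|theta0 s0 - theta0 s| < b / 2.
    by have /cvgrPdist_lt/(_ _ b20) := @theta0_cont s0.
  have nA' : \forall s \near s0, A s := nA.
  by apply: filterS (filterI nA' (filterI ct g0)) => s [? []].
have hj : \forall j \near U, (forall t, `|us j t - u t| <= a / 4) /\
    (forall s, `|th j s - theta0 s| <= b / 4).
  exact: filterI (ultra_limit_uniform a40) (th_cvg b40).
exists ([set s | [/\ A s, `|theta0 s0 - theta0 s| < b / 2 &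
    `|f s0 (u (theta0 s0)) - f s (u (theta0 s))| <= d / 2]],
  [set j | (forall t, `|us j t - u t| <= a / 4) /\
    (forall s, `|th j s - theta0 s| <= b / 4)]); first by split.
move=> [s j] /= [[As ts gs] [ju jt]].
have us_ball : ball (u (theta0 s0)) a (us j (th j s)).
  rewrite -ball_normE/=; apply: le_lt_trans (ler_distD (u (th j s)) _ _) _.
  have h1 : `|u (theta0 s0) - u (th j s)| < a / 2.
    apply: bu; rewrite /ball/=; apply: le_lt_trans (ler_distD (theta0 s) _ _) _.
    by have := jt s; rewrite (distrC (th j s)); lra.
  by have := ju (th j s); rewrite (distrC (us j _)); lra.
have := AB (s, us j (th j s)) (conj As (aB _ us_ball)) => /= h.
apply: le_trans (ler_distD (f s0 (u (theta0 s0))) _ _) _.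
by rewrite (splitr d) lerD// distrC.
Qed.

Lemma ultra_limit_solution : delayed_solution theta0 u.
Proof.
split; first exact: ultra_limit_continuous.
  by move=> t t0; rewrite /u t0.
move=> t t0.
have cu := ultra_limit_continuous.
have cF := continuous_resolvent dotC dot_linear dot_norm e_orth e_basis w_cont w_ge0
  w_le1 S_coord (t := t) (continuous_forcing cu theta0_cont).
have [I bI] := continuous_bochner_integral dotC dot_linear dot_norm V_complete cF t0.
exists I => //; apply/eqP; rewrite -subr_eq0 -normr_le0; apply/ler_addgt0Pr => d d0.
(* The two errors are [a] for the solution and [a * t] for the integral, together [d]. *)
rewrite add0r; pose a := d / (t + 1).
have t1 : 0 < t + 1 by rewrite ltr_wpDl.
have a0 : 0 < a by rewrite divr_gt0.
have [j [[ju jf] [[cth _] [cj _ jeq]]]] :=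
  filter_ex (filterI (filterI (ultra_limit_uniform a0) (forcing_cvg t0 a0)) us_sol).
have [Ij bIj jE] := jeq t t0.
have cFj := continuous_resolvent dotC dot_linear dot_norm e_orth e_basis w_cont w_ge0
  w_le1 S_coord (t := t) (continuous_forcing cj cth).
have dI : `|Ij - I| <= a * t.
  apply: (bochner_dist cFj cF t0 (ltW a0) _ bIj bI) => s st.
  by apply: le_trans (resolvent_dist _ _ _) _; exact: jf.
have -> : u t - (S t (xi 0) + I) = (u t - us j t) + (Ij - I).
  by rewrite jE !opprD !addrA subrK.
apply: le_trans (ler_normD _ _) _; rewrite distrC; apply: le_trans (lerD (ju t) dI) _.
have -> : a + a * t = d by rewrite /a; field; rewrite gt_eqF.
exact: lexx.
Qed.

Lemma ultra_limit : exists u0, delayed_solution theta0 u0 /\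
  forall d : R, 0 < d -> \forall j \near U, forall t, `|us j t - u0 t| <= d.
Proof.
by exists u; split; [exact: ultra_limit_solution|exact: ultra_limit_uniform].
Qed.

End limit.

Hypothesis w0 : forall n, w n 0 = 1.

Lemma resolvent0 v : S 0 v = v.
Proof.
apply: (coord_inj dotC dot_linear dot_norm e_orth e_basis) => n.
by rewrite S_coord w0 mul1r.
Qed.

(** * Existence when the delay is bounded away from zero *)

Section shifted.
Variable h : R.
Hypotheses (h_gt0 : 0 < h) (h_le1 : h <= 1).
Let th s := theta0 s - h.

Let th_cont : continuous th.
Proof. by move=> s; apply: cvgB; [exact: theta0_cont|exact: cvg_cst]. Qed.

Lemma delay_shift : delay th.
Proof.
split => // s s0; have := theta0_le s0; rewrite /th; split; [move: h_gt0|move: h_le1]; lra.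
Qed.

(** Integrands that agree on [[0, t]] have the same set of integrals, hence the same chosen one;
    this yields [eq_bint] without uniqueness of the integral. *)
Let bint (t : R) (F : R -> V) : V := xget 0 [set I | bochner_integral leb `[0, t] F I].

Let bintP t F : 0 <= t -> continuous F -> bochner_integral leb `[0, t] F (bint t F).
Proof.
move=> t0 cF; have [I bI] := continuous_bochner_integral dotC dot_linear dot_norm
  V_complete cF t0.
by apply: (@xgetPex _ 0 [set I | bochner_integral leb `[0, t] F I]); exists I.
Qed.

Let eq_bint t F1 F2 : (forall s, 0 <= s <= t -> F1 s = F2 s) -> bint t F1 = bint t F2.
Proof.
move=> F12; congr xget; apply/seteqP; split => I /=;
  apply: eq_bochner_integral => s /=; rewrite in_itv/= => st; by rewrite F12.
Qed.

Let Phi (v : R -> V) (t : R) : V :=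
  if t <= 0 then xi t else S t (xi 0) + bint t (fun s => S (t - s) (f s (v (th s)))).

Let ok (v : R -> V) := continuous v /\ forall t, `|v t| <= r.

Let cres (g : R -> V) (t : R) : continuous g -> continuous (fun s => S (t - s) (g s)).
Proof.
exact: (continuous_resolvent dotC dot_linear dot_norm e_orth e_basis w_cont w_ge0
  w_le1 S_coord).
Qed.

Let xi_r s : `|xi s| <= r.
Proof.
apply: le_trans (xi_le s) _.
by have := mulr_ge0 kappa0 (ltW r_gt0); have := r_gt0; lra.
Qed.

Let ok_Phi v : ok v -> ok (Phi v) /\ forall t, 0 <= t -> exists2 I,
  bochner_integral leb `[0, t] (fun s => S (t - s) (f s (v (th s)))) I &
  Phi v t = S t (xi 0) + I.
Proof.
move=> [cv vr].
have cg := continuous_forcing cv th_cont.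
have gq s : 0 <= s -> `|f s (v (th s))| <= q s by move=> s0; exact: ball_forcing_le.
have eqn t : 0 <= t -> exists2 I,
    bochner_integral leb `[0, t] (fun s => S (t - s) (f s (v (th s)))) I &
    Phi v t = S t (xi 0) + I.
  rewrite le_eqVlt => /predU1P[<-|t0]; last first.
    by exists (bint t (fun s => S (t - s) (f s (v (th s)))));
      [apply: bintP (ltW t0) _; exact: cres|rewrite /Phi leNgt t0].
  (* At [t = 0] the definition of [Phi] returns [xi 0], so the chosen integral over a single point
     must be shown to vanish. *)
  have bI := bintP (lexx 0) (cres (t := 0) cg).
  exists (bint 0 (fun s => S (0 - s) (f s (v (th s))))) => //.
  rewrite /Phi lexx resolvent0.
  have iq := ball_forcing_integrable (lexx 0).
  have : `|bint 0 (fun s => S (0 - s) (f s (v (th s))))| <= \int[leb]_(s in `[0, 0]) q s.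
    apply: (le_norm_bochner dotC dot_linear dot_norm (cres (t := 0) cg) iq _ bI) => s /andP[s0 _].
    apply: le_trans (norm_resolvent dotC dot_linear dot_norm e_orth e_basis w_ge0
      w_antimono S_coord _ _) _.
    by apply: le_trans (gq s s0); rewrite ler_piMl.
  by rewrite set_itv1 Rintegral_set1 normr_le0 => /eqP ->; rewrite addr0.
have fo : forced S q (xi 0) (Phi v) by exists (fun s => f s (v (th s))).
split => //; split; last first.
  move=> t; have [t0|/ltW t0] := leP t 0; first by rewrite /Phi t0.
  have [I bI ->] := eqn t t0.
  apply: le_trans (ball_step t0 cg _ bI) _; first by move=> s /andP[s0 _]; exact: gq.
  by have := mulr_ge0 (ltW r_gt0) (ltW (_ : 0 < 1 - kappa)); rewrite subr_gt0 => /(_ kappa1); lra.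
move=> t0; apply/cvgrPdist_le => d d0.
have near_xi : \forall t \near t0, t <= 0 -> t0 <= 0 -> `|Phi v t0 - Phi v t| <= d.
  have /cvgrPdist_le/(_ _ d0) := @xi_cont t0; apply: filterS => t ht tn t0n.
  by rewrite /Phi tn t0n.
have near_f : \forall t \near t0, 0 <= t -> 0 <= t0 -> `|Phi v t0 - Phi v t| <= d.
  have [t00|t00] := leP 0 t0; last first.
    apply: (@filterS _ (nbhs t0) _ setT) => [t _ _|]; first by [].
    exact: filterT.
  have := forced_equicontinuous dotC dot_linear dot_norm e_orth e_basis w_cont w_ge0
    w_le1 w_antimono w_small S_coord (xi 0) ball_forcing_integrable ball_forcing_ge0 t00 d0.
  by apply: filterS => t ht t_ge0 _; rewrite distrC; exact: ht.
(* Near a nonzero time only one branch of [Phi] matters; at 0 both apply and agree. *)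
have near_sign : \forall t \near t0, (0 < t0 -> 0 <= t) /\ (t0 < 0 -> t <= 0).
  have [t00|t00|->] := ltgtP t0 0.
  - have : \forall t \near t0, t < 0 by exact: lt_nbhsl.
    by apply: filterS => t /ltW.
  - have : \forall t \near t0, 0 < t by exact: lt_nbhsr.
    by apply: filterS => t /ltW.
  - by apply: (@filterS _ (nbhs (0 : R)) _ setT) => [t _|]; [split|exact: filterT].
apply: filterS (filterI near_xi (filterI near_f near_sign)) => t [h1 [h2 [h3 h4]]].
have [t00|t00|t00] := ltgtP t0 0.
- by apply: h1; [exact: h4|exact: ltW].
- by apply: h2; [exact: h3|exact: ltW].
- have [tn|/ltW tp] := leP t 0; first by apply: h1 => //; rewrite t00.
  by apply: h2 => //; rewrite t00.
Qed.

Let v m := iter m Phi xi.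

Let ok_v m : ok (v m).
Proof. by elim: m => [|m IH]; [split|exact: (ok_Phi IH).1]. Qed.

(** Up to time [m.+1 * h] the delayed argument is at most [m * h], so the next iterate sees only
    values that have already settled. *)
Let v_stepE m t : t <= m%:R * h -> v m.+1 t = v m t.
Proof.
elim: m t => [|m IH] t; first by rewrite mul0r /= /Phi => ->.
move=> tm; rewrite /v !iterS -/(v m) -[Phi (v m)]/(v m.+1) /= /Phi.
case: (t <= 0); first exact: erefl.
apply: (congr1 (+%R (S t (xi 0)))); apply: eq_bint => s /andP[s0 st].
congr (S _ (f _ _)); apply: IH; have := theta0_le s0.
by move: tm; rewrite -natr1 mulrDl mul1r /th; lra.
Qed.

Let v_stable m n t : (m <= n)%N -> t <= m%:R * h -> v n t = v m t.
Proof.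
move=> /subnK <-; elim: (n - m)%N => // i IH tm.
rewrite addSn v_stepE; first exact: IH.
by apply: le_trans tm _; rewrite ler_wpM2r ?(ltW h_gt0)// ler_nat leq_addl.
Qed.

Let N (t : R) := (Num.truncn (`|t| / h)).+1.

Let tN (t : R) : t <= (N t)%:R * h.
Proof.
rewrite -ler_pdivrMr// ltW//; apply: le_lt_trans (truncnS_gt _).
by rewrite ler_pM2r ?invr_gt0// ler_norm.
Qed.

Let u (t : R) := v (N t) t.

Let uE m (t : R) : t <= m%:R * h -> u t = v m t.
Proof.
move=> tm; rewrite /u; have [mN|/ltnW Nm] := leqP m (N t); first exact: v_stable.
by rewrite (v_stable Nm).
Qed.

(* Tonelli's scheme: with a delay of at least [h] the equation is solved
   successively on the intervals of length [h]. *)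
Lemma shifted_solution : exists u0, delayed_solution th u0.
Proof.
exists u; split.
- move=> t0; apply/cvgrPdist_le => d d0; pose m := N (t0 + 1).
  have [cvm _] := ok_v m; have /cvgrPdist_le/(_ _ d0) hm := cvm t0.
  have t1 : \forall t \near t0, t < t0 + 1 by apply: lt_nbhsl; rewrite ltrDl.
  apply: filterS (filterI hm t1) => t [ht tt].
  by rewrite !(@uE m)//; apply: le_trans (tN (t0 + 1)); rewrite ?lerDl// ltW.
- by move=> t t0; rewrite (@uE 0) ?mul0r.
- move=> t t0; pose m := N t.
  have [I bI vE] := (ok_Phi (ok_v m)).2 t t0.
  exists I; last first.
    by rewrite -vE (@uE m.+1)//; apply: le_trans (tN t) _; rewrite ler_wpM2r ?(ltW h_gt0)// ler_nat.
  apply: eq_bochner_integral bI => s /=; rewrite in_itv/= => /andP[s0 st].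
  rewrite (@uE m)//; apply: le_trans (tN t); have := theta0_le s0; rewrite /th.
  by move: h_gt0; lra.
Qed.

End shifted.

Lemma delayed_solution_exists : exists u, delayed_solution theta0 u.
Proof.
have h0 k : 0 < k.+1%:R^-1 :> R by rewrite invr_gt0.
have h1 k : k.+1%:R^-1 <= 1 :> R by rewrite invf_le1// ler1n.
have /choice [us usP] : forall k, exists u : R -> V,
    delayed_solution (fun s => theta0 s - k.+1%:R^-1) u.
  by move=> k; exact: (shifted_solution (h0 k)).
have [U [UU oU]] := ultraFilterLemma (_ : ProperFilter \oo).
have [] := @ultra_limit nat U UU (fun k s => theta0 s - k.+1%:R^-1) us.
- apply: (@filterS _ U _ setT) => [k _|]; last exact: filterT.
  by split; [exact: (delay_shift (h0 k) (h1 k))|exact: usP].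
- move=> d d0; apply: oU.
  have hd : \forall k \near \oo, `|0 - harmonic k| <= d.
    exact: (iffLR (cvgrPdist_le _ _) (@cvg_harmonic R) _ d0).
  apply: (@filterS _ \oo _ _ _ _ hd) => k; rewrite sub0r normrN => hk s.
  by rewrite [_ - _ - _]addrAC subrr sub0r normrN.
- by move=> u [su _]; exists u.
Qed.

Lemma delayed_solution_cluster (J : Type) (U : set_system J) (us : J -> R -> V) :
  UltraFilter U -> (\forall j \near U, delayed_solution theta0 (us j)) ->
  exists u, delayed_solution theta0 u /\
    forall d, 0 < d -> \forall j \near U, forall t, `|us j t - u t| <= d.
Proof.
move=> UU usP; apply: (@ultra_limit J U UU (fun=> theta0) us).
  apply: filterS usP => j uj; split => //; split => // s s0; split; first exact: theta0_le.
  by rewrite gerBl.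
move=> d d0; apply: (@filterS _ U _ setT) => [j _ s|]; last exact: filterT.
by rewrite subrr normr0 ltW.
Qed.

Lemma delayed_solution_cvg0 u : delayed_solution theta0 u ->
  forall eps, 0 < eps -> exists T, forall t, T <= t -> `|u t| <= eps.
Proof.
move=> su eps eps0; have [T hT] := delayed_solution_decay eps0.
exists T; apply: (hT _ _ _ su); split => // s s0; split; first exact: theta0_le.
by rewrite gerBl.
Qed.

End delayed_equation.

(** * Decay solutions *)

(** The upper limit is an infimum of suprema over punctured neighbourhoods, so one of these suprema
    is already below [1 / M]; it is a real number [k], and [kappa = M * k]. For [M = 0] anything
    works. *)
Lemma limsup_linear_bound (R : realType) (G : R -> R) (M : R) : 0 <= M ->
    (forall s : R, 0 <= s -> 0 <= G s) ->
    (limf_esup (fun r : R => (G r / r)%:E) (at_right 0%R) * M%:E < 1)%E ->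
  exists r kappa : R, [/\ 0 < r, 0 <= kappa < 1 &
    forall s, 0 < s <= r -> M * G s <= kappa * s].
Proof.
move=> M0 G0; move: M0; rewrite le_eqVlt => /predU1P[<- _|M0].
  by exists 1, 0; split => //; [rewrite lexx ltr01|move=> s _; rewrite !mul0r].
rewrite -lte_pdivlMr// => /ereal_inf_lt[y [W W0 <-{y}]] supW.
have [d /= d0 dW] := iffLR (nbhs_ballP _ _) W0.
have {}dW s : 0 < s < d -> W s.
  by move=> /andP[s0 sd]; apply: dW => //; rewrite /ball/= sub0r normrN gtr0_norm.
have d2 : 0 < d / 2 by rewrite divr_gt0.
have supP s : 0 < s <= d / 2 ->
    ((G s / s)%:E <= ereal_sup ((fun r : R => (G r / r)%:E) @` W))%E.
  move=> /andP[s0 sd]; apply: ereal_sup_ubound; exists s => //; apply: dW.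
  by rewrite s0/=; lra.
have {supW} [k kE k1] : exists2 k : R, ereal_sup ((fun r : R => (G r / r)%:E) @` W) = k%:E &
    k < M^-1.
  move: supW (supP (d / 2)); rewrite d2 lexx => + /(_ isT).
  by case: ereal_sup => [k||] //; rewrite mul1e ?lte_fin => kM _; exists k.
rewrite kE in supP.
exists (d / 2), (M * k); split => //.
  apply/andP; split; last by rewrite -lter_pdivlMl// mulr1.
  rewrite mulr_ge0 ?(ltW M0)//; have := supP (d / 2).
  rewrite d2 lexx lee_fin => /(_ isT); apply: le_trans.
  by rewrite divr_ge0 ?G0 ?(ltW d2).
move=> s sd; have /andP[s0 _] := sd; rewrite -mulrA ler_wpM2l ?(ltW M0)//.
by have := supP s sd; rewrite lee_fin ler_pdivrMr.
Qed.

Lemma conv_uptoE (R : realType) (k p : R -> R) (b t : R) : continuous (nneg_ext k) ->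
    lebesgue_measure.-integrable `[0, b] (EFin \o p) -> b <= t ->
  conv_upto k p b t =
    (\int[@lebesgue_measure R]_(s in `[0, b]) (nneg_ext k (t - s) * p s))%:E.
Proof.
move=> ck ip bt.
have cg : continuous (fun s : R => nneg_ext k (t - s)).
  move=> s; apply: continuous_comp; last exact: ck.
  by apply: continuousB; [exact: cvg_cst|exact: cvg_id].
have i := integrable_continuousM cg ip.
transitivity (\int[@lebesgue_measure R]_(s in `[0%R, b]) (nneg_ext k (t - s) * p s)%:E)%E.
  apply: eq_integral => s; rewrite inE/= in_itv/= => /andP[_ sb].
  by rewrite nneg_ext_id// subr_ge0 (le_trans sb).
by rewrite fineK//; apply: integrable_fin_num => //; exact: measurable_itv.
Qed.

(** [sup] is an upper bound only for sets that are bounded above, which continuity on the compact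
    segment ensures. *)
Lemma le_sup_norm (R : realType) (V : normedModType R) (xi : R -> V) (a b delta : R) :
    {within `[a, b], continuous xi} -> sup [set `|xi s| | s in `[a, b]] <= delta ->
  forall s, a <= s <= b -> `|xi s| <= delta.
Proof.
move=> cxi; apply: contraPP => /existsNP[s].
move=> /not_implyP[sab /negP]; rewrite -ltNge => ds; apply/negP; rewrite -ltNge.
apply: lt_le_trans ds _; apply: ub_le_sup; last by exists s => //=; rewrite in_itv.
have : compact ((Num.norm : V -> R) @` (xi @` `[a, b])).
  apply: continuous_compact; last first.
    by apply: continuous_compact; [exact: cxi|exact: segment_compact].
  by apply: continuous_subspaceT; exact: norm_continuous.
move=> /compact_bounded[M [_ /(_ (M + 1))]]; rewrite ltrDl ltr01 => /(_ isT) H.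
exists (M + 1) => _ [x xab <-].
by rewrite -[`|xi x|]normr_id; apply: H; exists (xi x) => //; exists x.
Qed.

(** * The modes of the resolvent *)

Section relaxation_family.
Context (R : realType) (gamma alpha : R) (omega : R -> R -> R) (lambda : nat -> R).
Hypotheses (gamma_gt0 : 0 < gamma) (alpha01 : 0 < alpha < 1)
  (omegaP : forall mu, 0 < mu -> relaxation_solution gamma alpha mu (omega ^~ mu))
  (lambda_gt0 : 0 < lambda 0%N)
  (lambda_ndecr : forall m n, (m <= n)%N -> lambda m <= lambda n)
  (lambda_lim : lambda n @[n --> \oo] --> +oo).

Let lambda_pos n : 0 < lambda n.
Proof. exact: lt_le_trans (lambda_ndecr (leq0n n)). Qed.

Let max0 (s : R) : 0 <= Num.max 0 s. Proof. by rewrite le_max lexx. Qed.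

Definition modes n := nneg_ext (omega ^~ (lambda n)).

Lemma continuous_modes n : continuous (modes n).
Proof. exact: continuous_relaxation (omegaP (lambda_pos n)). Qed.

Lemma modes0 n : modes n 0 = 1.
Proof. by rewrite /modes nneg_ext_id//; case: (omegaP (lambda_pos n)). Qed.

Lemma modes_ge0 n s : 0 <= modes n s.
Proof. exact: relaxation_ge0 gamma_gt0 alpha01 _ _ _ (lambda_pos n) (omegaP _) _. Qed.

Lemma modes_le1 n s : modes n s <= 1.
Proof. exact: relaxation_le1 gamma_gt0 alpha01 _ _ _ (lambda_pos n) (omegaP _) _. Qed.

Lemma modes_antimono m n s : (m <= n)%N -> modes n s <= modes m s.
Proof.
move=> mn; apply: (relaxation_antimono_param gamma_gt0 alpha01 (lambda_pos m)
  (lambda_ndecr mn) (omegaP (lambda_pos m)) (omegaP (lambda_pos n)) (max0 s)).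
Qed.

(** From [w s * (1 + lambda n * s) <= 1]. Used for large [n] with [eta] fixed, and for [n = 0] with
    [eta] large. *)
Let modes_inv n eta eps s : 0 < eta -> 0 < eps -> (eps * eta)^-1 <= lambda n -> eta <= s ->
  modes n s <= eps.
Proof.
move=> eta0 eps0 hl es; have s0 : 0 <= s by exact: le_trans (ltW eta0) es.
have := relaxation_decay gamma_gt0 alpha01 (lambda_pos n) (omegaP (lambda_pos n)) s0.
rewrite -(nneg_ext_id (omega^~ (lambda n)) s0) -/(modes n s) => dec.
have h1 : eps^-1 <= lambda n * s.
  apply: le_trans (_ : lambda n * eta <= _); last by rewrite ler_pM2l.
  by rewrite -ler_pdivrMr// -invfM.
rewrite -[leRHS]invrK -[leRHS]mul1r ler_pdivlMr ?invr_gt0//; apply: le_trans dec.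
by rewrite ler_wpM2l ?modes_ge0//; lra.
Qed.

Lemma modes_small eta eps : 0 < eta -> 0 < eps ->
  exists N, forall s, eta <= s -> modes N s <= eps.
Proof.
move=> eta0 eps0.
have [N _ hN] : \forall n \near \oo, (eps * eta)^-1 <= lambda n.
  by move/cvgryPge: lambda_lim; apply.
by exists N => s; apply: modes_inv => //; exact: (hN N (leqnn N)).
Qed.

Lemma modes_lim eps : 0 < eps -> exists T, forall s, T <= s -> modes 0 s <= eps.
Proof.
move=> eps0; exists (eps * lambda 0%N)^-1 => s.
apply: modes_inv => //; first by rewrite invr_gt0 mulr_gt0.
by rewrite invfM invrK mulrA mulVf ?mul1r// gt_eqF.
Qed.

End relaxation_family.

Section L2_resolvent.
Context d (T : measurableType d) (R : realType) (mu : {measure set T -> \bar R})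
  (phi : nat -> LspaceType2 mu) (omega : R -> R -> R) (lambda : nat -> R).
Hypotheses (phi_basis : orthonormal_basis phi)
  (bound : forall n s, `|modes omega lambda n s| <= 1).

Lemma dot_resolvent t v n :
  L2dot (nneg_ext (resolvent omega lambda phi) t v) (phi n) =
  modes omega lambda n t * L2dot v (phi n).
Proof.
exact: (dot_diagonal (@L2dotC _ _ _ mu) (@L2dot_linear _ _ _ mu) (@L2dot_norm _ _ _ mu)
  (@Lspace2_complete _ _ _ mu) phi_basis.1 phi_basis.2 v n (bound^~ t)).
Qed.

End L2_resolvent.

(** * Mild solutions as solutions of the delayed equation *)

Section mild.
Context (R : realType) (V : normedModType R) (S f : R -> V -> V) (tau : R) (rho : R -> R)
  (xi : R -> V).
Hypotheses (tau_ge0 : 0 <= tau) (rho_cont : {within `[0, +oo[, continuous rho})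
  (rho_bd : forall t, 0 <= t -> - tau <= t - rho t <= t).

Definition delayed_time (s : R) : R := s - rho s.
Definition history_ext (s : R) : V := xi (Num.max (- tau) (Num.min 0 s)).

Let history_extE s : - tau <= s <= 0 -> history_ext s = xi s.
Proof. by move=> /andP[ts s0]; rewrite /history_ext min_r// max_r. Qed.

(** Delayed times never fall below [- tau], so freezing [u] to the left of [- tau] leaves the
    equation unchanged. *)
Lemma mild_delayed u : mild_solution S tau rho f xi u ->
  delayed_solution (nneg_ext S) (nneg_ext f) history_ext (nneg_ext delayed_time)
    (u \o Num.max (- tau)).
Proof.
move=> [cu uxi ueq]; split.
- apply: continuous_clamp cu; first exact: continuous_maxl.
  by move=> s; rewrite /= in_itv/= andbT le_max lexx.
- move=> s s0 /=; rewrite /history_ext min_r// uxi// le_max lexx /=.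
  by rewrite ge_max s0 oppr_le0 tau_ge0.
- move=> t t0 /=; have [I bI uE] := ueq t t0; exists I; last first.
    have tt : - tau <= t by apply: le_trans t0; rewrite oppr_le0.
    by rewrite max_r// uE nneg_ext_id// history_extE// oppr_le0 tau_ge0 lexx.
  apply: eq_bochner_integral bI => s /=; rewrite in_itv/= => /andP[s0 st].
  have /andP[rs _] := rho_bd s0.
  by rewrite !nneg_ext_id ?subr_ge0// max_r.
Qed.

Lemma delayed_mild u :
  delayed_solution (nneg_ext S) (nneg_ext f) history_ext (nneg_ext delayed_time) u ->
  mild_solution S tau rho f xi u.
Proof.
move=> [cu uxi ueq]; split; first exact: continuous_subspaceT.
- by move=> s sP; rewrite uxi ?history_extE//; case/andP: sP.
- move=> t t0 /=; have [I bI uE] := ueq t t0; exists I; last first.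
    by rewrite uE nneg_ext_id// history_extE// oppr_le0 tau_ge0 lexx.
  apply: eq_bochner_integral bI => s /=; rewrite in_itv/= => /andP[s0 st].
  by rewrite !nneg_ext_id ?subr_ge0.
Qed.

Lemma continuous_history_ext : {within `[- tau, 0], continuous xi} -> continuous history_ext.
Proof.
pose c (s : R) : R := Num.max (- tau) (Num.min 0 s).
have cmin : continuous (Num.min (0 : R)).
  by move=> s; apply: (@continuous_min R R); [exact: cvg_cst|exact: cvg_id].
have cc : continuous c.
  by move=> s; exact: (continuous_comp (cmin s) (@continuous_maxl _ (- tau) _)).
have Ac s : `[- tau, 0]%classic (c s).
  rewrite /= in_itv/= /c le_max lexx /= ge_max oppr_le0 tau_ge0/=.
  by rewrite ge_min lexx.
exact: continuous_clamp cc Ac.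
Qed.

Lemma continuous_delayed_time : continuous (nneg_ext delayed_time).
Proof.
move=> s; apply: continuousB; last exact: continuous_nneg_ext.
exact: continuous_maxl.
Qed.

Lemma delayed_time_le s : 0 <= s -> nneg_ext delayed_time s <= s.
Proof. by move=> s0; rewrite nneg_ext_id//; case/andP: (rho_bd s0). Qed.

Lemma delayed_time_lim : t - rho t @[t --> +oo] --> +oo ->
  forall A, exists T, forall s, T <= s -> A <= nneg_ext delayed_time s.
Proof.
move=> /cvgryPge lim A; have [M [_ hM]] := lim A; exists (Num.max 0 (M + 1)) => s.
rewrite ge_max => /andP[s0 Ms]; rewrite nneg_ext_id//; apply: hM.
by apply: lt_le_trans Ms; rewrite ltrDl.
Qed.

End mild.

Lemma continuous_nneg_ext2 (R : realType) (V W : normedModType R) (f : R -> V -> W) :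
  {within [set tv : R * V | 0 <= tv.1], continuous (fun tv => f tv.1 tv.2)} ->
  continuous (fun tv : R * V => nneg_ext f tv.1 tv.2).
Proof.
pose c (tv : R * V) : R * V := (Num.max 0 tv.1, tv.2).
have cc : continuous c.
  move=> tv; apply: (@cvg_pair _ _ _ (nbhs tv) (nbhs (Num.max 0 tv.1)) (nbhs tv.2)).
    have c1 : {for tv, continuous (fst : R * V -> R)} by exact: cvg_fst.
    exact: (continuous_comp c1 (@continuous_maxl _ 0 _)).
  exact: cvg_snd.
have Ac tv : [set tv : R * V | 0 <= tv.1] (c tv) by rewrite /= le_max lexx.
exact: continuous_clamp cc Ac.
Qed.

Lemma cvg_uniform_ball (R : realType) (V : normedModType R) (A : set R)
    (F : set_system {uniform` A -> V}) (u : {uniform` A -> V}) : Filter F ->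
  (forall eps : R, 0 < eps -> \forall g \near F, forall t, A t -> `|g t - u t| < eps) ->
  F --> u.
Proof.
move=> FF h P /uniform_nbhs[E [entE sub]].
move: entE; rewrite -entourage_ballE => -[eps /= eps0 ballE].
apply: filterS (h eps eps0) => g gu; apply: sub => t At.
by apply: ballE; rewrite /= -ball_normE /= distrC; exact: gu.
Qed.

(* [lambda n] and [phi n] are the (n+1)-st eigenvalue and eigenfunction *)
Theorem theorem4p3 (R : realType) (d : nat) (d_gt0 : (0 < d)%N)
  (Omega : set 'rV[R]_d) (oOmega : open Omega)
  (domOmega : bounded_smooth_domain Omega)
  (gamma alpha tau : R) (gamma_gt0 : 0 < gamma) (alpha01 : 0 < alpha < 1)
  (tau_ge0 : 0 <= tau)
  (rho : R -> R) (rho_cont : {within `[0, +oo[, continuous rho})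
  (rho_bd : forall t : R, 0 <= t -> - tau <= t - rho t <= t)
  (rho_lim : t - rho t @[t --> +oo] --> +oo)
  (omega : R -> R -> R)
  (omegaP : forall mu : R, 0 < mu -> relaxation_solution gamma alpha mu (omega ^~ mu))
  (lambda : nat -> R) (phi : nat -> L2 oOmega)
  (lambda_gt0 : 0 < lambda 0%N)
  (lambda_ndecr : forall m n, (m <= n)%N -> lambda m <= lambda n)
  (lambda_lim : lambda n @[n --> \oo] --> +oo)
  (phi_basis : orthonormal_basis phi)
  (phi_eigen : forall n, dirichlet_eigenfunction (lambda n) (phi n))
  (f : R -> L2 oOmega -> L2 oOmega)
  (f_cont : {within [set tv : R * L2 oOmega | 0 <= tv.1],
     continuous (fun tv => f tv.1 tv.2)})
  (p G : R -> R)
  (f_le : forall (t : R) (v : L2 oOmega), 0 <= t -> `|f t v| <= p t * G `|v|)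
  (p_ge0 : forall t : R, 0 <= t -> 0 <= p t)
  (p_loc : forall t : R, 0 <= t ->
     lebesgue_measure.-integrable `[0, t] (EFin \o p))
  (G_cont : {within `[0, +oo[, continuous G})
  (G_ge0 : forall r : R, 0 <= r -> 0 <= G r)
  (G_ndecr : forall r s : R, 0 <= r -> r <= s -> G r <= G s)
  (* rules out the undefined product 0 * oo in [G_small] *)
  (kp_fin : (sup_conv (omega^~ (lambda 0%N)) p < +oo)%E)
  (G_small : (limf_esup (fun r : R => (G r / r)%:E) (at_right 0%R) *
              sup_conv (omega^~ (lambda 0%N)) p < 1)%E)
  (tail : ereal_sup [set conv_upto (omega^~ (lambda 0%N)) p (t / 2) t |
            t in [set t : R | T <= t]] @[T --> +oo] --> 0%E) :
  exists2 delta : R, 0 < delta &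
    forall xi : R -> L2 oOmega, {within `[- tau, 0], continuous xi} ->
      sup [set `|xi s| | s in `[- tau, 0]] <= delta ->
      let sols := decay_solutions (resolvent omega lambda phi) tau rho f xi in
      sols !=set0 /\ compact sols.
Proof.
set S := resolvent omega lambda phi; set w := modes omega lambda.
have wc n : continuous (w n) by exact: (continuous_modes omegaP).
have w_ge0 n s : 0 <= w n s by exact: (modes_ge0 gamma_gt0 alpha01 omegaP).
have w_le1 n s : w n s <= 1 by exact: (modes_le1 gamma_gt0 alpha01 omegaP).
have w_anti m n s : (m <= n)%N -> w n s <= w m s.
  exact: (modes_antimono gamma_gt0 alpha01 omegaP).
have w_small eta eps : 0 < eta -> 0 < eps -> exists N, forall s, eta <= s -> w N s <= eps.
  exact: (modes_small gamma_gt0 alpha01 omegaP).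
have w_lim eps : 0 < eps -> exists T, forall s, T <= s -> w 0 s <= eps.
  exact: (modes_lim gamma_gt0 alpha01 omegaP).
have w0 n : w n 0 = 1 by exact: (modes0 omegaP).
have S_coord t v n : L2dot (nneg_ext S t v) (phi n) = w n t * L2dot v (phi n).
  by apply: dot_resolvent => // m s; rewrite ger0_norm ?w_le1.
have supM t : 0 <= t ->
    ((\int[@lebesgue_measure R]_(s in `[0, t]) (w 0 (t - s) * p s))%:E <=
     sup_conv (omega^~ (lambda 0%N)) p)%E.
  move=> t0; rewrite -conv_uptoE; [|exact: wc|exact: p_loc|exact: lexx].
  by apply: ereal_sup_ubound; exists t.
(* [kp_fin] excludes [+oo], and the value at [t = 0] bounds the supremum from below, excluding
   [-oo]. *)
have [M supE] : exists M : R, sup_conv (omega^~ (lambda 0%N)) p = M%:E.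
  by move: kp_fin (supM 0 (lexx 0)); case: sup_conv => [M||] // _ _; exists M.
rewrite supE in G_small supM.
have p_conv t : 0 <= t ->
    \int[@lebesgue_measure R]_(s in `[0, t]) (w 0 (t - s) * p s) <= M.
  by move=> t0; rewrite -lee_fin; exact: supM.
have M0 : 0 <= M.
  apply: le_trans (p_conv 0 (lexx 0)); apply: Rintegral_ge0 => s.
  by rewrite /= in_itv/= => /andP[s0 _]; rewrite mulr_ge0 ?p_ge0.
have [r [kappa [r0 kappa01 G_kappa]]] := limsup_linear_bound M0 G_ge0 G_small.
have p_tail eps : 0 < eps -> exists T, forall t, T <= t ->
    \int[@lebesgue_measure R]_(s in `[0, t / 2]) (w 0 (t - s) * p s) <= eps.
  move=> eps0.
  have nb : nbhs (0%E : \bar R) [set x | (x < eps%:E)%E].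
    have : \forall x \near (0 : R), x < eps by exact: lt_nbhsl.
    by apply: filterS => x; rewrite /= lte_fin.
  have [T [_ /(_ (T + 1))]] := tail _ nb; rewrite ltrDl ltr01 => /(_ isT) /= hT.
  exists (Num.max 0 (T + 1)) => t; rewrite ge_max => /andP[t0 Tt].
  rewrite -lee_fin -conv_uptoE; [|exact: wc|by apply: p_loc; lra|by lra].
  by apply: le_trans (ltW hT); apply: ereal_sup_ubound; exists t.
exists ((1 - kappa) * r / 2).
  by case/andP: kappa01 => _ k1; rewrite divr_gt0 ?mulr_gt0 ?subr_gt0.
move=> xi xi_cont xi_sup sols.
have xi_le s : `|history_ext tau xi s| <= (1 - kappa) * r / 2.
  apply: (le_sup_norm xi_cont xi_sup); rewrite le_max lexx ge_max oppr_le0 tau_ge0/=.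
  by rewrite ge_min lexx.
have f_le' t v : 0 <= t -> `|nneg_ext f t v| <= p t * G `|v|.
  by move=> t0; rewrite nneg_ext_id// f_le.
pose delayed := delayed_solution (nneg_ext S) (nneg_ext f) (history_ext tau xi)
  (nneg_ext (delayed_time rho)).
have xi_cont' := continuous_history_ext tau_ge0 xi_cont.
have f_cont' := continuous_nneg_ext2 f_cont.
have th_cont := continuous_delayed_time rho_cont.
have th_le := delayed_time_le rho_bd.
have th_lim := delayed_time_lim rho_lim.
have delayed_sols u : delayed u -> sols u.
  move=> su; split; first exact: delayed_mild su.
  split; first by apply: continuous_subspaceT; case: su.
  apply/cvgrPdist_le => eps eps0.
  have [T hT] := delayed_solution_cvg0 (@L2dotC _ _ _ _) (@L2dot_linear _ _ _ _)
    (@L2dot_norm _ _ _ _) phi_basis.1 phi_basis.2 wc w_ge0 w_le1 w_anti w_lim S_coord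
    f_cont' p_loc p_ge0 G_ge0 G_ndecr f_le' p_conv r0 kappa01 G_kappa p_tail xi_le
    th_cont th_le th_lim su eps0.
  by exists T; split; [exact: num_real|move=> t /ltW Tt; rewrite sub0r normrN; exact: hT].
split.
  have [u su] := delayed_solution_exists (@L2dotC _ _ _ _) (@L2dot_linear _ _ _ _)
    (@L2dot_norm _ _ _ _) phi_basis.1 phi_basis.2 wc w_ge0 w_le1 w_anti w_small w_lim
    S_coord f_cont' p_loc p_ge0 G_ge0 G_ndecr f_le' p_conv r0 kappa01 G_kappa p_tail
    xi_cont' xi_le th_cont th_le th_lim (@Lspace2_complete _ _ _ _) w0.
  by exists u; exact: delayed_sols.
rewrite compact_ultra => U UU Usols.
(* Members of the function space have arbitrary values before [- tau]; clamping makes them solutions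
   on the whole line. *)
pose us (g : {uniform` (`[0, +oo[%classic : set R) -> L2 oOmega}) : R -> L2 oOmega :=
  (g : R -> L2 oOmega) \o Num.max (- tau).
have us_delayed : \forall g \near U, delayed (us g).
  by apply: filterS Usols => g [gm _]; exact: mild_delayed gm.
have [u [su u_lim]] := delayed_solution_cluster (@L2dotC _ _ _ _) (@L2dot_linear _ _ _ _)
  (@L2dot_norm _ _ _ _) phi_basis.1 phi_basis.2 wc w_ge0 w_le1 w_anti w_small w_lim
  S_coord f_cont' p_loc p_ge0 G_ge0 G_ndecr f_le' p_conv r0 kappa01 G_kappa p_tail
  xi_le th_cont th_le th_lim (@Lspace2_complete _ _ _ _) UU us_delayed.
exists u; split; first exact: delayed_sols.
apply: cvg_uniform_ball => eps eps0.
have eps2 : 0 < eps / 2 by rewrite divr_gt0.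
apply: filterS (u_lim _ eps2) => g hg t; rewrite /= in_itv/= andbT => t0.
have := hg t; rewrite /us /= max_r; last by apply: le_trans t0; rewrite oppr_le0.
by move=> ht; apply: le_lt_trans ht _; lra.
Qed.
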